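(* Let $k \le 6$ be a positive integer, and let $M_k$ be the $k!\times k!$ limit second-moment matrix of the normalized $k$-profile, $M_k = \lim_{n\to\infty} E\big[\mathbf{\tilde P}_{kn}\mathbf{\tilde P}_{kn}^{\,T}\big]$. There exist an orthogonal $k!$-by-$k!$ matrix $U_k$ and a strictly positive diagonal matrix $D_k$ (i.e. diagonal with all diagonal entries positive) such that $$ U_k^T M_k U_k \;=\; D_k $$ and the columns of $U_k$ are the normalized matrix elements $$\left\{\sqrt{\tfrac{d_{\lambda}}{k!}}\;\mathbf{R}^{\lambda}_{ij}\right\}_{\lambda \vdash k,\;1 \leq i,j \leq d_{\lambda}}$$ of orthogonal simple $S_k$-representations $\{R^\lambda\}_{\lambda \vdash k}$, i.e. for each $\lambda \vdash k$, $R^\lambda$ is some realization of the simple representation $\rho^\lambda$ by real orthogonal $d_\lambda \times d_\lambda$ matrices $R^\lambda(\sigma)$, $\sigma \in S_k$.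
   Context: **Patterns and profiles.** For $\pi \in S_n$, $k \le n$ and positions $a_1 < \dots < a_k$ in $\{1,\dots,n\}$, the pattern induced by $\pi$ at these positions is the unique $\sigma \in S_k$ with $\sigma(i)<\sigma(j) \iff \pi(a_i)<\pi(a_j)$ for all $i,j$. For $\sigma \in S_k$, $N_\sigma(\pi)$ is the number of $k$-subsets of positions at which $\pi$ induces $\sigma$, and the density of $\sigma$ in $\pi$ is $P_\sigma(\pi) = N_\sigma(\pi)/\binom{n}{k}$. The $k$-profile of $\pi$ is the vector $\mathbf{P}_k(\pi) = (P_\sigma(\pi))_{\sigma \in S_k} \in \mathbb{R}^{k!}$, where $\mathbb{R}^{k!}$ has coordinates indexed by $S_k$ and the standard inner product. For $\pi$ uniformly distributed in $S_n$, the random vector $\mathbf{P}_k(\pi)$ (a column vector) is denoted $\mathbf{P}_{kn}$ (for $n \ge k$). **Representations and the subspaces $V_r$.** A partition $\lambda \vdash k$ is a nonincreasing sequence of positive integers $\lambda_1 \ge \dots \ge \lambda_\ell \ge 1$ with sum $k$. For each $\lambda \vdash k$, $\rho^\lambda$ is the corresponding simple (irreducible) real representation of $S_k$, defined up to similarity: the left action of $S_k$ on $A c_\lambda$, where $A = \mathbb{R}S_k$ is the group algebra and $c_\lambda = \left(\sum_{\sigma \in P_T} \sigma\right)\left(\sum_{\sigma \in Q_T} \mathrm{sign}(\sigma)\sigma\right)$ is the Young symmetrizer of any tableau $T$ of shape $\lambda$ (a filling of the Young diagram of $\lambda$, with row lengths $\lambda_i$, by $1,\dots,k$, each once), $P_T$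 and $Q_T$ being the subgroups of permutations preserving each row, respectively each column, of $T$. Thus $\lambda=(k)$ gives the trivial representation and $\lambda = (1,\dots,1)$ the sign representation. Let $d_\lambda = \dim \rho^\lambda$; one has $\sum_{\lambda\vdash k} d_\lambda^2 = k!$. If $\rho^\lambda$ is given by real matrices $R^\lambda(\sigma) \in \mathbb{R}^{d_\lambda\times d_\lambda}$, $\sigma \in S_k$, its matrix elements are the vectors $\mathbf{R}^\lambda_{ij} = (R^\lambda_{ij}(\sigma))_{\sigma \in S_k} \in \mathbb{R}^{k!}$, $1 \le i,j \le d_\lambda$; their span does not depend on the choice of matrices. For $r \in \{0,\dots,k-1\}$, $$V_r := \mathrm{span}\{\mathbf{R}^\lambda_{ij} : \lambda \vdash k,\ \lambda_1 = k-r,\ 1\le i,j\le d_\lambda\}.$$ The subspaces $V_0,\dots,V_{k-1}$ are mutually orthogonal and $\mathbb{R}^{k!} = V_0 \oplus \dots \oplus V_{k-1}$; $\Pi_r : \mathbb{R}^{k!} \to V_r$ is the orthogonal projection. **Normalized profile.** $\mathbf{\tilde{P}}_{kn} := \sum_{r=0}^{k-1} n^{r/2} \,\Pi_r \mathbf{P}_{kn}$, and $M_k := \lim_{n \to \infty} E\big[ \mathbf{\tilde{P}}_{kn} \mathbf{\tilde{P}}_{kn}^{\,T} \big] \in \mathbb{R}^{k!\times k!}$, with rows and columns indexed by $S_k$. *)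

(* Defs.v *)
From mathcomp Require Export all_boot all_order all_algebra all_fingroup.
From mathcomp Require Export mxrepresentation.
From mathcomp Require Export boolp classical_sets reals topology normedtype
  sequences exp.

Set Implicit Arguments.
Unset Strict Implicit.
Unset Printing Implicit Defensive.

Import Order.TTheory GRing.Theory Num.Theory.
Import numFieldNormedType.Exports.

Local Open Scope ring_scope.

(* MathComp composes permutations from left to right: (s * t)%g x = t (s x).
   All products below are meant in the usual order s \o t, that is (t * s)%g. *)

(* Coordinates of R^{k!} are indexed by S_k through enum_val / gring_index.
   Vectors of R^{k!} are row vectors throughout. *)
Notation nSym k := #|[set: 'S_k]|.

Section Patterns.
Local Open Scope nat_scope.
Variables k n : nat.

(* [a] is the increasing enumeration a_1 < ... < a_k of the positions [A]. *)
Definition induces (pi : 'S_n) (A : {set 'I_n}) (s : 'S_k) : bool :=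
  [exists a : {ffun 'I_k -> 'I_n},
    [&& [forall i : 'I_k, forall j : 'I_k, (i < j) ==> (a i < a j)],
        A == [set a i | i : 'I_k] &
        [forall i, forall j, (s i < s j) == (pi (a i) < pi (a j))]]].

Definition occurrences (s : 'S_k) (pi : 'S_n) : nat :=
  #|[set A : {set 'I_n} | (#|A| == k) && induces pi A s]|.

End Patterns.

Definition density (R : realType) (k n : nat) (s : 'S_k) (pi : 'S_n) : R :=
  (occurrences s pi)%:R / 'C(n, k)%:R.

Definition profile (R : realType) (k n : nat) (pi : 'S_n) : 'rV[R]_(nSym k) :=
  \row_a density R (enum_val a : 'S_k) pi.

Definition is_partition (k : nat) (la : seq nat) : bool :=
  [&& sorted geq la, 0%N \notin la & sumn la == k].

(* A partition of k has at most k parts, each at most k; hence this finite type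
   contains all of them. *)
Definition intpart (k : nat) :=
  {la : k.-bseq 'I_k.+1 | is_partition k [seq val i | i <- la]}.

Definition parts (k : nat) (la : intpart k) : seq nat :=
  [seq nat_of_ord i | i <- val la].

Section Specht.
Variables (R : realType) (k : nat).

Local Notation G := [set: 'S_k]%G.

(* A filling of a diagram is given by the box (row, column) of each entry. *)
Definition row_group (T : 'I_k -> nat * nat) : {set 'S_k} :=
  [set p : 'S_k | [forall i, (T (p i)).1 == (T i).1]].
Definition col_group (T : 'I_k -> nat * nat) : {set 'S_k} :=
  [set q : 'S_k | [forall i, (T (q i)).2 == (T i).2]].

Definition young_symmetrizer (T : 'I_k -> nat * nat) : 'rV[R]_(nSym k) :=
  \sum_(p in row_group T) \sum_(q in col_group T)
    (-1) ^+ q *: delta_mx 0 (gring_index G (q * p)%g).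

(* The tableau of shape la filled row by row; any other tableau of the same shape
   gives a similar representation. *)
Definition tableau (la : intpart k) (i : 'I_k) : nat * nat :=
  (reshape_index (parts la) i, reshape_offset (parts la) i).

(* MathComp's regular representation acts on the right: x sends e_s to
   e_(s * x)%g, i.e. to e_(x \o s). In the usual order of composition this is the
   left regular action, and the cyclic module generated by c is A c. *)
Definition simple_mx (la : intpart k) : 'M[R]_(nSym k) :=
  cyclic_mx (regular_repr R G) (young_symmetrizer (tableau la)).

Definition dim_simple (la : intpart k) : nat := \rank (simple_mx la).

Definition simple_repr (la : intpart k) :
    mx_representation R G (dim_simple la) :=
  submod_repr (cyclic_mx_module (regular_repr R G)
                 (young_symmetrizer (tableau la))).

(* Matrices of a mx_representation act on row vectors and reverse the order of
   composition; the usual matrix of s, acting on columns, is (rho s)^T. *)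
Definition matrix_element (d : nat) (rho : mx_representation R G d)
    (i j : 'I_d) : 'rV[R]_(nSym k) :=
  \row_a (rho (enum_val a))^T i j.

Definition Vsub (r : nat) : 'M[R]_(nSym k) :=
  (\sum_(la : intpart k | head 0%N (parts la) == (k - r)%N)
   \sum_(i < dim_simple la) \sum_(j < dim_simple la)
     <<matrix_element (simple_repr la) i j>>)%MS.

(* The kernel of W^T is the orthogonal complement of the row space of W. *)
Definition proj_V (r : nat) (v : 'rV[R]_(nSym k)) : 'rV[R]_(nSym k) :=
  v *m proj_mx (Vsub r) (kermx (Vsub r)^T).

Definition normalized_profile (n : nat) (pi : 'S_n) : 'rV[R]_(nSym k) :=
  \sum_(r < k) (n%:R `^ (r%:R / 2)) *: proj_V r (profile R k pi).

Definition second_moment (n : nat) : 'M[R]_(nSym k) :=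
  (n`!)%:R^-1 *:
  \sum_(pi : 'S_n) (normalized_profile pi)^T *m normalized_profile pi.

Definition limit_second_moment : 'M[R]_(nSym k) := limn second_moment.

End Specht.

(* Main.v *)
(* Label the points of a random permutation.  The pattern on a set of k labels is
   a^-1 b, where a and b are the standardizations of the abscissas and of the
   ordinates of those labels, so the matrix elements of an orthogonal representation
   factor.  Hence E[P P^T] is a sum over the number m of labels shared by two k-sets,
   with weights of order n^-m, of products of two copies of the average of
   rho(std A) (x) rho'(std B) over all relative orders of A u B.  A symmetrizer on
   more than lambda_1 points kills the Specht module of lambda, so these averages
   vanish for m < k - lambda_1; for m = r = k - lambda_1 a double coset argument and
   Schur's lemma make the average a multiple nu of the invariant projection.  In the
   limit the blocks of different lambda decouple, and the block of lambda is
   nu (x) nu up to a scalar, which an orthogonal change of basis diagonalizes.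
   Positivity: merging two k-sets along r shared labels gives products of (a + b)!,
   where a and b count the private labels lying in a gap between shared ones, and
   (a + b)! = a! b! \sum_j 'C(a, j) 'C(b, j) turns the form into a sum of squares
   with a triangular, hence injective, system behind it.  That every partition gives
   a distinct simple representation and that these exhaust the regular one follows by
   counting conjugacy classes. *)

(* The columns of U must be matrix elements, so the only freedom is an orthogonal conjugation of
   each representation, which acts on both matrix indices at once. This suffices because abscissas
   and ordinates have the same law: both tensor factors of the limit block are the same matrix
   [ntr], symmetric because the two label sets can be swapped. Levels decouple by counting powers of
   n: coordinates of levels r and r' carry n^((r + r')/2), while the term with m shared labels has
   order n^-m and vanishes for m < max(r, r'). The exponent is thus at most 0, with equality only
   for r = r' = m. Schur's lemma does not apply directly to a cross average M at level r: M absorbs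
   permutations of private labels and intertwines those of shared labels, but not all of S_k. The
   double coset argument shows that M intertwines the corner E A E, where E projects onto the
   vectors fixed by the permutations of private labels; averaging over S_k then returns M up to a
   nonzero scalar. That U is square rests on the sum of the squared dimensions being k! for these
   concrete real modules, hence the count of irreducibles and the absolute irreducibility. *)
Require Import Defs.
From mathcomp Require Import zify ring lra.
From mathcomp Require spectral complex realfun.

Set Implicit Arguments.
Unset Strict Implicit.
Unset Printing Implicit Defensive.

Import Order.TTheory GRing.Theory Num.Theory.
Import numFieldNormedType.Exports.

Local Open Scope ring_scope.

(** * Permutations compatible with colourings *)

Section Coloring.
Import mathcomp.boot.fintype mathcomp.boot.finset.
Local Open Scope nat_scope.
Variables (T C : finType).

(** The predicate [P] limits which colours may move, so that the order of the group can be computed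
    by adding one colour at a time. *)
Definition color_fix (P : pred C) (c : T -> C) : {set {perm T}} :=
  [set s : {perm T} | [forall x, (c (s x) == c x) && (P (c x) || (s x == x))]].

Lemma color_fixP (P : pred C) (c : T -> C) (s : {perm T}) :
  reflect (forall x, c (s x) = c x /\ (~~ P (c x) -> s x = x)) (s \in color_fix P c).
Proof.
rewrite inE; apply: (iffP forallP) => h x; have := h x.
  by case/andP=> /eqP -> /orP[->|/eqP ->].
by case=> -> h'; rewrite eqxx /=; case: (P _) h' => //= /(_ isT) ->.
Qed.

(** Adding a colour splits each permutation uniquely into one supported on the new colour class and
    one fixing that class, so the orders multiply. *)
Lemma card_color_fix (c : T -> C) (l : seq C) : uniq l ->
  #|color_fix [in l] c| = \prod_(i <- l) (#|[set x | c x == i]|)`!.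
Proof.
elim: l => [_|i l IH /= /andP[il ul]].
  rewrite big_nil -(cards1 (1%g : {perm T})); apply: eq_card => s.
  apply/color_fixP/set1P => [h|-> x]; last by rewrite perm1.
  by apply/permP => x; rewrite perm1; apply: (h x).2.
rewrite big_cons -(IH ul); set A := [set x | c x == i].
rewrite -card_perm -[#|perm_on A|]cardsE -cardsX.
pose f (pq : {perm T} * {perm T}) : {perm T} := (pq.1 * pq.2)%g.
rewrite -(@card_in_imset _ _ f); last first.
  move=> [p q] [p' q'] /setXP[/= pA qf] /setXP[/= pA' qf'] /= e.
  rewrite in_set in pA; rewrite in_set in pA'.
  have fixp (p0 : {perm T}) : p0 \in perm_on A -> forall x, c x != i -> p0 x = x.
    by move=> h x cx; apply: out_perm h _; rewrite inE.
  have fixq (q0 : {perm T}) : q0 \in color_fix [in l] c -> forall x, c x = i -> q0 x = x.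
    by move=> /color_fixP h x cx; apply: (h x).2; rewrite cx.
  have pp : p = p'.
    apply/permP => x; have [cx|cx] := eqVneq (c x) i; last by rewrite !fixp.
    have := congr1 (fun s : {perm T} => s x) e; rewrite /f /= !permM.
    have cp (p0 : {perm T}) : p0 \in perm_on A -> c (p0 x) = i.
      move=> h; apply/eqP; have := perm_closed x h.
      by rewrite !inE cx eqxx.
    by rewrite (fixq q) ?(fixq q') ?cp.
  by move: e; rewrite /f /= pp => /mulgI ->.
apply: eq_card => s; apply/color_fixP/imsetP => [h|[[p q] /setXP[/= pA qf] ->]].
  pose g x := if c x == i then s x else x.
  have cs x : c (s x) = c x by case: (h x).
  have gi : injective g.
    move=> x y; rewrite /g; case: eqP => cx; case: eqP => cy //.
    - exact: perm_inj.
    - by move=> e; rewrite -e cs cx in cy.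
    - by move=> e; rewrite e cs cy in cx.
  exists (perm gi, ((perm gi)^-1 * s)%g); last by rewrite /f /= mulKVg.
  apply/setXP; split => /=.
    rewrite in_set.
    rewrite /perm_on; apply/subsetP => x; rewrite !inE permE /g.
    by case: ifP; rewrite ?eqxx.
  have hg x : c (g x) = c x by rewrite /g; case: ifP.
  apply/color_fixP => x; rewrite permM.
  have [y ->] : exists y, x = g y.
    by exists ((perm gi)^-1 x)%g; rewrite -[X in X = _](permKV (perm gi)) permE.
  have -> : ((perm gi)^-1)%g (g y) = y by rewrite -[g y](permE gi) permK.
  rewrite cs hg; split => // cy; rewrite /g; case: eqP => // /eqP cyi.
  by apply: (h y).2; rewrite inE negb_or cyi.
move: qf => /color_fixP qf; rewrite in_set in pA => x; rewrite /f permM /=.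
have cp : c (p x) = c x.
  have := perm_closed x pA; rewrite !inE => e.
  have [cx|cx] := eqVneq (c x) i; first by apply/eqP; rewrite cx e; apply/eqP.
  by rewrite (out_perm pA) // inE.
split; first by rewrite (qf _).1.
rewrite inE negb_or => /andP[cx cl]; rewrite (out_perm pA) ?inE //.
exact: (qf x).2.
Qed.

(** Equal class sizes make the two lists of colours rearrangements of each other; the permutation of
    indices is transported to [T]. *)
Lemma exists_perm_color (c c' : T -> C) :
  (forall i, #|[set x | c x == i]| = #|[set x | c' x == i]|) ->
  exists s : {perm T}, forall x, c' (s x) = c x.
Proof.
move=> h; pose t := [tuple of [seq c (enum_val i) | i <- ord_tuple #|T|]].
pose t' := [tuple of [seq c' (enum_val i) | i <- ord_tuple #|T|]].
have /tuple_permP[p pe] : perm_eq t t'.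
  apply/allP => i _ /=; apply/eqP.
  have aux (d : T -> C) : count_mem i [seq d (enum_val j) | j <- enum 'I_#|T|] =
      #|[set x | d x == i]|.
    transitivity (\sum_(j : 'I_#|T| | d (enum_val j) == i) 1).
      by rewrite count_map -sum1_count big_enum_cond.
    rewrite -sum1_card (reindex (@enum_val T T)) /=.
      by apply: eq_bigl => j; rewrite !inE.
    exact: (onW_bij _ (@enum_val_bij T)).
  by rewrite !aux h.
have pE i : c (enum_val i) = c' (enum_val (p i)).
  have := congr1 (fun s : seq C => nth (c (enum_val i)) s i) pe.
  rewrite -[LHS]tnth_nth -[RHS]tnth_nth !tnth_map.
  by rewrite !tnth_ord_tuple.
have gi : injective (fun x : T => enum_val (p (enum_rank x))).
  by move=> x y /enum_val_inj /perm_inj /enum_rank_inj.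
by exists (perm gi) => x; rewrite permE -pE enum_rankK.
Qed.

(** These permutations form a coset of the colour-preserving group, shifted by one solution [s0]. *)
Lemma card_perm_color (c c' : T -> C) :
  (forall i, #|[set x | c x == i]| = #|[set x | c' x == i]|) ->
  #|[set s : {perm T} | [forall x, c' (s x) == c x]]| =
  \prod_i (#|[set x | c x == i]|)`!.
Proof.
move=> h; have [s0 s0E] := exists_perm_color h.
have := card_color_fix c (enum_uniq C); rewrite big_enum /= => <-.
rewrite -[RHS](card_imset _ (mulIg s0)); apply: eq_card => s.
apply/idP/imsetP => [|[t /color_fixP tP ->]]; last first.
  by rewrite inE; apply/forallP => x; rewrite permM s0E (tP x).1.
rewrite inE => /forallP sP; exists (s * s0^-1)%g; last by rewrite mulgKV.
apply/color_fixP => x; rewrite mem_enum; split => //.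
by rewrite permM -s0E permKV (eqP (sP x)).
Qed.

End Coloring.

(** * Standardization of injective sequences *)

Section Standardization.
Import mathcomp.boot.fintype mathcomp.boot.finset.
Local Open Scope nat_scope.
Variable k : nat.
Implicit Types (f g : 'I_k -> nat) (s p : 'S_k).

(** The default 1 is reached only when [f] is not injective; otherwise the ranks of the values
    provide the permutation. *)
Definition std f : 'S_k :=
  odflt 1%g [pick s : 'S_k | [forall i, forall j, (s i < s j) == (f i < f j)]].

Lemma rank_lt f i : #|[set j | f j < f i]| < k.
Proof.
rewrite -[X in _ < X]card_ord -cardsT; apply: proper_card.
by apply/properP; split; [apply/subsetP|exists i; rewrite ?inE ?ltnn].
Qed.

Definition rank_ord f i : 'I_k := Ordinal (rank_lt f i).

Lemma rank_ord_lt f i j : injective f -> (rank_ord f i < rank_ord f j) = (f i < f j).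
Proof.
move=> fi /=; have [lt|le] := ltnP (f i) (f j).
  apply: proper_card; apply/properP; split.
    by apply/subsetP => l; rewrite !inE => /ltn_trans; apply.
  by exists i; rewrite !inE ?ltnn.
apply/negbTE; rewrite -leqNgt; apply: subset_leq_card.
by apply/subsetP => l; rewrite !inE => /leq_trans; apply.
Qed.

Lemma ltn_val_inj f g : injective f ->
  (forall i j, (g i < g j) = (f i < f j)) -> injective g.
Proof.
move=> fi e i j gij; apply: fi; apply/eqP.
by rewrite eqn_leq !(leqNgt (f _)) -!e gij ltnn.
Qed.

Lemma std_ltn f i j : injective f -> (std f i < std f j) = (f i < f j).
Proof.
move=> fi; rewrite /std; case: pickP => [s /forallP/(_ i)/forallP/(_ j)/eqP //|].
have ri : injective (rank_ord f).
  move=> a b e; apply: (ltn_val_inj fi (fun a b => rank_ord_lt a b fi)).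
  by rewrite e.
move=> /(_ (perm ri)) /negP[]; apply/forallP => a; apply/forallP => b.
by rewrite !permE rank_ord_lt.
Qed.

Lemma std_val f i : injective f -> std f i = #|[set j | f j < f i]| :> nat.
Proof.
move=> fi; rewrite -(card_imset _ (@perm_inj _ (std f))).
have -> : [set std f j | j in [set j | f j < f i]] = [set a : 'I_k | a < std f i].
  apply/setP => a; rewrite !inE; apply/imsetP/idP => [[j]|lt].
    by rewrite inE -std_ltn // => lt ->.
  by exists ((std f)^-1%g a); rewrite ?permKV // inE -std_ltn // permKV.
rewrite -sum1_card (eq_bigl (fun a : 'I_k => a < std f i)); last by move=> a; rewrite inE.
by rewrite (big_ord_narrow (ltnW (ltn_ord (std f i)))) sum1_card card_ord.
Qed.

Lemma eq_std_ltn f g : injective f ->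
  (forall i j, (f i < f j) = (g i < g j)) -> std f = std g.
Proof.
move=> fi e; have gi : injective g by apply: (ltn_val_inj fi) => i j; rewrite e.
apply/permP => i; apply: val_inj; rewrite /= !std_val //.
by apply: eq_card => j; rewrite !inE e.
Qed.

Lemma std_id s : std (fun i => s i) = s.
Proof.
have si : injective (fun i => s i : nat) by move=> i j /val_inj/perm_inj.
apply/permP => i; apply: val_inj; rewrite /= std_val //.
rewrite -(card_imset _ (@perm_inj _ s)).
have -> : [set s j | j in [set j | s j < s i]] = [set a : 'I_k | a < s i].
  apply/setP => a; rewrite !inE; apply/imsetP/idP => [[j]|lt].
    by rewrite inE => lt ->.
  by exists (s^-1%g a); rewrite ?permKV // inE permKV.
rewrite -sum1_card (eq_bigl (fun a : 'I_k => a < s i)); last by move=> a; rewrite inE.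
by rewrite (big_ord_narrow (ltnW (ltn_ord (s i)))) sum1_card card_ord.
Qed.

Lemma std_unique f s : injective f -> (forall i j, (s i < s j) = (f i < f j)) -> std f = s.
Proof. by move=> fi e; rewrite -[RHS]std_id; apply: eq_std_ltn. Qed.

(** Relabelling points multiplies the standardization on the left; the invariance of the cross
    averages comes from this rule. *)
Lemma std_perm f p : injective f -> std (f \o p) = (p * std f)%g.
Proof.
move=> fi; apply: std_unique => [|i j]; first exact: inj_comp (@perm_inj _ p).
by rewrite !permM std_ltn.
Qed.

Lemma eq_std f g : f =1 g -> std f = std g.
Proof. by move=> e; congr std; apply/funext. Qed.

End Standardization.

Lemma std_comp k n (f : 'I_n -> nat) (g : 'I_k -> 'I_n) : injective f -> injective g ->
  std (fun i => std f (g i) : nat) = std (f \o g).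
Proof.
move=> fi gi; apply/esym/eq_std_ltn => [|i j]; first exact: inj_comp.
by rewrite std_ltn.
Qed.

(** * Induced patterns in terms of labelled points *)

Section Patterns.
Import mathcomp.boot.fintype mathcomp.boot.finset.
Variables k n : nat.

(* The points of the permutation [pi] are labelled: [x i] is the abscissa of the
   point labelled [i]. *)
Lemma inducesE (pi : 'S_n) (x : 'I_k -> 'I_n) (s : 'S_k) : injective x ->
  induces pi [set x i | i : 'I_k] s =
  (s == (std (fun i => x i : nat))^-1 * std (fun i => pi (x i) : nat))%g.
Proof.
move=> xi; set al := std _; set be := std _.
have xi' : injective (fun i => x i : nat) by move=> i j /val_inj/xi.
have yi' : injective (fun i => pi (x i) : nat) by move=> i j /val_inj/perm_inj/xi.
apply/existsP/eqP => [[a /and3P[/forallP aM /eqP aI /forallP aS]]|->].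
  have aM' (i j : 'I_k) : (i < j)%N -> (a i < a j)%N by have /forallP/(_ j)/implyP := aM i.
  have aMe (i j : 'I_k) : (a i < a j)%N = (i < j)%N.
    apply/idP/idP => [|/aM' //]; have [//|ji aij] := ltnP i j.
    have [e|ne] := eqVneq i j; first by rewrite e ltnn in aij.
    have := aM' j i; rewrite ltn_neqAle ji eq_sym ne => /(_ isT) /(ltn_trans aij).
    by rewrite ltnn.
  have ai : injective a.
    move=> i j e; apply/val_inj/eqP; by rewrite eqn_leq (leqNgt i) (leqNgt j) -(aMe i) -(aMe j) e ltnn.
  have ex i : exists j, x i == a j.
    have : x i \in [set x i | i : 'I_k] by apply: imset_f.
    by rewrite aI => /imsetP[j _ ->]; exists j.
  pose q i := xchoose (ex i); have qE i : x i = a (q i) by apply/eqP; exact: xchooseP (ex i).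
  have qi : injective q by move=> i j e; apply: xi; rewrite !qE e.
  have alE : al = perm qi.
    by apply: std_unique => // i j; rewrite !permE !qE aMe.
  have beE : be = (perm qi * s)%g.
    apply: std_unique => // i j; rewrite !permM !permE !qE.
    by have /forallP/(_ (q j))/eqP := aS (q i).
  by rewrite alE beE mulKg.
pose a := [ffun j => x (al^-1%g j)]; exists a; apply/and3P; split.
- apply/forallP => i; apply/forallP => j; apply/implyP => ij.
  by rewrite !ffunE -(std_ltn _ _ xi') !permKV.
- apply/eqP/setP => y; apply/imsetP/imsetP => [[i _ ->]|[i _ ->]].
    by exists (al i) => //; rewrite ffunE permK.
  by exists (al^-1%g i) => //; rewrite ffunE.
- apply/forallP => i; apply/forallP => j.
  by rewrite !permM !ffunE -(std_ltn _ _ yi').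
Qed.

End Patterns.

(** Colouring each point by its preimage under [f], respectively [g], with [None] off the image,
    reduces this to equal class sizes. *)
Lemma exists_perm_ext (A T : finType) (f g : A -> T) : injective f -> injective g ->
  exists s : {perm T}, forall a, s (f a) = g a.
Proof.
move=> fi gi; pose c (f : A -> T) x := [pick a | f a == x].
have cS (h : A -> T) a : injective h -> c h (h a) = Some a.
  rewrite /c => hi; case: pickP => [b /eqP/hi -> //|/(_ a)].
  by rewrite eqxx.
have cE (h : A -> T) x a : c h x = Some a -> x = h a.
  by rewrite /c; case: pickP => // b /eqP <- [->].
have cardS (h : A -> T) a : injective h -> #|[set x | c h x == Some a]| = 1%N.
  move=> hi; rewrite -(cards1 (h a)); apply: eq_card => x; rewrite !inE.
  by apply/eqP/eqP => [/cE|->]; last exact: cS.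
have cardN (h : A -> T) : injective h -> #|[set x | c h x == None]| = (#|T| - #|A|)%N.
  move=> hi; have -> : [set x | c h x == None] = ~: [set h a | a in A].
    apply/setP => x; rewrite !inE /c; case: pickP => [a /eqP <-|h0].
      by rewrite imset_f.
    by symmetry; apply/imsetP => -[a _ e]; have := h0 a; rewrite e eqxx.
  by rewrite cardsCs finset.setCK card_imset.
have [i|s sE] := @exists_perm_color _ _ (c f) (c g).
  by case: i => [a|]; rewrite ?cardS ?cardN.
by exists s => a; apply: cE; rewrite sE cS.
Qed.

(** * Labels of two overlapping k-sets *)

Section Labels.
Variables k m : nat.

(* Two sets of [k] labels sharing [m] of them: [labA] and [labB] agree exactly on
   the indices below [m]. *)
Definition labA (i : 'I_k) : 'I_(k + (k - m)) := lshift (k - m) i.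

Lemma labB_lt (i : 'I_k) : ((if (i < m)%N then i : nat else i + (k - m)) < k + (k - m))%N.
Proof. by case: ifP => _; have := ltn_ord i; lia. Qed.

Definition labB (i : 'I_k) : 'I_(k + (k - m)) := Ordinal (labB_lt i).

Lemma labA_inj : injective labA. Proof. exact: lshift_inj. Qed.

Lemma labB_inj : injective labB.
Proof.
move=> i j /(congr1 val) /= e; apply: val_inj => /=.
have := ltn_ord i; have := ltn_ord j.
by move: e; case: (ltnP i m); case: (ltnP j m); lia.
Qed.

Lemma labB_lo (i : 'I_k) : (i < m)%N -> labB i = labA i.
Proof. by move=> im; apply: val_inj; rewrite /= im. Qed.

Lemma labB_hi (i j : 'I_k) : (m <= i)%N -> labB i != labA j.
Proof.
move=> im; rewrite -val_eqE /= ltnNge im /=; have := ltn_ord j; have := ltn_ord i.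
by lia.
Qed.

(** As [p] and [q] agree on the shared labels and keep them shared, they glue to one relabelling of
    the union. *)
Lemma relabel_ext (p q : 'S_k) :
  (forall i : 'I_k, (i < m)%N -> p i = q i /\ (p i < m)%N) ->
  exists s : 'S_(k + (k - m)), forall i, s (labA i) = labA (p i) /\ s (labB i) = labB (q i).
Proof.
move=> pq; pose B := {i : 'I_k | (m <= i)%N}.
(* An injective map of the finite set of shared labels into itself is onto, so private labels stay
   private. *)
have qm (i : 'I_k) : (m <= i)%N -> (m <= q i)%N.
  have qE (j : 'I_k) : (j < m)%N = (q j < m)%N.
    have sub : [set q j | j in [set j : 'I_k | (j < m)%N]] \subset [set j : 'I_k | (j < m)%N].
      apply/fintype.subsetP => _ /imsetP[l lm ->]; rewrite inE in lm.
      by rewrite inE -(pq l lm).1 (pq l lm).2.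
    have := subset_leqif_cards sub; rewrite card_imset; last exact: perm_inj.
    move=> /leqif_refl /eqP e; have := congr1 (fun D : {set 'I_k} => q j \in D) e.
    by rewrite mem_imset ?inE; last exact: perm_inj.
  by move=> mi; rewrite leqNgt -qE -leqNgt.
pose f (x : 'I_k + B) := match x with inl i => labA i | inr i => labB (val i) end.
pose g (x : 'I_k + B) :=
  match x with inl i => labA (p i) | inr i => labB (q (val i)) end.
have [||s sE] := @exists_perm_ext _ _ f g.
- move=> [i|[i im]] [j|[j jm]] /=.
  + by move=> /labA_inj ->.
  + by move=> /esym/eqP; rewrite (negPf (labB_hi _ jm)).
  + by move=> /eqP; rewrite (negPf (labB_hi _ im)).
  + by move=> /labB_inj e; congr inr; apply: val_inj.
- move=> [i|[i im]] [j|[j jm]] /=.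
  + by move=> /labA_inj/perm_inj ->.
  + by move=> /esym/eqP; rewrite (negPf (labB_hi _ (qm _ jm))).
  + by move=> /eqP; rewrite (negPf (labB_hi _ (qm _ im))).
  + by move=> /labB_inj/perm_inj e; congr inr; apply: val_inj.
exists s => i; split; first exact: (sE (inl i)).
have [im|im] := ltnP i m; last exact: (sE (inr (exist _ i im))).
by rewrite labB_lo // (sE (inl i)) /= (pq i im).1 labB_lo // -(pq i im).1 (pq i im).2.
Qed.

End Labels.

(** * Restricting a uniform permutation to fewer labels *)

Section Sums.
Variable R : numFieldType.

(** The left sum is unchanged when the argument of [F] is multiplied by any h in ['S_N], since h
    extends to ['S_n]; averaging over h replaces every term by the mean of [F]. *)
Lemma sum_std_restrict (N n : nat) (le : (N <= n)%N) (F : 'S_N -> R) :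
  (\sum_(eta : 'S_n) F (std (fun i => eta (widen_ord le i) : nat))) / n`!%:R =
  (\sum_(tau : 'S_N) F tau) / N`!%:R.
Proof.
have wi : injective (widen_ord le) by move=> i j /(congr1 val) /= /val_inj.
have ei (eta : 'S_n) : injective (fun i => eta (widen_ord le i) : nat).
  by move=> i j /val_inj/perm_inj/wi.
set S := \sum_eta _.
have E h : S = \sum_(eta : 'S_n) F (h * std (fun i => eta (widen_ord le i) : nat))%g.
  have [|s sE] := @exists_perm_ext _ _ (widen_ord le) (widen_ord le \o h) wi.
    exact: inj_comp wi (@perm_inj _ h).
  rewrite /S (reindex_inj (mulgI s)) /=; apply: eq_bigr => eta _.
  rewrite -std_perm //; congr F; apply: eq_std => i /=.
  by rewrite permM sE.
have e2 : S *+ N`! = (\sum_tau F tau) *+ n`!.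
  have cS q : #|'S_q| = q`! by rewrite card_Sn.
  transitivity (\sum_(h : 'S_N) \sum_(eta : 'S_n)
                  F (h * std (fun i => eta (widen_ord le i) : nat))%g).
    by rewrite -(cS N) -sumr_const; apply: eq_bigr => h _; exact: E h.
  rewrite exchange_big /= -(cS n) -sumr_const; apply: eq_bigr => eta _.
  by rewrite [RHS](reindex_inj (mulIg (std (fun i => eta (widen_ord le i) : nat)))).
have f0 q : q`!%:R != 0 :> R by rewrite pnatr_eq0 -lt0n fact_gt0.
by apply/eqP; rewrite eqr_div ?f0 //; apply/eqP; rewrite !mulr_natr.
Qed.

End Sums.

(** * Pairs of k-sets with m common elements *)

Section Pairs.
Import mathcomp.boot.fintype mathcomp.boot.finset.
Variables (R : numFieldType) (k m n : nat).
Hypotheses (mk : (m <= k)%N) (le : (k + (k - m) <= n)%N).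

Definition posA (xi : 'S_n) : {set 'I_n} := [set xi (widen_ord le (labA m i)) | i : 'I_k].
Definition posB (xi : 'S_n) : {set 'I_n} := [set xi (widen_ord le (labB m i)) | i : 'I_k].

Definition pair_color (A B : {set 'I_n}) (x : 'I_n) : bool * bool := (x \in A, x \in B).

(** The number of labellings with prescribed position sets: labels are shared, private to either
    set, or outside both. *)
Definition fiber_size := (m`! * (k - m)`! * ((k - m)`! * (n - (k + (k - m)))`!))%N.

Let wi : injective (widen_ord le). Proof. by move=> i j /(congr1 val) /= /val_inj. Qed.

Lemma card_posA xi : #|posA xi| = k.
Proof.
rewrite card_imset ?card_ord // => i j /perm_inj/wi.
exact: labA_inj.
Qed.

Lemma card_posB xi : #|posB xi| = k.
Proof.
rewrite card_imset ?card_ord // => i j /perm_inj/wi.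
exact: labB_inj.
Qed.

Lemma card_posAB xi : #|posA xi :&: posB xi| = m.
Proof.
have -> : posA xi :&: posB xi =
    [set xi (widen_ord le (labA m (widen_ord mk i))) | i : 'I_m].
  apply/setP => y; rewrite inE; apply/andP/imsetP => [[]|[i _ ->]].
    move=> /imsetP[i _ ->] /imsetP[j _] /perm_inj/wi/eqP.
    have [jm|jm] := ltnP j m; last by rewrite eq_sym (negPf (labB_hi _ jm)).
    rewrite labB_lo // => /eqP/labA_inj ->; exists (Ordinal jm) => //.
    by congr (xi (widen_ord le (labA m _))); apply: val_inj.
  split; first by apply: imset_f.
  rewrite -labB_lo; first by apply: imset_f.
  exact: ltn_ord i.
rewrite card_imset ?card_ord // => i j /perm_inj/wi/labA_inj /(congr1 val) /=.
exact: val_inj.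
Qed.

Lemma card_pair_color (A B : {set 'I_n}) (c : bool * bool) :
  #|A| = k -> #|B| = k -> #|A :&: B| = m ->
  #|[set x | pair_color A B x == c]| =
  match c with
  | (true, true) => m
  | (false, false) => (n - (k + (k - m)))%N
  | _ => (k - m)%N
  end.
Proof.
move=> cA cB cAB.
have dA : #|A :\: B| = (k - m)%N by rewrite cardsD cA cAB.
have dB : #|B :\: A| = (k - m)%N by rewrite cardsD cB setIC cAB.
case: c => -[] [].
- by rewrite -cAB; apply: eq_card => x; rewrite !inE xpair_eqE !eqb_id.
- by rewrite -dA; apply: eq_card => x; rewrite !inE xpair_eqE eqb_id eqbF_neg andbC.
- by rewrite -dB; apply: eq_card => x; rewrite !inE xpair_eqE eqb_id eqbF_neg.
- have -> : #|[set x | pair_color A B x == (false, false)]| = #|~: (A :|: B)|.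
    by apply: eq_card => x; rewrite !inE xpair_eqE !eqbF_neg negb_or.
  have := cardsC (A :|: B); rewrite cardsU cA cB cAB card_ord; move: mk le.
  by lia.
Qed.

(** Phrased as a matching of colourings, so that [card_perm_color] counts the fibre. *)
Lemma pos_fiber (A B : {set 'I_n}) (xi : 'S_n) :
  (posA xi, posB xi) == (A, B) =
  [forall x, pair_color A B (xi x) == pair_color (posA 1) (posB 1) x].
Proof.
have hA : posA xi = [set xi x | x in posA 1].
  by rewrite /posA -imset_comp; apply: eq_imset => i /=; rewrite perm1.
have hB : posB xi = [set xi x | x in posB 1].
  by rewrite /posB -imset_comp; apply: eq_imset => i /=; rewrite perm1.
apply/eqP/forallP => [[<- <-] x|h].
  by rewrite /pair_color hA hB !mem_imset //; exact: perm_inj.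
rewrite hA hB; congr pair; apply/setP => y; rewrite -[y](permKV xi) mem_imset;
  by [exact: perm_inj | have /eqP[] := h (xi^-1%g y)].
Qed.

(** Each admissible pair of sets comes from equally many labellings, so sums over pairs become sums
    over permutations. *)
Lemma sum_pairs (Phi : {set 'I_n} -> {set 'I_n} -> R) :
  \sum_(xi : 'S_n) Phi (posA xi) (posB xi) =
  (\sum_(AB : {set 'I_n} * {set 'I_n} |
     [&& #|AB.1| == k, #|AB.2| == k & #|AB.1 :&: AB.2| == m]) Phi AB.1 AB.2)
  *+ fiber_size.
Proof.
rewrite (partition_big (fun xi => (posA xi, posB xi)) (fun AB =>
  [&& #|AB.1| == k, #|AB.2| == k & #|AB.1 :&: AB.2| == m])) /=; last first.
  by move=> xi _; rewrite card_posA card_posB card_posAB !eqxx.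
rewrite -sumrMnl; apply: eq_bigr => -[A B] /= /and3P[/eqP cA /eqP cB /eqP cAB].
transitivity (\sum_(xi : 'S_n | (posA xi, posB xi) == (A, B)) Phi A B).
  by apply: eq_bigr => xi /eqP[-> ->].
rewrite sumr_const; congr (_ *+ _).
have := @card_perm_color _ _ (pair_color (posA 1) (posB 1)) (pair_color A B).
rewrite -(pair_bigA _ (fun a b => (#|[set x | pair_color _ _ x == (a, b)]|)`!)) /=.
rewrite /fiber_size !big_bool /= !card_pair_color ?card_posA ?card_posB ?card_posAB // => <-.
  by apply: eq_card => xi; rewrite [RHS]inE -pos_fiber xpair_eqE.
by move=> c; rewrite !card_pair_color ?card_posA ?card_posB ?card_posAB.
Qed.

End Pairs.

(** * Gaps between shared labels *)

Section Gap.
Import mathcomp.boot.fintype mathcomp.boot.finset.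
Local Open Scope nat_scope.
Variables n r : nat.
Hypothesis rn : r <= n.
Implicit Types (eta : 'S_n) (l i : 'I_n).

(** Labels below [r] are the shared ones; the gap tells between which of their values the value of
    [l] falls. *)
Definition gap eta l : nat := #|[set i : 'I_n | (i < r) && (eta i < eta l)]|.

Lemma card_low : #|[set i : 'I_n | i < r]| = r.
Proof.
rewrite -sum1_card (eq_bigl (fun i : 'I_n => i < r)); last by move=> i; rewrite inE.
by rewrite (big_ord_narrow rn) sum1_card card_ord.
Qed.

Lemma gap_le eta l : gap eta l <= r.
Proof.
rewrite -[X in _ <= X]card_low; apply: subset_leq_card.
by apply/subsetP => i; rewrite !inE => /andP[].
Qed.

Lemma gap_mono eta l l' : eta l <= eta l' -> gap eta l <= gap eta l'.
Proof.
move=> le; apply: subset_leq_card; apply/subsetP => i; rewrite !inE => /andP[-> /=].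
by move/leq_trans; apply.
Qed.

Lemma gap_strict eta l l' : l < r -> eta l < eta l' -> gap eta l < gap eta l'.
Proof.
move=> lr lt; apply: proper_card; apply/properP; split.
  by apply/subsetP => i; rewrite !inE => /andP[-> /=] /ltn_trans; apply.
by exists l; rewrite !inE ?lr ?lt // ltnn.
Qed.

Lemma gap_low eta l : l < r -> gap eta l < r.
Proof.
move=> lr; rewrite -[X in _ < X]card_low; apply: proper_card; apply/properP; split.
  by apply/subsetP => i; rewrite !inE => /andP[].
by exists l; rewrite !inE ?lr // ltnn.
Qed.

Lemma gap_low_inj eta i i' : i < r -> i' < r -> gap eta i = gap eta i' -> i = i'.
Proof.
move=> ir ir' e; apply: (@perm_inj _ eta); apply: val_inj; apply/eqP; rewrite eqn_leq.
apply/andP; split; rewrite leqNgt; apply/negP => /gap_strict.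
  by move=> /(_ ir'); rewrite e ltnn.
by move=> /(_ ir); rewrite e ltnn.
Qed.

(** A shared [l] below [i] is counted in the gap of [i] but not in its own, whence strictness; a
    private [l] is counted in neither. So the gaps determine the values at shared labels. *)
Lemma eta_low_ltn eta l i : i < r ->
  (eta l < eta i) = (if l < r then gap eta l < gap eta i else gap eta l <= gap eta i).
Proof.
move=> ir; have [lr|rl] := ltnP l r.
  apply/idP/idP => [|lt]; first exact: gap_strict.
  by rewrite ltnNge; apply/negP => /gap_mono; rewrite leqNgt lt.
apply/idP/idP => [/ltnW/gap_mono //|le].
rewrite ltn_neqAle leqNgt; apply/andP; split; last first.
  by apply/negP => /(gap_strict ir); rewrite ltnNge le.
by apply/negP => /eqP/val_inj/perm_inj e; move: rl; rewrite e leqNgt ir.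
Qed.

Lemma gap_eq_low eta eta' i : gap eta =1 gap eta' -> i < r -> eta i = eta' i.
Proof.
move=> e ir; apply: val_inj => /=; rewrite -(std_id eta) -(std_id eta').
have inj (s : 'S_n) : injective (fun i => s i : nat) by move=> ? ? /val_inj/perm_inj.
rewrite !std_val //; apply: eq_card => l; rewrite !inE.
by rewrite !eta_low_ltn // !e.
Qed.

Lemma gap_perm (eta h : 'S_n) l : (forall i : 'I_n, i < r -> h i = i) ->
  gap (h * eta) l = gap eta (h l).
Proof.
move=> hr; apply: eq_card => i; rewrite !inE !permM.
by case: ltnP => //= ir; rewrite hr.
Qed.

Lemma gap_eqP eta eta' : gap eta =1 gap eta' ->
  forall i : 'I_n, i < r -> (eta' * eta^-1)%g i = i.
Proof. by move=> e i ir; rewrite permM -(gap_eq_low e ir) permK. Qed.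

Definition gap_map (psi : 'I_n -> nat) : bool :=
  [forall l, psi l <= r] && [forall i : 'I_n, (i < r) ==> (psi i < r)]
  && [forall i : 'I_n, forall j : 'I_n, [&& i < r, j < r & psi i == psi j] ==> (i == j)].

Lemma gap_mapP (psi : 'I_n -> nat) :
  reflect [/\ forall l, psi l <= r, forall i : 'I_n, i < r -> psi i < r &
             forall i j : 'I_n, i < r -> j < r -> psi i = psi j -> i = j] (gap_map psi).
Proof.
apply: (iffP andP) => [[/andP[/forallP h1 /forallP h2] /forallP h3]|[h1 h2 h3]].
  split=> // i; first exact/implyP.
  move=> j ir jr e; have /forallP/(_ j) := h3 i.
  by rewrite ir jr e eqxx => /eqP.
split; first (apply/andP; split); apply/forallP => i //.
  by apply/implyP; exact: h2.
by apply/forallP => j; apply/implyP => /and3P[ir jr /eqP e]; apply/eqP; exact: h3.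
Qed.

Lemma gap_exists (psi : 'I_n -> nat) : gap_map psi -> exists eta, gap eta =1 psi.
Proof.
move=> /gap_mapP[h1 h2 h3].
(* A lexicographic key: a shared label of gap c must come right above the private labels of gap c,
   hence odd against even; the label itself breaks ties. *)
pose key (l : 'I_n) := (if l < r then (psi l).*2.+1 else (psi l).*2) * n + l.
have keyi : injective key.
  move=> l l' /(congr1 (modn^~ n)); rewrite /key !modnMDl !modn_small //.
  exact: val_inj.
exists (std key) => l; rewrite /gap.
have -> : [set i : 'I_n | (i < r) && (std key i < std key l)] =
          [set i : 'I_n | (i < r) && (psi i < psi l)].
  apply/setP => i; rewrite !inE; case: ltnP => //= ir; rewrite std_ltn //.
  have ilt := ltn_ord i; have llt := ltn_ord l.
  rewrite /key ir; case: (ltnP l r) => lr.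
    have [e|ne] := eqVneq (psi i) (psi l).
      by rewrite (h3 _ _ ir lr e) !ltnn.
    by apply/idP/idP => ?; nia.
  by apply/idP/idP => ?; nia.
(* The gaps of the shared labels are r distinct numbers below r, so exactly [psi l] of them are
   smaller than [psi l] (which is at most r). *)
pose low := enum [pred i : 'I_n | i < r].
have lowE i : (i \in low) = (i < r) by rewrite mem_enum inE.
have ul : uniq [seq psi i | i <- low].
  rewrite map_inj_in_uniq ?enum_uniq // => i j; rewrite !lowE.
  exact: h3.
have pl : perm_eq [seq psi i | i <- low] (iota 0 r).
  apply: uniq_perm => //; first exact: iota_uniq.
  have sub : {subset [seq psi i | i <- low] <= iota 0 r}.
    by move=> v /mapP[i]; rewrite lowE => ir ->; rewrite mem_iota /= add0n h2.
  have [//|_ //] := uniq_min_size ul sub.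
  rewrite size_iota size_map -cardE -{1}card_low.
  by apply: eq_leq; apply: eq_card => i; rewrite !inE.
transitivity (count (fun v => v < psi l) [seq psi i | i <- low]); last first.
  rewrite (seq.permP pl) -size_filter.
  rewrite (@eq_filter _ _ (fun v => v < 0 + psi l)) //.
  by rewrite filter_iota_ltn ?size_iota.
rewrite count_map -size_filter -(card_uniqP _); last by apply: filter_uniq; exact: enum_uniq.
by apply: eq_card => i; rewrite !inE mem_filter lowE andbC.
Qed.

(** Two permutations with the same gaps differ by one that fixes the shared labels and keeps each
    private label in its gap, so they form a coset. *)
Lemma card_gap (psi : 'I_n -> nat) : gap_map psi ->
  #|[set eta : 'S_n | [forall l, gap eta l == psi l]]| =
  \prod_(c < r.+1) (#|[set l : 'I_n | (r <= l) && (psi l == c)]|)`!.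
Proof.
move=> gm; have [eta0 e0] := gap_exists gm.
(* The labels below [r] get pairwise different colours, hence have to be fixed. *)
pose col (l : 'I_n) : 'I_n + 'I_r.+1 := if l < r then inl l else inr (inord (psi l)).
have psi_lt l : psi l < r.+1 by rewrite -e0 ltnS gap_le.
transitivity #|[set h : 'S_n | [forall l, col (h l) == col l]]|.
  rewrite -[RHS](card_imset _ (mulIg eta0)); apply: eq_card => eta.
  rewrite inE; apply/forallP/imsetP => [h|[h]].
    have ge l : gap eta0 l = gap eta l by rewrite e0 (eqP (h l)).
    exists (eta * eta0^-1)%g; last by rewrite mulgKV.
    have fix_low := gap_eqP ge.
    rewrite inE; apply/forallP => l; have [lr|rl] := ltnP l r.
      by rewrite fix_low.
    have rl' : r <= (eta * eta0^-1)%g l.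
      rewrite leqNgt; apply/negP => lt; have := fix_low _ lt.
      by move=> /perm_inj e; rewrite e ltnNge rl in lt.
    rewrite /col !ltnNge rl rl' /= -e0 -gap_perm // mulgKV.
    by rewrite -ge e0.
  rewrite inE => /forallP hc -> l; apply/eqP.
  have hr i : i < r -> h i = i.
    by move=> ir; have /eqP := hc i; rewrite /col ir; case: ifP => // _ [].
  rewrite gap_perm // e0; have := hc l; have [lr|rl] := ltnP l r; first by rewrite hr.
  rewrite /col [l < r]ltnNge rl /=; case: ifP => // _ /eqP [] /(congr1 val) /=.
  by rewrite !inordK.
rewrite (@card_perm_color _ _ col col) // big_sumType /= big1 ?mul1n => [|i _].
  apply: eq_bigr => c _; congr _`!; apply: eq_card => l; rewrite !inE /col.
  case: ltnP => //= rl; apply/eqP/eqP => [[<-]|->]; first by rewrite inordK.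
  by rewrite inord_val.
have : #|[set x | col x == inl i]| <= 1.
  rewrite -(cards1 i); apply: subset_leq_card; apply/subsetP => l.
  by rewrite !inE /col; case: ifP => // _ /eqP[->].
by case: #|_| => [|[]].
Qed.

End Gap.

(** Vandermonde's identity; the bound [K] makes the range of summation independent of a and b. *)
Lemma fact_addn_sum a b K : (b <= K)%N ->
  ((a + b)`! = a`! * b`! * \sum_(j < K.+1) 'C(a, j) * 'C(b, j))%N.
Proof.
move=> bK; have -> : (\sum_(j < K.+1) 'C(a, j) * 'C(b, j) = 'C(a + b, b))%N.
  rewrite -(binomial.Vandermonde a b b).
  rewrite (big_ord_widen K.+1 (fun j => 'C(a, j) * 'C(b, b - j))%N) //.
  rewrite [RHS]big_mkcond /=; apply: eq_bigr => j _.
  case: ltnP => jb; first by rewrite bin_sub.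
  by rewrite ['C(b, j)]bin_small ?muln0.
by rewrite mulnC mulnA mulnC mulnA -(bin_fact (leq_addl a b)) addnK; lia.
Qed.

(** * Positivity of the interleaving form *)

Section Interleave.
Import mathcomp.boot.fintype mathcomp.boot.finset.
Variables (R : realFieldType) (k r : nat).
Hypothesis rk : (r <= k)%N.
Variable h : 'S_k -> R.
Hypothesis hinv : forall p b : 'S_k,
  (forall i : 'I_k, (i < r)%N -> p i = i) -> h (p * b)%g = h b.

Local Notation N := (k + (k - r))%N.

Lemma gap_std_lab (lab : 'I_k -> 'I_N) (eta : 'S_N) l :
  injective lab -> (forall i : 'I_k, (i < r)%N -> lab i = i :> nat) ->
  gap r (std (fun i => eta (lab i) : nat)) l = gap r eta (lab l).
Proof.
move=> li lr; have ei : injective (fun i => eta (lab i) : nat).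
  by move=> i j /val_inj/perm_inj/li.
rewrite /gap -(card_imset _ li); apply: eq_card => i; rewrite !inE.
apply/imsetP/andP => [[j]|[ir lt]].
  by rewrite inE std_ltn // => /andP[jr lt ->]; rewrite lr.
have ik : (i < k)%N by exact: leq_trans ir rk.
have ie : i = lab (Ordinal ik) by apply: val_inj; rewrite /= lr.
by exists (Ordinal ik); rewrite // inE std_ltn // -ie ir.
Qed.

Definition gapf n (s : 'S_n) : {ffun 'I_n -> 'I_r.+1} := [ffun l => inord (gap r s l)].

Lemma gapfE n (s : 'S_n) l : (r <= n)%N -> gapf s l = gap r s l :> nat.
Proof. by move=> rn; rewrite ffunE inordK // ltnS gap_le. Qed.

(** By [hinv] the function [h] depends on gaps only. Extending it by 0 to maps that are not gap maps
    lets sums run over all maps. *)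
Definition liftg (chi : {ffun 'I_k -> 'I_r.+1}) : R :=
  oapp h 0 [pick b : 'S_k | gapf b == chi].

Lemma liftg_gapf b : liftg (gapf b) = h b.
Proof.
rewrite /liftg; case: pickP => [b' /eqP e|/(_ b)]; last by rewrite eqxx.
have ge : gap r b =1 gap r b' by move=> l; rewrite -!gapfE // e.
by rewrite /= -[b'](mulgKV b) hinv // => i ir; rewrite (gap_eqP ge ir).
Qed.

Definition labc (lab : 'I_k -> 'I_N) (psi : {ffun 'I_N -> 'I_r.+1}) : {ffun 'I_k -> 'I_r.+1} :=
  [ffun l => psi (lab l)].

Definition content (chi : {ffun 'I_k -> 'I_r.+1}) (c : 'I_r.+1) : nat :=
  #|[set l : 'I_k | (r <= l)%N && (chi l == c)]|.

Definition lowf (chi : {ffun 'I_k -> 'I_r.+1}) : {ffun 'I_k -> 'I_r.+1} :=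
  [ffun l : 'I_k => if (l < r)%N then chi l else ord0].

Lemma labA_lo (i : 'I_k) : (i < r)%N -> labA r i = i :> nat. Proof. by []. Qed.
Lemma labB_lo' (i : 'I_k) : (i < r)%N -> labB r i = i :> nat.
Proof. by move=> ir; rewrite labB_lo. Qed.

(** Permutations are grouped by their gaps: [card_gap] gives the size of each fibre, and a map that
    is not a gap map contributes 0 through [liftg]. *)
Lemma sum_gap_maps :
  \sum_(eta : 'S_N) h (std (fun i => eta (labA r i) : nat)) *
                    h (std (fun i => eta (labB r i) : nat)) =
  \sum_(psi : {ffun 'I_N -> 'I_r.+1})
    liftg (labc (labA r) psi) * liftg (labc (labB r) psi) *
    (\prod_c (#|[set l : 'I_N | (r <= l)%N && (psi l == c)]|)`!)%:R.
Proof.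
have rN : (r <= N)%N by rewrite (leq_trans rk) ?leq_addr.
rewrite (partition_big (@gapf N) predT) //; apply: eq_bigr => psi _.
have lE (lab : 'I_k -> 'I_N) (eta : 'S_N) : injective lab ->
    (forall i : 'I_k, (i < r)%N -> lab i = i :> nat) ->
    h (std (fun i => eta (lab i) : nat)) = liftg (labc lab (gapf eta)).
  move=> li lr; rewrite -liftg_gapf; congr liftg; apply/ffunP => l.
  by apply: val_inj; rewrite /= gapfE // gap_std_lab // ffunE gapfE.
transitivity (\sum_(eta : 'S_N | gapf eta == psi)
    liftg (labc (labA r) psi) * liftg (labc (labB r) psi)).
  apply: eq_bigr => eta /eqP <-; congr (_ * _); apply: lE.
  - exact: labA_inj.
  - exact: labA_lo.
  - exact: labB_inj.
  - exact: labB_lo'.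
rewrite sumr_const -[LHS]mulr_natr.
have [gm|ngm] := boolP (gap_map r (fun l => psi l : nat)).
  rewrite -(card_gap rN gm); congr (_ * _%:R); apply: eq_card => eta.
  rewrite [RHS]inE; transitivity (gapf eta == psi); first by [].
  apply/eqP/forallP => [<- l|e]; first by rewrite gapfE.
  by apply/ffunP => l; apply: val_inj; rewrite /= gapfE // (eqP (e l)).
(* The conditions on a gap map concern shared labels, all visible in A: were the A part realizable,
   [psi] would be a gap map. *)
suff -> : liftg (labc (labA r) psi) = 0 by rewrite !mul0r.
rewrite /liftg; case: pickP => //= b /eqP e; case/negP: ngm.
have psiE l : psi (labA r l) = gap r b l :> nat.
  by rewrite -gapfE // e ffunE.
have lowE (i : 'I_N) (ir : (i < r)%N) : psi i = gap r b (Ordinal (leq_trans ir rk)) :> nat.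
  by rewrite -psiE; congr (val (psi _)); apply: val_inj.
apply/gap_mapP; split=> [l|i ir|i j ir jr]; first by rewrite -ltnS.
  by rewrite lowE gap_low.
by rewrite !lowE => /gap_low_inj => /(_ ir jr) /(congr1 val) /= /val_inj.
Qed.


(** A map on the union is a pair of maps on A and B that agree on the shared labels. *)
Lemma sum_labc (F : {ffun 'I_k -> 'I_r.+1} -> {ffun 'I_k -> 'I_r.+1} -> R) :
  \sum_(psi : {ffun 'I_N -> 'I_r.+1}) F (labc (labA r) psi) (labc (labB r) psi) =
  \sum_(p : {ffun 'I_k -> 'I_r.+1} * {ffun 'I_k -> 'I_r.+1} | lowf p.1 == lowf p.2)
    F p.1 p.2.
Proof.
pose glue (p : {ffun 'I_k -> 'I_r.+1} * {ffun 'I_k -> 'I_r.+1}) :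
    {ffun 'I_N -> 'I_r.+1} :=
  [ffun l : 'I_N => if [pick i | labA r i == l] is Some i then p.1 i else
     if [pick i | labB r i == l] is Some i then p.2 i else ord0].
have glueA p i : glue p (labA r i) = p.1 i.
  rewrite ffunE; case: pickP => [j /eqP/labA_inj -> //|/(_ i)]; by rewrite eqxx.
have glueB p i : lowf p.1 = lowf p.2 -> glue p (labB r i) = p.2 i.
  move=> e; have [ir|ir] := ltnP i r.
    rewrite labB_lo // glueA; have := congr1 (fun f : {ffun _ -> _} => f i) e.
    by rewrite /lowf !ffunE ir.
  rewrite ffunE; case: pickP => [j|_].
    by rewrite eq_sym (negPf (labB_hi _ ir)).
  case: pickP => [j /eqP/labB_inj -> //|/(_ i)]; by rewrite eqxx.
rewrite [RHS](reindex_onto (fun psi => (labc (labA r) psi, labc (labB r) psi)) glue) /=.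
  apply: eq_bigl => psi; symmetry; apply/andP.
  have lE : lowf (labc (labA r) psi) = lowf (labc (labB r) psi).
    by apply/ffunP => i; rewrite !ffunE; case: ifP => // ir; rewrite labB_lo.
  split; first by rewrite lE.
  apply/eqP/ffunP => l.
  have [[i ->]|[i ->]] : (exists i, l = labA r i) \/ (exists i, l = labB r i).
    have [lk|kl] := ltnP l k.
      by left; exists (Ordinal lk); apply: val_inj.
    right; have lt : (l - (k - r) < k)%N by have := ltn_ord l; lia.
    exists (Ordinal lt); apply: val_inj => /=.
    by case: ifP; have := ltn_ord l; lia.
  - by rewrite glueA ffunE.
  - by rewrite glueB // ffunE.
move=> [f g] /= /eqP e; congr pair; apply/ffunP => i; rewrite ffunE.
  by rewrite glueA.
by rewrite glueB.
Qed.

Lemma content_glue (psi : {ffun 'I_N -> 'I_r.+1}) (c : 'I_r.+1) :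
  #|[set l : 'I_N | (r <= l)%N && (psi l == c)]| =
  (content (labc (labA r) psi) c + content (labc (labB r) psi) c)%N.
Proof.
set A := [set labA r l | l in [set l : 'I_k | (r <= l)%N && (psi (labA r l) == c)]].
set B := [set labB r l | l in [set l : 'I_k | (r <= l)%N && (psi (labB r l) == c)]].
have cA : content (labc (labA r) psi) c = #|A|.
  rewrite card_imset; last exact: labA_inj.
  by apply: eq_card => l; rewrite !inE ffunE.
have cB : content (labc (labB r) psi) c = #|B|.
  rewrite card_imset; last exact: labB_inj.
  by apply: eq_card => l; rewrite !inE ffunE.
have dAB : A :&: B = set0.
  apply/setP => x; rewrite !inE; apply/negP => /andP[/imsetP[i _ ->] /imsetP[j]].
  by rewrite inE => /andP[rj _] /esym/eqP; rewrite (negPf (labB_hi _ rj)).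
rewrite cA cB -cardsUI dAB cards0 addn0; apply: eq_card => l; rewrite !inE.
apply/andP/orP => [[rl pl]|[]/imsetP[j]]; last first.
- rewrite inE => /andP[rj pj] ->; split => //=.
  by rewrite ltnNge rj /= (leq_trans rj) ?leq_addr.
- by rewrite inE => /andP[rj pj] ->.
have [lk|kl] := ltnP l k.
  have le : l = labA r (Ordinal lk) by apply: val_inj.
  left; rewrite [X in X \in _]le; apply: imset_f; rewrite inE -le pl andbT.
  exact: rl.
have lt : (l - (k - r) < k)%N by have := ltn_ord l; lia.
have le : l = labB r (Ordinal lt).
  by apply: val_inj => /=; case: ifP; have := ltn_ord l; lia.
right; rewrite [X in X \in _]le; apply: imset_f; rewrite inE -le pl andbT /=.
by have := ltn_ord l; lia.
Qed.

(** The share of one label set in the term of index [J] once the factorials of all gaps are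
    expanded. *)
Definition weight (J : {ffun 'I_r.+1 -> 'I_k.+1}) (chi : {ffun 'I_k -> 'I_r.+1}) : R :=
  liftg chi * (\prod_c ((content chi c)`! * 'C(content chi c, J c)))%:R.

Lemma content_le chi c : (content chi c <= k)%N.
Proof. by rewrite -[X in (_ <= X)%N]card_ord -cardsT subset_leq_card //; apply/subsetP. Qed.

(* [(a + b)! = a! b! \sum_j 'C(a, j) 'C(b, j)] diagonalizes the form. *)
Lemma interleave_squares :
  \sum_(eta : 'S_N) h (std (fun i => eta (labA r i) : nat)) *
                    h (std (fun i => eta (labB r i) : nat)) =
  \sum_J \sum_tau (\sum_(chi | lowf chi == tau) weight J chi) ^+ 2.
Proof.
rewrite sum_gap_maps.
transitivity (\sum_(psi : {ffun 'I_N -> 'I_r.+1}) \sum_J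
    weight J (labc (labA r) psi) * weight J (labc (labB r) psi)).
  apply: eq_bigr => psi _.
  set x := labc _ psi; set y := labc _ psi.
  transitivity (\sum_(J : {ffun 'I_r.+1 -> 'I_k.+1}) liftg x * liftg y * (\prod_c
     ((content x c)`! * (content y c)`! * ('C(content x c, J c) * 'C(content y c, J c))))%:R).
    rewrite -mulr_sumr -natr_sum; congr (_ * _%:R).
    rewrite -(bigA_distr_bigA (fun c (j : 'I_k.+1) => ((content x c)`! * (content y c)`! *
      ('C(content x c, j) * 'C(content y c, j)))%N)) /=.
    apply: eq_bigr => c _.
    by rewrite content_glue (@fact_addn_sum _ _ k) ?content_le // big_distrr.
  apply: eq_bigr => J _; rewrite /weight mulrACA -natrM -big_split /=.
  congr (_ * _%:R); apply: eq_bigr => c _; exact: mulnACA.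
rewrite exchange_big /=; apply: eq_bigr => J _.
rewrite (sum_labc (fun x y => weight J x * weight J y)).
rewrite (partition_big (fun p => lowf p.1) predT) //=; apply: eq_bigr => tau _.
rewrite expr2 mulr_suml.
under [RHS]eq_bigr do rewrite mulr_sumr.
rewrite [RHS]pair_big_dep /=; apply: eq_bigl => -[x y] /=.
by apply/andP/andP => -[/eqP e1 /eqP e2]; rewrite ?e1 ?e2 ?eqxx // -e1 e2.
Qed.

(** Equal contents give a permutation of the private labels carrying one map to the other, and [h]
    is invariant under it. *)
Lemma liftg_same b chi : lowf chi = lowf (gapf b) -> content chi =1 content (gapf b) ->
  liftg chi = h b.
Proof.
move=> el ec.
pose col (f : {ffun 'I_k -> 'I_r.+1}) (l : 'I_k) : 'I_k + 'I_r.+1 :=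
  if (l < r)%N then inl l else inr (f l).
have cc i : #|[set x | col chi x == i]| = #|[set x | col (gapf b) x == i]|.
  case: i => [i|c].
    by apply: eq_card => x; rewrite !inE /col; case: ifP.
  have E f : #|[set x | col f x == inr c]| = content f c.
    by apply: eq_card => x; rewrite !inE /col; case: ltnP.
  by rewrite !E ec.
have [s sE] := exists_perm_color cc.
have slow (i : 'I_k) : (i < r)%N -> s i = i.
  by move=> ir; have := sE i; rewrite /col ir; case: ifP => // _ [].
have chiE i : chi i = gapf b (s i).
  have := sE i; rewrite /col; have [ir|ir] := ltnP i r.
    move=> _; rewrite slow //; have := congr1 (fun f : {ffun _ -> _} => f i) el.
    by rewrite /lowf !ffunE ir.
  by case: ifP => // _ [->].
have -> : chi = gapf (s * b)%g.
  apply/ffunP => i; apply: val_inj; rewrite /= chiE !gapfE //.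
  by rewrite (gap_perm _ _ slow).
by rewrite liftg_gapf hinv.
Qed.

Lemma sum_content chi : (\sum_c content chi c = k - r)%N.
Proof.
transitivity #|[set l : 'I_k | (r <= l)%N]|.
  rewrite -sum1_card (partition_big chi predT) //=; apply: eq_bigr => c _.
  by rewrite sum1dep_card; apply: eq_card => l; rewrite !inE.
have := cardsC [set l : 'I_k | (l < r)%N]; rewrite card_low // card_ord.
have -> : ~: [set l : 'I_k | (l < r)%N] = [set l : 'I_k | (r <= l)%N].
  by apply/setP => l; rewrite !inE -leqNgt.
by lia.
Qed.

Lemma interleave_gt0 : (exists b, h b != 0) ->
  0 < \sum_(eta : 'S_N) h (std (fun i => eta (labA r i) : nat)) *
                        h (std (fun i => eta (labB r i) : nat)).
Proof.
move=> [b hb]; rewrite interleave_squares.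
(* The square taken at the contents and shared values of [b] is shown to be positive; all others are
   nonnegative. *)
pose J : {ffun 'I_r.+1 -> 'I_k.+1} := [ffun c => inord (content (gapf b) c)].
have JE c : J c = content (gapf b) c :> nat by rewrite ffunE inordK // ltnS content_le.
have sq_ge0 J' tau : 0 <= (\sum_(chi | lowf chi == tau) weight J' chi) ^+ 2.
  exact: sqr_ge0.
rewrite (bigD1 J) //= ltr_wpDr //; first by apply: sumr_ge0 => ? _; apply: sumr_ge0.
rewrite (bigD1 (lowf (gapf b))) //= ltr_wpDr //; first by apply: sumr_ge0.
rewrite exprn_even_gt0 //=; set S := \sum_(_ | _) _.
(* Nonzero terms of [S] all have the sign of [h b]: nonvanishing binomials force every content to be
   at least that of [b], equal totals k - r force equality, and then [liftg] takes the value
   [h b]. *)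
suff : 0 < S * h b by apply: contraTneq => ->; rewrite mul0r ltxx.
rewrite /S mulr_suml (bigD1 (gapf b)) //= ltr_wpDr //.
  apply: sumr_ge0 => chi /andP[/eqP el _]; rewrite /weight.
  have [/forallP lec|] := boolP [forall c, (J c <= content chi c)%N]; last first.
    rewrite negb_forall => /existsP[c]; rewrite -ltnNge => lt.
    by rewrite (bigD1 c) //= bin_small // muln0 mul0n mulr0 mul0r.
  rewrite (liftg_same el); last first.
    move=> c; apply/eqP; rewrite eq_sym -JE.
    have := @leqif_sum _ predT (fun c => J c == content chi c :> nat)
      (fun c => J c : nat) (content chi) (fun c _ => leqif_eq (lec c)).
    rewrite sum_content (eq_bigr (content (gapf b))); last by move=> ? _; rewrite JE.
    by rewrite sum_content => /leqif_refl /forallP /(_ c).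
  by rewrite mulrAC mulr_ge0 ?ler0n // -expr2 sqr_ge0.
rewrite /weight liftg_gapf mulrAC mulr_gt0 //; first by rewrite -expr2 exprn_even_gt0.
rewrite ltr0n prodn_gt0 // => c; rewrite muln_gt0 fact_gt0 /= bin_gt0.
by rewrite JE.
Qed.

End Interleave.

(** * Tableaux and dominance *)

Section Tableaux.
Import mathcomp.boot.fintype mathcomp.boot.finset.
Local Open Scope nat_scope.
Variable k : nat.
Implicit Types (la mu : intpart k) (S T : 'I_k -> nat * nat).

Lemma parts_partition la : is_partition k (parts la).
Proof. exact: (valP la). Qed.

Lemma sumn_parts la : sumn (parts la) = k.
Proof. by have /and3P[_ _ /eqP] := parts_partition la. Qed.

Lemma parts_sorted la : sorted geq (parts la).
Proof. by have /and3P[] := parts_partition la. Qed.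

Lemma parts_neq0 la : 0 \notin parts la.
Proof. by have /and3P[] := parts_partition la. Qed.

Lemma size_parts la : size (parts la) <= k.
Proof. by rewrite size_map size_bseq. Qed.

Lemma parts_le_head la a : nth 0 (parts la) a <= head 0 (parts la).
Proof.
have := parts_sorted la; case: (parts la) => [|x s] /=; first by rewrite nth_nil.
rewrite path_sortedE; last by move=> a1 a2 a3 h1 h2; exact: leq_trans h2 h1.
case/andP => /allP h _; case: a => [|a] //=.
have [lt|ge] := ltnP a (size s); last by rewrite nth_default.
by apply: h; rewrite mem_nth.
Qed.

Let ord_sumn la (i : 'I_k) : i < sumn (parts la). Proof. by rewrite sumn_parts. Qed.

Lemma tableau_col la i : (tableau la i).2 < nth 0 (parts la) (tableau la i).1.
Proof. exact: reshape_offsetP. Qed.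

Lemma tableau_row la i : (tableau la i).1 < k.
Proof. by apply: leq_trans (size_parts la); apply: reshape_indexP. Qed.

Lemma tableau_inj la : injective (tableau la).
Proof.
move=> i j [e1 e2]; apply: val_inj.
by rewrite /= -(reshape_indexK (parts la) i) -(reshape_indexK (parts la) j) e1 e2.
Qed.

Lemma tableau_surj la a b : b < nth 0 (parts la) a -> exists i, tableau la i == (a, b).
Proof.
move=> lt; have lk := flatten_indexP lt; rewrite sumn_parts in lk.
by exists (Ordinal lk); rewrite /tableau /= flatten_indexKl // flatten_indexKr.
Qed.

Lemma card_tableau_row_lt la a j :
  #|[set i | ((tableau la i).1 == a) && ((tableau la i).2 < j)]| =
  minn (nth 0 (parts la) a) j.
Proof.
have ex (b : 'I_(minn (nth 0 (parts la) a) j)) : exists i, tableau la i == (a, val b).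
  by apply: tableau_surj; have := ltn_ord b; rewrite leq_min => /andP[].
have [f fE] := fin_all_exists ex.
have fi : injective f.
  move=> b b' e; have := fE b; rewrite e (eqP (fE b')) => /eqP[].
  by move=> /val_inj.
rewrite -[RHS]card_ord -(card_imset _ fi); apply: eq_card => i.
rewrite inE; apply/andP/imsetP => [[/eqP ra lt]|[b _ ->]].
  have lb : (tableau la i).2 < minn (nth 0 (parts la) a) j.
    by rewrite leq_min lt andbT -ra tableau_col.
  exists (Ordinal lb) => //; apply: (@tableau_inj la).
  by rewrite (eqP (fE (Ordinal lb))) [LHS]surjective_pairing ra.
rewrite (eqP (fE b)) /= eqxx; split=> //.
by have := ltn_ord b; rewrite leq_min => /andP[].
Qed.

Lemma card_tableau_row la a :
  #|[set i | (tableau la i).1 == a]| = nth 0 (parts la) a.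
Proof.
rewrite -[RHS]minnn -card_tableau_row_lt; apply: eq_card => i; rewrite !inE.
by case: eqP => //= <-; rewrite tableau_col.
Qed.

(** The hypothesis of the dominance lemma; where it fails, some transposition preserves both the
    rows of [T] and the columns of [S]. *)
Definition transverse T S :=
  forall i j, (T i).1 = (T j).1 -> (S i).2 = (S j).2 -> i = j.

Definition col_count S j := #|[set i | (S i).2 < j]|.

Lemma col_count_rows la S j :
  col_count S j = \sum_(a < k) #|[set i | ((tableau la i).1 == a) && ((S i).2 < j)]|.
Proof.
rewrite /col_count -sum1_card.
rewrite (partition_big (fun i => Ordinal (tableau_row la i)) predT) //=.
apply: eq_bigr => a _; rewrite sum1dep_card; apply: eq_card => i.
by rewrite !inE -val_eqE /= andbC.
Qed.

(** Entries of one row lie in different columns of [S], so at most j of them are in the first j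
    columns. *)
Lemma transverse_row la S a j : transverse (tableau la) S ->
  #|[set i | ((tableau la i).1 == a) && ((S i).2 < j)]| <= minn (nth 0 (parts la) a) j.
Proof.
move=> tr; rewrite leq_min -{1}card_tableau_row; apply/andP; split.
  by apply: subset_leq_card; apply/subsetP => i; rewrite !inE => /andP[].
set A := [set _ | _].
have u : uniq [seq (S i).2 | i <- enum A].
  rewrite map_inj_in_uniq ?enum_uniq // => x y; rewrite !mem_enum !inE.
  by move=> /andP[/eqP <- _] /andP[/eqP e _]; apply: tr.
have := uniq_leq_size (s2 := iota 0 j) u; rewrite size_map size_iota -cardE; apply.
by move=> v /mapP[i]; rewrite mem_enum inE mem_iota => /andP[_ lt] ->.
Qed.

Lemma col_count_tableau la j :
  col_count (tableau la) j = \sum_(a < k) minn (nth 0 (parts la) a) j.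
Proof.
rewrite (col_count_rows la); apply: eq_bigr => a _; exact: card_tableau_row_lt.
Qed.

(** The dominance inequality between partial sums of column lengths. *)
Lemma transverse_col_count la S j : transverse (tableau la) S ->
  col_count S j <= col_count (tableau la) j.
Proof.
move=> tr; rewrite (col_count_rows la) col_count_tableau.
by apply: leq_sum => a _; apply: transverse_row.
Qed.

(* In a transverse pair the boxes (row of [T], column of [S]) are distinct; when the
   column lengths agree they fill the diagram. *)
Lemma transverse_col la S : transverse (tableau la) S ->
  (forall j, col_count S j = col_count (tableau la) j) ->
  forall i, (S i).2 < nth 0 (parts la) (tableau la i).1.
Proof.
move=> tr ec i; set a := (tableau la i).1; set j := nth 0 _ a.
have := @leqif_sum _ predT _ _ _ (fun (a : 'I_k) _ => leqif_eq (transverse_row a j tr)).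
rewrite -col_count_rows -col_count_tableau ec => /leqif_refl /forallP.
move=> /(_ (Ordinal (tableau_row la i))) /= /eqP; rewrite -/a -/j minnn.
rewrite /j -card_tableau_row => e.
have sub : [set i | ((tableau la i).1 == a) && ((S i).2 < j)] \subset
           [set i | (tableau la i).1 == a].
  by apply/subsetP => x; rewrite !inE => /andP[].
have := subset_leqif_cards sub; rewrite /j -card_tableau_row e => /leqif_refl /eqP es.
have := congr1 (fun A : {set 'I_k} => i \in A) es; rewrite !inE eqxx /=.
by rewrite !card_tableau_row.
Qed.

(** First differences of the column counts are the numbers of parts above j; second differences give
    the multiplicities of the parts. *)
Lemma col_count_inj la mu :
  (forall j, col_count (tableau la) j = col_count (tableau mu) j) -> la = mu.
Proof.
move=> e.
suff pe : perm_eq (parts la) (parts mu).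
  have epq : parts la = parts mu.
    apply: (sorted_eq (leT := geq)) (parts_sorted la) (parts_sorted mu) pe.
      by move=> x y z h1 h2; exact: leq_trans h2 h1.
    by move=> x y h; apply/eqP; rewrite eqn_leq andbC.
  do 2! apply: val_inj; exact: (inj_map val_inj epq).
have cE (nu : intpart k) j : \sum_(a < k) minn (nth 0 (parts nu) a) j.+1 =
    \sum_(a < k) minn (nth 0 (parts nu) a) j + count (fun x => j < x) (parts nu).
  have -> : count (fun x => j < x) (parts nu) = \sum_(a < k) (j < nth 0 (parts nu) a).
    rewrite -sum1_count (big_nth 0) big_mkord big_mkcond /=.
    rewrite (big_ord_widen k (fun a => if j < nth 0 (parts nu) a then 1 else 0)) ?size_parts //.
    rewrite big_mkcond /=; apply: eq_bigr => a _.
    by case: ltnP => h; [case: ifP|rewrite nth_default].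
  rewrite -big_split /=; apply: eq_bigr => a _.
  by case: ltnP; lia.
have gt j : count (fun x => j < x) (parts la) = count (fun x => j < x) (parts mu).
  have := e j.+1; rewrite !col_count_tableau !cE -!col_count_tableau e.
  exact: addnI.
apply/allP => x _ /=; apply/eqP; case: x => [|x].
  by rewrite !(count_memPn _) ?parts_neq0.
have E (s : seq nat) : count (fun y => x < y) s = count_mem x.+1 s + count (fun y => x.+1 < y) s.
  elim: s => //= y s ->; case: (ltngtP y x.+1) => h; rewrite ?eqxx; lia.
by have := gt x; rewrite !E gt => /addIn.
Qed.

End Tableaux.

(** * Specht modules inside the regular representation *)

Section Specht.
Import mathcomp.boot.fintype mathcomp.boot.finset.
Variables (R : realType) (k : nat).
Local Notation G := [set: 'S_k]%G.
Local Notation aG := (regular_repr R G).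
Implicit Types (la mu : intpart k) (S T : 'I_k -> nat * nat) (s p q : 'S_k).

Definition coefg (v : 'rV[R]_(nSym k)) (s : 'S_k) : R := v 0 (gring_index G s).

Lemma coefg_inj (v w : 'rV[R]_(nSym k)) : (forall s, coefg v s = coefg w s) -> v = w.
Proof. by move=> e; apply/rowP => a; rewrite -[a](gring_valK (G := G)); exact: e. Qed.

Lemma coefg_regular v x s : coefg (v *m aG x) s = coefg v (s * x^-1)%g.
Proof.
rewrite /coefg mxE (bigD1 (gring_index G (s * x^-1)%g)) //= big1 => [|i ne].
  by rewrite /regular_mx !mxE gring_indexK ?inE // mulgKV !eqxx mulr1 addr0.
rewrite /regular_mx !mxE eqxx /=; case: eqP => [e|_]; last by rewrite mulr0.
case/eqP: ne; rewrite -(gring_valK i); congr gring_index.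
have := congr1 enum_val e; rewrite !gring_indexK ?inE // => ->.
by rewrite mulgK.
Qed.

Lemma coefg_sum (I : finType) (P : pred I) (F : I -> 'rV[R]_(nSym k)) s :
  coefg (\sum_(i | P i) F i) s = \sum_(i | P i) coefg (F i) s.
Proof. by rewrite /coefg summxE. Qed.

Lemma coefg_scale a v s : coefg (a *: v) s = a * coefg v s.
Proof. by rewrite /coefg mxE. Qed.

(** The regular action multiplies on the right. Row invariance sits on that side and is special to
    the generator; column alternation sits on the other side, so it passes to the whole cyclic
    module. *)
Definition row_inv T (v : 'rV[R]_(nSym k)) :=
  forall p s, p \in row_group T -> coefg v (s * p)%g = coefg v s.
Definition col_alt T (v : 'rV[R]_(nSym k)) :=
  forall q s, q \in col_group T -> coefg v (q * s)%g = (-1) ^+ q * coefg v s.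

Lemma row_group_M T p p' : p \in row_group T -> p' \in row_group T ->
  (p * p')%g \in row_group T.
Proof.
rewrite !inE => /forallP h /forallP h'; apply/forallP => i.
by rewrite permM (eqP (h' _)) h.
Qed.

Lemma row_group_V T p : p \in row_group T -> (p^-1)%g \in row_group T.
Proof.
rewrite !inE => /forallP h; apply/forallP => i.
by rewrite -[in X in _ == X](permKV p i) eq_sym.
Qed.

Lemma col_group_M T p p' : p \in col_group T -> p' \in col_group T ->
  (p * p')%g \in col_group T.
Proof.
rewrite !inE => /forallP h /forallP h'; apply/forallP => i.
by rewrite permM (eqP (h' _)) h.
Qed.

Lemma col_group_V T p : p \in col_group T -> (p^-1)%g \in col_group T.
Proof.
rewrite !inE => /forallP h; apply/forallP => i.
by rewrite -[in X in _ == X](permKV p i) eq_sym.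
Qed.

Lemma coefg_young T s :
  coefg (young_symmetrizer R T) s =
  \sum_(p in row_group T) \sum_(q in col_group T) (-1) ^+ q * (s == (q * p)%g)%:R.
Proof.
rewrite /young_symmetrizer coefg_sum; apply: eq_bigr => p _.
rewrite coefg_sum; apply: eq_bigr => q _; rewrite coefg_scale /coefg mxE eqxx /=.
congr (_ * (nat_of_bool _)%:R); apply/eqP/eqP => [e|-> //].
by have := congr1 enum_val e; rewrite !gring_indexK ?inE.
Qed.

Lemma young_row_inv T : row_inv T (young_symmetrizer R T).
Proof.
move=> p s pP; rewrite !coefg_young (reindex_inj (mulIg p)) /=.
apply: eq_big => [p'|p' _].
  apply/idP/idP => h; last exact: row_group_M.
  by rewrite -(mulgK p p'); apply: row_group_M => //; apply: row_group_V.
apply: eq_bigr => q _; congr (_ * (nat_of_bool _)%:R).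
by rewrite mulgA (inj_eq (mulIg p)).
Qed.

Lemma young_col_alt T : col_alt T (young_symmetrizer R T).
Proof.
move=> q s qQ; rewrite !coefg_young mulr_sumr; apply: eq_bigr => p _.
rewrite mulr_sumr (reindex_inj (mulgI q)) /=; apply: eq_big => [q'|q' _].
  apply/idP/idP => h; last exact: col_group_M.
  by rewrite -(mulKg q q'); apply: col_group_M => //; apply: col_group_V.
by rewrite odd_permM signr_addb -mulrA -mulgA (inj_eq (mulgI q)).
Qed.

(** A permutation preserving all rows and all columns is trivial, so 1 is a product q p only for q =
    p = 1. *)
Lemma young_coef1 T : injective T -> coefg (young_symmetrizer R T) 1%g = 1.
Proof.
move=> Ti; have id1 : (1%g \in row_group T) && (1%g \in col_group T).
  by rewrite !inE; apply/andP; split; apply/forallP => i; rewrite perm1.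
have /andP[idP idQ] := id1.
rewrite coefg_young (bigD1 1%g) //= (bigD1 1%g) //=.
rewrite mulg1 eqxx odd_perm1 expr0 mulr1 !big1 ?addr0 //.
  move=> p /andP[pP p1]; apply: big1 => q qQ; case: eqP => [e|_]; last by rewrite mulr0.
  case/eqP: p1; apply/permP => i; rewrite perm1; apply: Ti.
  have qE : q = (p^-1)%g by rewrite -[LHS](mulgK p) -e mul1g.
  move: pP qQ; rewrite qE inE => /forallP hp /(@col_group_V T).
  rewrite invgK inE => /forallP hq.
  by rewrite [LHS]surjective_pairing (eqP (hp i)) (eqP (hq i)) -surjective_pairing.
by move=> q /andP[_ q1]; rewrite mulg1 eq_sym (negPf q1) mulr0.
Qed.

Lemma col_alt_cyclic T u v : col_alt T u -> (v <= cyclic_mx aG u)%MS -> col_alt T v.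
Proof.
move=> ua /cyclic_mxP[A /envelop_mxP[a ->] ->] q s qQ.
rewrite mulmx_sumr !coefg_sum mulr_sumr; apply: eq_bigr => x _.
rewrite -scalemxAr !coefg_scale !coefg_regular -mulgA [coefg u (q * _)%g]ua //.
by rewrite mulrCA.
Qed.

Lemma row_inv_regular T v p : row_inv T v -> p \in row_group T -> v *m aG p = v.
Proof.
move=> vi pP; apply: coefg_inj => s; rewrite coefg_regular vi //.
exact: row_group_V.
Qed.

(** A failure of transversality gives a transposition that is a row move on one side of [s] and a
    column move on the other, so the coefficient equals its negative. *)
Lemma coefg_eq0 T S v s : row_inv T v -> col_alt S v ->
  ~ transverse T (S \o (s^-1)%g) -> coefg v s = 0.
Proof.
move=> vr vc nt.
have [/existsP[i /existsP[j /and3P[/eqP er /eqP ec ne]]]|no] :=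
  boolP [exists i, exists j, [&& (T i).1 == (T j).1,
    (S (s^-1%g i)).2 == (S (s^-1%g j)).2 & i != j]]; last first.
  case: nt => i j er ec; apply/eqP; apply: contraNT no => ne.
  by apply/existsP; exists i; apply/existsP; exists j; rewrite er eqxx ne andbT; apply/eqP.
have tP : tperm i j \in row_group T.
  rewrite inE; apply/forallP => x.
  by case: tpermP => [->|->|_ _] //; rewrite er.
have tQ : tperm (s^-1%g i) (s^-1%g j) \in col_group S.
  rewrite inE; apply/forallP => x.
  by case: tpermP => [->|->|_ _] //; rewrite ec.
have := vr _ s tP.
have -> : (s * tperm i j)%g = (tperm (s^-1%g i) (s^-1%g j) * s)%g.
  by rewrite -tpermJ conjgE invgK -!mulgA mulVg mulg1.
rewrite vc // odd_tperm (inj_eq (@perm_inj _ _)) ne expr1 mulN1r => e.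
by lra.
Qed.

(** The box formed by the row of i and the column of s^-1 i lies in the diagram; moving each i to
    the entry of that box is the row permutation sought. *)
Lemma transverse_factor la s : transverse (tableau la) (tableau la \o (s^-1)%g) ->
  exists2 p, p \in row_group (tableau la) & (s * p)%g \in col_group (tableau la).
Proof.
move=> tr.
have cc j : col_count (tableau la \o (s^-1)%g) j = col_count (tableau la) j.
  rewrite /col_count -(card_imset _ (@perm_inj _ (s^-1)%g)); apply: eq_card => i.
  rewrite inE; apply/imsetP/idP => [[x]|h]; first by rewrite inE => h ->.
  by exists (s i); rewrite ?inE /= permK.
have ex i : exists x, tableau la x == ((tableau la i).1, (tableau la (s^-1%g i)).2).
  by apply: tableau_surj; exact: (transverse_col tr cc).
pose u i := xchoose (ex i).
have uE i : tableau la (u i) = ((tableau la i).1, (tableau la (s^-1%g i)).2).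
  by apply/eqP; exact: xchooseP (ex i).
have ui : injective u.
  move=> i j e; have := uE i; rewrite e uE => -[e1 e2]; exact: tr.
exists (perm ui); rewrite inE; apply/forallP => i.
  by rewrite permE uE.
by rewrite permM permE uE /= permK.
Qed.

(** Each [s] has coefficient 0 or factors into a column and a row permutation, so the coefficient at
    1 determines the vector. This makes endomorphisms scalar. *)
Lemma coefg_eq0_of1 la v : row_inv (tableau la) v -> col_alt (tableau la) v ->
  coefg v 1%g = 0 -> v = 0.
Proof.
move=> vr vc v1; apply: coefg_inj => s; rewrite [RHS]mxE.
have [/transverse_factor[p pP qQ]|nt] := pselect (transverse (tableau la) (tableau la \o (s^-1)%g)).
  rewrite -(vr p) // -[(s * p)%g]mulg1 vc // v1 mulr0.
  by [].
exact: (coefg_eq0 vr vc nt).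
Qed.

(** Transversality both ways would give dominance both ways, hence equal shapes. *)
Lemma no_transverse_pair la mu : la != mu ->
  (forall s, ~ transverse (tableau la) (tableau mu \o (s^-1)%g)) \/
  (forall s, ~ transverse (tableau mu) (tableau la \o (s^-1)%g)).
Proof.
have cc nu s j : col_count (tableau nu \o (s^-1)%g) j = col_count (tableau nu) j.
  rewrite /col_count -(card_imset _ (@perm_inj _ (s^-1)%g)); apply: eq_card => i.
  rewrite inE; apply/imsetP/idP => [[x]|h]; first by rewrite inE => h ->.
  by exists (s i); rewrite ?inE /= permK.
move=> ne.
have [h|/existsNP[s /contrapT t1]] := pselect (forall s, ~ transverse (tableau la) (tableau mu \o (s^-1)%g)); first by left.
right => s' t2; case/eqP: ne; apply: col_count_inj => j.
apply/eqP; rewrite eqn_leq -{1}(cc la s') (transverse_col_count j t2) /=.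
by rewrite -(cc mu s) (transverse_col_count j t1).
Qed.

Local Notation young la := (young_symmetrizer R (tableau la)).
Local Notation spec la := (simple_repr R la).

Lemma young_neq0 la : young la != 0.
Proof.
apply/eqP => e; have := young_coef1 (@tableau_inj _ la); rewrite e /coefg mxE => /eqP.
by rewrite eq_sym oner_eq0.
Qed.

Lemma young_in la : (young la <= simple_mx R la)%MS.
Proof. exact: cyclic_mx_id. Qed.

Definition gen la : 'rV[R]_(dim_simple R la) := in_submod (simple_mx R la) (young la).

Lemma val_gen_young la : val_submod (gen la) = young la.
Proof. exact: in_submodK (young_in la). Qed.

Lemma gen_row la p : p \in row_group (tableau la) -> gen la *m spec la p = gen la.
Proof.
move=> pP; rewrite /gen -in_submodJ ?young_in //.
by rewrite (row_inv_regular (@young_row_inv _) pP).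
Qed.

Lemma val_col_alt la (w : 'rV[R]_(dim_simple R la)) : col_alt (tableau la) (val_submod w).
Proof. exact: col_alt_cyclic (@young_col_alt _) (val_submodP w). Qed.

(** The image of the generator keeps its row invariance for [la] and lies in the module of [mu],
    hence alternates along columns; the two symmetries together decide which homomorphisms exist. *)
Lemma gen_hom_row_inv la mu (f : 'M[R]_(dim_simple R la, dim_simple R mu)) :
  (forall s, spec la s *m f = f *m spec mu s) ->
  row_inv (tableau la) (val_submod (gen la *m f)).
Proof.
move=> fh p s pP; rewrite -[RHS]/(coefg (val_submod (gen la *m f)) s).
have e : val_submod (gen la *m f) *m aG p = val_submod (gen la *m f).
  rewrite -(val_submodJ (cyclic_mx_module aG (young mu))) ?inE //.
  have -> : gen la *m f *m submod_mx (cyclic_mx_module aG (young mu)) p =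
            gen la *m spec la p *m f.
    transitivity (gen la *m (f *m spec mu p)); first exact: esym (mulmxA _ _ _).
    by rewrite -fh mulmxA.
  by rewrite gen_row.
by rewrite -{1}e coefg_regular mulgK.
Qed.

Lemma gen_generates la mu (f : 'M[R]_(dim_simple R la, dim_simple R mu)) :
  (forall s, spec la s *m f = f *m spec mu s) -> gen la *m f = 0 -> f = 0.
Proof.
move=> fh f0; apply/row_matrixP => i; rewrite row0 rowE.
set w := delta_mx 0 i; have /cyclic_mxP[A /envelop_mxP[a ->] e] := val_submodP w.
have we : w = gen la *m (\sum_(x in G) a x *: spec la x).
  apply: (@val_submod_inj _ _ (simple_mx R la)); rewrite e !mulmx_sumr raddf_sum.
  apply: eq_bigr => x _; rewrite -!scalemxAr [RHS]linearZ /=; congr (_ *: _).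
  by rewrite (val_submodJ (cyclic_mx_module aG (young la))) ?inE // val_gen_young.
rewrite we -mulmxA mulmx_suml mulmx_sumr big1 // => x _.
by rewrite -scalemxAl -scalemxAr fh mulmxA f0 mul0mx scaler0.
Qed.

(** Homomorphisms vanish in the direction in which dominance fails; the other direction is recovered
    later by transposing orthogonal matrices. *)
Lemma spec_hom_neq la mu : la != mu ->
  (forall f : 'M[R]_(dim_simple R la, dim_simple R mu),
     (forall s, spec la s *m f = f *m spec mu s) -> f = 0) \/
  (forall f : 'M[R]_(dim_simple R mu, dim_simple R la),
     (forall s, spec mu s *m f = f *m spec la s) -> f = 0).
Proof.
move=> /no_transverse_pair[] nt; [left|right] => f fh; apply: (gen_generates fh);
  apply: (@val_submod_inj _ _ (simple_mx R _)); rewrite linear0; apply: coefg_inj => s;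
  rewrite [RHS]mxE; exact: coefg_eq0 (gen_hom_row_inv fh) (@val_col_alt _ _) (nt s).
Qed.

(** Subtracting the right scalar kills the coefficient at 1 of the image of the generator, hence the
    image, hence the map. *)
Lemma spec_hom_scalar la (f : 'M[R]_(dim_simple R la)) :
  (forall s, spec la s *m f = f *m spec la s) -> exists a, f = a%:M.
Proof.
move=> fh; set y := val_submod (gen la *m f); exists (coefg y 1%g).
apply/eqP; rewrite -subr_eq0; apply/eqP; set f' := _ - _.
have fh' s : spec la s *m f' = f' *m spec la s.
  by rewrite mulmxBr mulmxBl fh scalar_mxC.
apply: (gen_generates fh'); apply: (@val_submod_inj _ _ (simple_mx R la)); rewrite linear0.
apply: coefg_eq0_of1 (gen_hom_row_inv fh') (@val_col_alt _ _) _.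
rewrite mulmxBr linearB /= -/y mul_mx_scalar linearZ /= val_gen_young.
rewrite /coefg !mxE -![_ _ _ (gring_index _ _)]/(coefg _ _).
by rewrite young_coef1 ?mulr1 ?subrr //; exact: tableau_inj.
Qed.

Lemma gen_neq0 la : gen la != 0.
Proof. by apply: contraNneq (young_neq0 la) => e; rewrite -val_gen_young e linear0. Qed.

Lemma pchar_group : pgroup.pgroup ([pchar R]^')%N G.
Proof.
by apply: sub_in_pnat (pnat_pi (cardG_gt0 _)) => i _ _; rewrite inE /= pchar_num.
Qed.

(** By Maschke a submodule has an invariant complement; the projection along it is an endomorphism,
    thus scalar, so a nonzero submodule is everything. *)
Lemma spec_abs_irr la : mx_absolutely_irreducible (spec la).
Proof.
apply: cent_mx_scalar_abs_irr.
  apply/mx_irrP; split.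
    rewrite lt0n; apply/eqP => d0; case/eqP: (gen_neq0 la).
    by apply/rowP => i; have := leq_trans (ltn_ord i) (eq_leq d0).
  move=> U Um U0; have [V Vm sUV dUV] := mx_Maschke_pchar (spec la) pchar_group Um (submx1 U).
  have /mxdirect_addsP cUV := dUV.
  have full : row_full (U + V)%MS by rewrite -sub1mx sUV.
  have hom := proj_mx_hom cUV Um Vm.
  have cent : centgmx (spec la) (proj_mx U V).
    by rewrite -row_full_dom_hom -sub1mx (submx_trans _ hom) // sub1mx.
  have [s|a aE] := @spec_hom_scalar la (proj_mx U V).
    by have /centgmxP := cent => /(_ s) ->; rewrite ?inE.
  have UE := proj_mx_id cUV (submx_refl U); rewrite aE mul_mx_scalar in UE.
  have a1 : a = 1.
    apply/eqP; rewrite -subr_eq0; apply: contraNT U0 => a0; apply/eqP.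
    apply: (scalerI a0); rewrite scaler0 scalerBl UE scale1r subrr //.
  have := proj_mx_sub U V 1%:M; rewrite mul1mx aE a1.
  by rewrite sub1mx.
apply: leq_trans (mxrankS _) (rank_leq_row (mxvec (1%:M : 'M[R]_(dim_simple R la)))).
apply/memmx_subP => f; rewrite memmx_cent_envelop => /centgmxP fc.
have [s|a ->] := @spec_hom_scalar la f; first by rewrite fc ?inE.
by rewrite memmx1 scalar_mx_is_scalar.
Qed.

Lemma spec_rsim_inj la mu : mx_rsim (spec la) (spec mu) -> la = mu.
Proof.
move=> sim; apply/eqP; apply: contraT => ne.
have zero la0 mu0 : mx_rsim (spec la0) (spec mu0) ->
    (forall f : 'M[R]_(dim_simple R la0, dim_simple R mu0),
     (forall s, spec la0 s *m f = f *m spec mu0 s) -> f = 0) -> False.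
  move=> [B _ Bf Bh] h0; have B0 : B = 0 by apply: h0 => s; rewrite Bh ?inE.
  have := gen_neq0 la0; move: Bf; rewrite /row_free B0 mxrank0 => /eqP d0 /eqP[].
  by apply/rowP => i; have := leq_trans (ltn_ord i) (eq_leq (esym d0)).
by case: (spec_hom_neq ne) => h0; case: (zero _ _ _ h0) => //; apply: mx_rsim_sym.
Qed.

Lemma coefg_spec la (w : 'rV[R]_(dim_simple R la)) h s :
  coefg (val_submod (w *m spec la h)) s = coefg (val_submod w) (s * h^-1)%g.
Proof.
by rewrite (val_submodJ (cyclic_mx_module aG (young la))) ?inE // coefg_regular.
Qed.

(** By pigeonhole two of these more than lambda_1 points have preimages under [s] in one column;
    swapping them reindexes the sum but changes its sign. *)
Lemma spec_sym_sum0 la (A : {set 'I_k}) : (head 0%N (parts la) < #|A|)%N ->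
  \sum_(h : 'S_k | perm_on A h) spec la h = 0.
Proof.
move=> lt; apply/row_matrixP => i; rewrite row0 rowE; set w := delta_mx 0 i.
apply: (@val_submod_inj _ _ (simple_mx R la)); rewrite linear0; apply: coefg_inj => s.
rewrite [RHS]mxE mulmx_sumr raddf_sum coefg_sum.
under eq_bigr do rewrite coefg_spec.
set v := val_submod w; have va : col_alt (tableau la) v := @val_col_alt la w.
have colh x : ((tableau la x).2 < head 0%N (parts la))%N.
  exact: leq_trans (tableau_col la x) (parts_le_head la _).
have [i0 [j0 [iA jA ne ec]]] : exists i0 j0, [/\ i0 \in A, j0 \in A, i0 != j0 &
    (tableau la (s^-1%g i0)).2 = (tableau la (s^-1%g j0)).2].
  apply: contrapT => no; move: lt; rewrite ltnNge => /negP[].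
  rewrite -[X in (_ <= X)%N]card_ord.
  apply: (@leq_card_in _ _ (fun x => Ordinal (colh (s^-1%g x)))) => x y xA yA /(congr1 val) /= e.
  by apply: contrapT => /eqP xy; apply: no; exists x, y.
have tA : perm_on A (tperm i0 j0).
  by rewrite /perm_on; apply/subsetP => x; rewrite inE; case: tpermP => [->|->|]; rewrite ?eqxx.
have tQ : tperm (s^-1%g i0) (s^-1%g j0) \in col_group (tableau la).
  rewrite inE; apply/forallP => x.
  by case: tpermP => [->|->|_ _] //; rewrite ec.
set X := \sum_(_ | _) _; suff : X = - X by move=> e; lra.
rewrite {1}/X (reindex_inj (mulIg (tperm i0 j0))) /= -sumrN.
apply: eq_big => [h|h _].
  apply/idP/idP => hA; last exact: perm_onM.
  by rewrite -[h](mulgK (tperm i0 j0)) tpermV; apply: perm_onM.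
rewrite invMg tpermV mulgA.
have -> : (s * tperm i0 j0)%g = (tperm (s^-1%g i0) (s^-1%g j0) * s)%g.
  by rewrite -tpermJ conjgE invgK -!mulgA mulVg mulg1.
by rewrite -mulgA [coefg v (tperm _ _ * _)%g]va // odd_tperm (inj_eq (@perm_inj _ _)) ne expr1 mulN1r.
Qed.

Lemma perm_onJ (A A0 : {set 'I_k}) (g h : 'S_k) : (forall x, (g x \in A) = (x \in A0)) ->
  perm_on A (h ^ g)%g = perm_on A0 h.
Proof.
move=> gA; rewrite /perm_on; apply/subsetP/subsetP => hs x; rewrite inE => ne.
  by rewrite -gA; apply: hs; rewrite inE permJ (inj_eq (@perm_inj _ _)).
by rewrite -[x](permKV g) gA; apply: hs; rewrite inE -(inj_eq (@perm_inj _ g)) -permJ permKV.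
Qed.

(** Up to conjugation [A] is the first row, whose permutations fix the generator, so the sum
    multiplies it by a positive integer. *)
Lemma spec_sym_sum_neq0 la (A : {set 'I_k}) : #|A| = head 0%N (parts la) ->
  \sum_(h : 'S_k | perm_on A h) spec la h != 0.
Proof.
move=> cA; pose A0 := [set i | (tableau la i).1 == 0%N].
have cA0 : #|A0| = #|A| by rewrite cA card_tableau_row nth0.
have [b|g gE] := @exists_perm_color _ _ (mem A0) (mem A).
  have T1 (B : {set 'I_k}) : #|[set x | mem B x == true]| = #|B|.
    by apply: eq_card => x; rewrite !inE eqb_id.
  have F1 (B : {set 'I_k}) : #|[set x | mem B x == false]| = (k - #|B|)%N.
    have := cardsC B; rewrite card_ord.
    have -> : #|[set x | mem B x == false]| = #|~: B|; last by lia.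
    by apply: eq_card => x; rewrite !inE eqbF_neg.
  by case: b; rewrite ?T1 ?F1 cA0.
have S0 : gen la *m (\sum_(h : 'S_k | perm_on A0 h) spec la h) != 0.
  rewrite mulmx_sumr (eq_bigr (fun=> gen la)); last first.
    move=> h hA; apply: gen_row; rewrite inE; apply/forallP => i.
    have [iA|iA] := boolP (i \in A0); last by rewrite (out_perm hA).
    by have := perm_closed i hA; rewrite iA inE => /eqP ->; move: iA; rewrite inE => /eqP ->.
  rewrite sumr_const -scaler_nat scaler_eq0 negb_or gen_neq0 andbT pnatr_eq0 -lt0n.
  by apply/card_gt0P; exists 1%g; exact: perm_on1.
apply: contraNneq S0 => SA0.
suff -> : \sum_(h : 'S_k | perm_on A0 h) spec la h =
    spec la g *m (\sum_(h : 'S_k | perm_on A h) spec la h) *m spec la (g^-1)%g.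
  by rewrite SA0 mulmx0 mul0mx mulmx0.
rewrite [in RHS](reindex_inj (conjg_inj g)) mulmx_sumr mulmx_suml.
apply: eq_big => h; first by rewrite (perm_onJ _ gE).
by move=> _; rewrite -!repr_mxM ?inE // conjgE !mulgA mulgV mul1g mulgK.
Qed.

End Specht.

(** * Conjugacy classes and cycle types *)

Section CycleType.
Import mathcomp.boot.fintype mathcomp.boot.finset.
Local Open Scope nat_scope.

Lemma porbit_expg (T : finType) (s : {perm T}) x a b :
  ((s ^+ a)%g x == (s ^+ b)%g x) = (a == b %[mod #|porbit s x|]).
Proof.
set n := #|porbit s x|.
have n0 : 0 < n by apply/card_gt0P; exists x; exact: porbit_id.
have red c : (s ^+ c)%g x = iter (c %% n) s x.
  rewrite permX {1}(divn_eq c n) addnC; elim: (c %/ n) => [|d IH]; first by rewrite addn0.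
  by rewrite mulSn addnCA addnC iterD iter_porbit.
rewrite !red; apply/eqP/eqP => [e|-> //].
have := uniq_traject_porbit s x; rewrite -/n => u.
have lt c : c %% n < n by rewrite ltn_mod.
apply/eqP; rewrite -(nth_uniq x _ _ u) ?size_traject ?lt //.
by rewrite !nth_traject ?lt // e.
Qed.

Definition cycle_type k (s : 'S_k) : seq nat :=
  sort geq [seq #|(C : {set 'I_k})| | C <- enum (porbits s)].

(** Cycles of equal length are matched, and s^i r is sent to t^i y for chosen base points r and y;
    exponents matter only modulo the common length. *)
Lemma cycle_type_conj k (s t : 'S_k) : cycle_type s = cycle_type t -> exists g, t = (s ^ g)%g.
Proof.
move=> est.
have pe : perm_eq [seq #|(C : {set 'I_k})| | C <- enum (porbits s)]
                  [seq #|(C : {set 'I_k})| | C <- enum (porbits t)].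
  have h (u : 'S_k) : perm_eq (cycle_type u) [seq #|(C : {set 'I_k})| | C <- enum (porbits u)].
    by rewrite perm_sort.
  by rewrite -(permPl (h s)) est (permPl (h t)).
have sz (u : 'S_k) (C : {set 'I_k}) : #|C| < k.+1.
  by rewrite ltnS -[X in _ <= X]card_ord; exact: max_card.
(* All subsets are coloured, with [None] for those that are not orbits, so that the colouring lemma
   matches orbits by size. *)
pose col (u : 'S_k) (C : {set 'I_k}) : option 'I_k.+1 :=
  if C \in porbits u then Some (Ordinal (sz u C)) else None.
have cnt (u : 'S_k) (n : 'I_k.+1) : #|[set C | col u C == Some n]| =
    count_mem (n : nat) [seq #|(C : {set 'I_k})| | C <- enum (porbits u)].
  rewrite count_map -size_filter -(card_uniqP _); last by apply: filter_uniq; exact: enum_uniq.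
  apply: eq_card => C; rewrite inE mem_filter mem_enum /= /col.
  by case: ifP; rewrite ?andbT ?andbF.
have cntN (u : 'S_k) : #|[set C | col u C == None]| = #|{set 'I_k}| - #|porbits u|.
  rewrite -(cardsC (porbits u)) addKn; apply: eq_card => C; rewrite !inE /col.
  by case: ifP.
have [c|b bE] := @exists_perm_color _ _ (col s) (col t).
  case: c => [n|]; first by rewrite !cnt (seq.permP pe).
  by rewrite !cntN !cardE -!(size_map (fun C : {set 'I_k} => #|C|)) (perm_size pe).
have bP x : b (porbit s x) \in porbits t /\ #|b (porbit s x)| = #|porbit s x|.
  have := bE (porbit s x); rewrite /col (imset_f (porbit s)) //.
  by case: ifP => // h [] e; split.
pose r x := odflt x [pick z in porbit s x].
have rP x : r x \in porbit s x.
  by rewrite /r; case: pickP => // /(_ x); rewrite porbit_id.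
pose y x := odflt x [pick z in b (porbit s x)].
have yP x : y x \in b (porbit s x).
  rewrite /y; case: pickP => // h; have [/imsetP[z _ e] _] := bP x.
  by have := h z; rewrite e porbit_id.
have yO x : porbit t (y x) = b (porbit s x).
  have := yP x; have [/imsetP[z _ ->] _] := bP x.
  by rewrite -eq_porbit_mem => /eqP.
have rO x : porbit s (r x) = porbit s x.
  by apply/eqP; rewrite eq_porbit_mem.
have r_eq x x' : porbit s x = porbit s x' -> r x = r x' /\ y x = y x'.
  move=> e; split.
    by rewrite /r -e; case: pickP => // /(_ x); rewrite porbit_id.
  have := yP x'; rewrite /y -e => yx; case: pickP => // h.
  by have [/imsetP[z _ ez] _] := bP x; have := h z; rewrite ez porbit_id.
have ex x : exists i, (s ^+ i)%g (r x) == x.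
  have : x \in porbit s (r x) by rewrite rO porbit_id.
  by case/porbitP => j e; exists j; apply/eqP/esym.
pose i x := xchoose (ex x).
have iE x : (s ^+ i x)%g (r x) = x by apply/eqP; exact: xchooseP (ex x).
have key x a c : ((s ^+ a)%g (r x) == (s ^+ c)%g (r x)) = ((t ^+ a)%g (y x) == (t ^+ c)%g (y x)).
  by rewrite !porbit_expg yO rO (bP x).2.
pose g x := (t ^+ i x)%g (y x).
have gs x : g (s x) = t (g x).
  have e : porbit s (s x) = porbit s x by rewrite -[s x]/((s ^+ 1)%g x) porbit_perm.
  have [er ey] := r_eq _ _ e.
  rewrite /g ey -permM -expgSr; apply/eqP; rewrite -key -{1}er iE expgSr permM iE.
  exact: eqxx.
have gO x : porbit t (g x) = b (porbit s x).
  by rewrite -yO; apply/eqP; rewrite eq_porbit_mem mem_porbit.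
have gi : injective g.
  move=> x x' e; have ep : porbit s x = porbit s x'.
    by apply: (@perm_inj _ b); rewrite -!gO e.
  have [er ey] := r_eq _ _ ep.
  rewrite -(iE x) -(iE x') -er; apply/eqP; rewrite key; apply/eqP.
  by move: e; rewrite /g -ey.
exists (perm gi); apply/permP => x.
have [z ->] : exists z, x = g z.
  by exists ((perm gi)^-1%g x); rewrite -(permE gi) permKV.
by rewrite -gs -[in RHS](permE gi) permJ permE.
Qed.

Lemma sum_card_porbits k (s : 'S_k) : \sum_(C in porbits s) #|C| = k.
Proof.
rewrite -[RHS]card_ord -sum1_card (partition_big (porbit s) (mem (porbits s))) /=.
  apply: eq_bigr => C /imsetP[y _ ->]; rewrite sum1dep_card; apply: eq_card => x.
  by rewrite inE eq_porbit_mem.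
by move=> x _; exact: imset_f.
Qed.

Lemma cycle_type_part k (s : 'S_k) : exists la : intpart k, parts la == cycle_type s.
Proof.
have pl : perm_eq (cycle_type s) [seq #|(C : {set 'I_k})| | C <- enum (porbits s)].
  by rewrite perm_sort.
have le x : x \in cycle_type s -> x <= k.
  by rewrite (perm_mem pl) => /mapP[C _ ->]; rewrite -[X in _ <= X]card_ord max_card.
have sz : size [seq (inord x : 'I_k.+1) | x <- cycle_type s] <= k.
  rewrite size_map (perm_size pl) size_map -cardE.
  by rewrite -[X in _ <= X]card_ord; exact: leq_imset_card.
have vE : [seq val i | i <- [seq (inord x : 'I_k.+1) | x <- cycle_type s]] = cycle_type s.
  rewrite -map_comp -[RHS]map_id; apply/eq_in_map => x /le xk /=.
  by rewrite inordK.
have part : is_partition k [seq val i | i <- Bseq sz].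
  rewrite /= vE; apply/and3P; split.
  - by apply: sort_sorted => x y; exact: leq_total.
  - rewrite (perm_mem pl); apply/negP => /mapP[C]; rewrite mem_enum => /imsetP[x _ ->] /eqP.
    by rewrite eq_sym (negPf (card_porbit_neq0 s x)).
  - by rewrite (perm_sumn pl) sumnE big_map big_enum /= sum_card_porbits.
by exists (exist _ (Bseq sz) part); rewrite /parts /= vE.
Qed.

Lemma card_classes_le k : #|classes [set: 'S_k]| <= #|{: intpart k}|.
Proof.
pose phi (C : {set 'S_k}) := xchoose (cycle_type_part (repr C)).
have phiE C : parts (phi C) = cycle_type (repr C) by apply/eqP; exact: xchooseP (cycle_type_part _).
apply: (@leq_card_in _ _ phi) => C D /imsetP[x _ ->] /imsetP[y _ ->] e.
have [g gE] : exists g, repr (y ^: [set: 'S_k])%g = (repr (x ^: [set: 'S_k]) ^ g)%g.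
  by apply: cycle_type_conj; rewrite -!phiE e.
have cl z : exists h, repr (z ^: [set: 'S_k])%g = (z ^ h)%g.
  have : repr (z ^: [set: 'S_k])%g \in (z ^: [set: 'S_k])%g.
    by apply: mem_repr (class_refl _ z).
  by case/imsetP => h _ ->; exists h.
have [h hE] := cl x; have [h' hE'] := cl y.
apply/esym/class_eqP; apply/imsetP; exists (h * g * h'^-1)%g; rewrite ?inE //.
by rewrite !conjgM -hE -gE hE' conjgK.
Qed.

End CycleType.

(** * Completeness of the Specht modules *)

Section Complete.
Variables (R : realType) (k : nat).
Local Notation G := [set: 'S_k]%G.
Local Notation spec la := (simple_repr R la).

(** The centre of the group algebra has the class sums as a basis and splits over the Wedderburn
    components, each contributing at least its identity. *)
Lemma card_irr_le (sG : irrType R G) : (#|sG| <= #|classes G|)%N.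
Proof.
rewrite -(eqnP (classg_base_free R G)) classg_base_center.
rewrite (mxdirect_sums_center (Wedderburn_sum_pchar sG (pchar_group R k))
  (Wedderburn_direct sG) (@Wedderburn_ideal _ _ _ sG)).
rewrite (mxdirectP _) /=; last first.
  apply/mxdirect_sumsP=> i _; apply/eqP; rewrite -submx0.
  rewrite -{2}(mxdirect_sumsP (Wedderburn_direct sG) i) // capmxS ?capmxSl //=.
  by apply/sumsmx_subP=> j ne_ji; rewrite (sumsmx_sup j) ?capmxSl.
rewrite -sum1_card; apply: leq_sum => i _.
have [nz_e Re ideR idRe] := Wedderburn_is_id_pchar (pchar_group R k) i.
have Ze: (mxvec (Wedderburn_id i) <= 'Z(Wedderburn_subring i))%MS.
  rewrite sub_capmx [(_ <= _)%MS]Re.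
  by apply/cent_mxP=> A R_A; rewrite ideR // idRe.
apply: leq_trans (mxrankS Ze).
by rewrite lt0n mxrank_eq0 mxvec_eq0.
Qed.

(** Partitions inject into irreducibles, which are at most as many as classes, which are at most as
    many as partitions. So all irreducibles are Specht modules and the field splits. *)
Lemma sum_dim_simple : (\sum_(la : intpart k) dim_simple R la ^ 2 = k`!)%N.
Proof.
(* [socle_exists] eliminates only into boolean goals. *)
suff : asbool (\sum_(la : intpart k) dim_simple R la ^ 2 = k`!)%N by move/asboolP.
apply: (socle_exists (regular_repr R G)) => sG; apply/asboolP.
have cG := pchar_group R k.
pose f (la : intpart k) : sG := irr_comp sG (spec la).
have fsim la : mx_rsim (spec la) (irr_repr (f la)).
  by apply: rsim_irr_comp_pchar => //; apply: mx_abs_irrW; exact: spec_abs_irr.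
have fi : injective f.
  move=> la mu e; apply: (@spec_rsim_inj R); apply: mx_rsim_trans (fsim la) _.
  by rewrite e; apply: mx_rsim_sym; exact: fsim.
have cc : #|{: intpart k}| = #|sG|.
  apply/eqP; rewrite eqn_leq (leq_card f fi) /=.
  by apply: leq_trans (card_irr_le sG) (card_classes_le k).
have fb : bijective f by apply: inj_card_bij fi _; rewrite cc.
have split : group_splitting_field R G.
  move=> n rG irrG; have simG := rsim_irr_comp_pchar sG cG irrG.
  have [f' _ f'K] := fb; rewrite (mx_rsim_abs_irr simG) -(f'K (irr_comp sG rG)).
  by rewrite -(mx_rsim_abs_irr (fsim _)); exact: spec_abs_irr.
have := sum_irr_degree_pchar sG cG split; rewrite cardsT card_Sn => <-.
rewrite (reindex f) /=; last exact: onW_bij.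
by apply: eq_bigr => la _; have [B e _ _] := fsim la; rewrite e.
Qed.

End Complete.

(** * The real spectral theorem *)

Section Spectral.
Import spectral complex.
Variable R : rcfType.

Lemma row_dot_ge0 n (v : 'rV[R]_n) : 0 <= (v *m v^T) 0 0.
Proof. by rewrite mxE sumr_ge0 // => i _; rewrite mxE -expr2 sqr_ge0. Qed.

Lemma row_dot_eq0 n (v : 'rV[R]_n) : ((v *m v^T) 0 0 == 0) = (v == 0).
Proof.
apply/idP/eqP => [|->]; last by rewrite mul0mx mxE.
rewrite mxE psumr_eq0 => [/allP h|i _]; last by rewrite mxE -expr2 sqr_ge0.
apply/rowP => i; have := h i (mem_index_enum _); rewrite !mxE -expr2 sqrf_eq0.
by move/eqP.
Qed.

(** Stated for the action [C] on an invariant row space, to be used on the complement of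
    eigenvectors already found. A complex eigenvector of [C] yields one of [A], and symmetry makes
    its eigenvalue real. *)
Lemma symmetric_compression_eigenvalue n m (A : 'M[R]_n) (B : 'M[R]_(m, n)) (C : 'M[R]_m) :
  A^T = A -> row_free B -> B *m A = C *m B -> (0 < m)%N -> exists x, eigenvalue C x.
Proof.
move=> symA freeB BA m0.
pose f := real_complex R.
have [a /eigenvalueP[v vC v0]] := eigenvalue_closed (map_mx f C) m0.
set w := v *m map_mx f B.
have wA : w *m map_mx f A = a *: w.
  by rewrite /w -mulmxA -map_mxM BA map_mxM mulmxA vC scalemxAl.
have w0 : w != 0.
  by rewrite /w -(mul0mx _ (map_mx f B)) (inj_eq (row_free_inj _)) // row_free_map.
pose wc := map_mx (@Num.conj R[i]) w.
have N0 : (w *m wc^T) 0 0 != 0.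
  apply: contraNneq w0 => /eqP; rewrite mxE psumr_eq0 => [/allP h|i _]; last first.
    by rewrite !mxE -normCK exprn_ge0.
  apply/eqP/rowP => i; have := h i (mem_index_enum _); rewrite !mxE -normCK.
  by rewrite sqrf_eq0 normr_eq0 => /eqP.
have wcA : wc *m map_mx f A = a^* *: wc.
  have -> : map_mx f A = map_mx (@Num.conj R[i]) (map_mx f A).
    by apply/matrixP => i j; rewrite !mxE; apply/esym/CrealP/complex_realP; exists (A i j).
  by rewrite /wc -map_mxM wA map_mxZ.
have aR : a^* = a.
  apply: (mulIf N0); rewrite -[LHS]/(_ *: (w *m wc^T) 0 0).
  have -> : a * (w *m wc^T) 0 0 = (w *m map_mx f A *m wc^T) 0 0.
    by rewrite wA -scalemxAl [RHS]mxE.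
  have -> : w *m map_mx f A *m wc^T = w *m (wc *m map_mx f A)^T.
    have fA : (map_mx f A)^T = map_mx f A.
      by apply/matrixP => i j; rewrite !mxE -[in RHS]symA mxE.
    by rewrite trmx_mul fA mulmxA.
  by rewrite wcA linearZ /= -scalemxAr [RHS]mxE.
have /CrealP/complex_realP[x xE] := aR.
have : root (char_poly (map_mx f C)) a.
  by rewrite -eigenvalue_root_char; apply/eigenvalueP; exists v.
by rewrite xE -map_char_poly fmorph_root -eigenvalue_root_char; exists x.
Qed.

Lemma orthonormal_eigenvectors n (A : 'M[R]_n) m : A^T = A -> (m <= n)%N ->
  exists (Q : 'M[R]_(m, n)) (d : 'rV[R]_m), Q *m Q^T = 1%:M /\ Q *m A = diag_mx d *m Q.
Proof.
move=> symA; elim: m => [|m IH] mn.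
  by exists 0, 0; split; apply/matrixP => -[].
have [Q [d [QQ QA]]] := IH (ltnW mn).
pose K := kermx Q^T; pose B := row_base K.
have rQ : \rank Q = m.
  apply/eqP; rewrite eqn_leq rank_leq_row -{1}(mxrank1 R m) -QQ; exact: mxrankM_maxl.
have rK : (0 < \rank K)%N by rewrite mxrank_ker mxrank_tr rQ subn_gt0.
have BQ : B *m Q^T = 0 by apply/sub_kermxP; rewrite eq_row_base.
have /submxP[C BA] : (B *m A <= B)%MS.
  rewrite (eq_row_base K); apply/sub_kermxP.
  rewrite -mulmxA; have -> : A *m Q^T = Q^T *m diag_mx d.
    by rewrite -[in LHS]symA -trmx_mul QA trmx_mul tr_diag_mx.
  by rewrite mulmxA BQ mul0mx.
have [x /eigenvalueP[u uC u0]] :=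
  symmetric_compression_eigenvalue symA (row_base_free K) BA rK.
pose v := u *m B.
have v0 : v != 0.
  by rewrite /v -(mul0mx _ B) (inj_eq (row_free_inj (row_base_free K))).
have vA : v *m A = x *: v by rewrite /v -mulmxA BA mulmxA uC scalemxAl.
have vQ : v *m Q^T = 0 by rewrite /v -mulmxA BQ mulmx0.
pose c := Num.sqrt ((v *m v^T) 0 0).
have c0 : c != 0.
  by rewrite /c sqrtr_eq0 -ltNge lt_def row_dot_eq0 v0 row_dot_ge0.
pose e := c^-1 *: v.
have eQ : e *m Q^T = 0 by rewrite /e -scalemxAl vQ scaler0.
have E1 : col_mx e Q *m (col_mx e Q)^T = 1%:M.
  rewrite tr_col_mx mul_col_row eQ QQ.
  have -> : Q *m e^T = 0 by rewrite -[Q]trmxK -trmx_mul eQ trmx0.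
  rewrite scalar_mx_block; congr block_mx.
  apply/matrixP => i j; rewrite !ord1 linearZ /= -scalemxAr -scalemxAl !mxE eqxx.
  have : (v *m v^T) 0 0 = c ^+ 2 by rewrite sqr_sqrtr ?row_dot_ge0.
  rewrite mxE => ->; rewrite expr2 mulKf // mulVf //.
have E2 : col_mx e Q *m A = diag_mx (row_mx x%:M d) *m col_mx e Q.
  rewrite mul_col_mx QA diag_mx_row mul_block_col !mul0mx addr0 add0r; congr col_mx.
  rewrite /e -scalemxAl vA scalerA mulrC -scalerA.
  by apply/matrixP => i j; rewrite !ord1 !mxE big_ord1 !mxE eqxx !mulr1n.
by exists (col_mx e Q), (row_mx x%:M d).
Qed.

Lemma real_spectral n (A : 'M[R]_n) : A^T = A ->
  exists (Q : 'M[R]_n) (d : 'rV[R]_n), Q *m Q^T = 1%:M /\ Q *m A *m Q^T = diag_mx d.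
Proof.
move=> symA; have [Q [d [QQ QA]]] := orthonormal_eigenvectors symA (leqnn n).
by exists Q, d; split=> //; rewrite QA -mulmxA QQ mulmx1.
Qed.

Lemma posdef_sqrt n (B : 'M[R]_n) : B^T = B ->
  (forall v : 'rV[R]_n, v != 0 -> 0 < (v *m B *m v^T) 0 0) ->
  exists S : 'M[R]_n, [/\ S^T = S, S \in unitmx & S *m S = B].
Proof.
move=> symB pos; have [Q [d [QQ QB]]] := real_spectral symB.
have Q'Q : Q^T *m Q = 1%:M by apply: mulmx1C.
have d0 i : 0 < d 0 i.
  pose w := delta_mx 0 i : 'rV[R]_n.
  have := pos (w *m Q).
  have -> : w *m Q *m B *m (w *m Q)^T = w *m diag_mx d *m w^T.
    by rewrite -QB trmx_mul !mulmxA.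
  have -> : (w *m diag_mx d *m w^T) 0 0 = d 0 i.
    rewrite -rowE mxE (bigD1 i) //= big1 ?addr0 => [|j ji].
      by rewrite !mxE !eqxx mulr1 mulr1n.
    by rewrite !mxE (negPf ji) mulr0.
  apply; apply: contraTneq (oner_neq0 R) => e0; rewrite negbK.
  have : (w *m Q *m (w *m Q)^T) 0 0 = 1 :> R.
    by rewrite trmx_mul mulmxA -[_ *m Q *m Q^T]mulmxA QQ mulmx1 -rowE !mxE !eqxx.
  by rewrite e0 mul0mx mxE => <-.
pose S := Q^T *m diag_mx (map_mx Num.sqrt d) *m Q.
have SS : S *m S = B.
  rewrite /S -!mulmxA [Q *m (Q^T *m _)]mulmxA QQ mul1mx [diag_mx _ *m (diag_mx _ *m _)]mulmxA.
  have -> : diag_mx (map_mx Num.sqrt d) *m diag_mx (map_mx Num.sqrt d) = diag_mx d.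
    rewrite mulmx_diag; congr diag_mx; apply/rowP => i; rewrite !mxE -expr2 sqr_sqrtr //.
    exact: ltW.
  by rewrite -QB -!mulmxA Q'Q mulmx1 mulmxA Q'Q mul1mx.
exists S; split=> //; first by rewrite /S !trmx_mul trmxK tr_diag_mx mulmxA.
have [uQ _] := mulmx1_unit QQ.
rewrite /S !unitmx_mul unitmx_tr uQ andbT /= unitmxE det_diag unitfE.
by apply/prodf_neq0 => i _; rewrite mxE sqrtr_eq0 -ltNge.
Qed.

End Spectral.

(** * Orthogonal realizations *)

Section Orthogonalize.
Variables (R : realType) (k d : nat).
Local Notation G := [set: 'S_k]%G.
Variable rG : mx_representation R G d.

Lemma conj_rsim (S : 'M[R]_d) (uS : invmx S \in unitmx) : S \in unitmx ->
  mx_rsim rG (rconj_repr rG uS).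
Proof.
move=> uS'; apply: (@MxReprSim _ _ _ _ _ _ _ S) => // [|x xG].
  by rewrite row_free_unit.
by rewrite rconj_mxE !mulmxA mulmxV // mul1mx invmxK.
Qed.

(** The sum of all rho(s) rho(s)^T is an invariant positive definite form; conjugation by its square
    root turns it into the identity. *)
Lemma orthogonal_rsim : exists rho : mx_representation R G d,
  mx_rsim rG rho /\ forall s, rho s *m (rho s)^T = 1%:M.
Proof.
pose B := \sum_(s : 'S_k) rG s *m (rG s)^T.
have symB : B^T = B.
  by rewrite /B linear_sum; apply: eq_bigr => s _; rewrite /= trmx_mul trmxK.
have posB (v : 'rV[R]_d) : v != 0 -> 0 < (v *m B *m v^T) 0 0.
  move=> v0; rewrite /B mulmx_sumr mulmx_suml summxE (bigD1 1%g) //= ltr_wpDr //.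
    apply: sumr_ge0 => s _; rewrite mulmxA -[_ *m _ *m v^T]mulmxA -trmx_mul.
    exact: row_dot_ge0.
  by rewrite repr_mx1 trmx1 !mulmx1 lt_def row_dot_eq0 v0 row_dot_ge0.
have [S [symS uS SS]] := posdef_sqrt symB posB.
have uS' : invmx S \in unitmx by rewrite unitmx_inv.
exists (rconj_repr rG uS'); split; first exact: conj_rsim.
move=> s; rewrite rconj_mxE invmxK !trmx_mul symS trmx_inv symS !mulmxA.
have inv : rG s *m B *m (rG s)^T = B.
  rewrite /B mulmx_sumr mulmx_suml [RHS](reindex_inj (mulgI s)) /=.
  apply: eq_bigr => t _; rewrite repr_mxM ?inE // trmx_mul !mulmxA.
  by [].
rewrite -(mulmxA (invmx S *m rG s)) SS -(mulmxA (invmx S)) -(mulmxA (invmx S)) inv.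
by rewrite -SS mulmxA mulVmx // mul1mx mulmxV.
Qed.

End Orthogonalize.

Lemma orthogonal_realization (R : realType) (k : nat) :
  exists rho : forall la : intpart k, mx_representation R [set: 'S_k] (dim_simple R la),
    (forall la, mx_rsim (simple_repr R la) (rho la)) /\
    (forall la s, rho la s *m (rho la s)^T = 1%:M).
Proof.
pose rho (la : intpart k) := projT1 (cid (orthogonal_rsim (simple_repr R la))).
by exists rho; split=> la; have [] := projT2 (cid (orthogonal_rsim (simple_repr R la))).
Qed.

Lemma matrix_elementE (R : realType) k d (rG : mx_representation R [set: 'S_k]%G d) i j a :
  matrix_element rG i j 0 a = rG (enum_val a) j i.
Proof. by rewrite mxE mxE. Qed.

(** * The orthonormal basis of matrix elements *)

Section Family.
Variables (R : realType) (k : nat).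
Local Notation G := [set: 'S_k]%G.
Local Notation d la := (dim_simple R la).
Variable rho : forall la : intpart k, mx_representation R G (d la).
Implicit Types la mu : intpart k.
Hypothesis rho_sim : forall la, mx_rsim (simple_repr R la) (rho la).
Hypothesis rho_orth : forall la s, rho la s *m (rho la s)^T = 1%:M.

Lemma rho_tr la s : (rho la s)^T = rho la s^-1%g.
Proof.
have e := rho_orth la s; have [u _] := mulmx1_unit e.
by rewrite repr_mxV ?inE // -[RHS]mulmx1 -e mulmxA mulVmx // mul1mx.
Qed.

Lemma rho_conj la : exists B B' : 'M[R]_(d la), [/\ B *m B' = 1%:M, B' *m B = 1%:M,
  forall s, simple_repr R la s = B *m rho la s *m B' &
  forall s, rho la s = B' *m simple_repr R la s *m B].
Proof.
have [B [B' B'B e]] := mx_rsim_def (rho_sim la).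
have BB' : B *m B' = 1%:M by apply: mulmx1C.
exists B, B'; split=> // s; first by rewrite e ?inE.
by rewrite e ?inE // !mulmxA B'B mul1mx -mulmxA B'B mulmx1.
Qed.

Lemma rho_abs_irr la : mx_absolutely_irreducible (rho la).
Proof. by rewrite -(mx_rsim_abs_irr (rho_sim la)); exact: spec_abs_irr. Qed.

Lemma rho_dim_gt0 la : (0 < d la)%N.
Proof. by have /andP[] := rho_abs_irr la. Qed.

Lemma rho_hom_scalar la (f : 'M[R]_(d la)) :
  (forall s, rho la s *m f = f *m rho la s) -> exists a, f = a%:M.
Proof.
move=> fh; apply/is_scalar_mxP; apply: (mx_abs_irr_cent_scalar (rho_abs_irr la)).
by apply/centgmxP => s _; rewrite fh.
Qed.

(** For orthogonal matrices transposition reverses the direction of a homomorphism, so vanishing in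
    one direction suffices. *)
Lemma rho_hom_neq la mu (f : 'M[R]_(d la, d mu)) : la != mu ->
  (forall s, rho la s *m f = f *m rho mu s) -> f = 0.
Proof.
move=> ne fh.
have [B [B' [BB' B'B se re]]] := rho_conj la.
have [C [C' [CC' C'C se' re']]] := rho_conj mu.
have fht s : rho mu s *m f^T = f^T *m rho la s.
  by rewrite -[s]invgK -(rho_tr la) -(rho_tr mu) -[LHS]trmx_mul -[RHS]trmx_mul fh.
case: (spec_hom_neq R ne) => h0.
  have : B *m f *m C' = 0.
    apply: h0 => s; rewrite se se' -!mulmxA [B' *m (B *m _)]mulmxA B'B mul1mx.
    by rewrite [C' *m (C *m _)]mulmxA C'C mul1mx [rho la s *m _]mulmxA fh -!mulmxA.
  move=> e; have : B' *m (B *m f *m C') *m C = 0 by rewrite e mulmx0 mul0mx.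
  by rewrite !mulmxA B'B mul1mx -mulmxA C'C mulmx1.
have : C *m f^T *m B' = 0.
  apply: h0 => s; rewrite se se' -!mulmxA [C' *m (C *m _)]mulmxA C'C mul1mx.
  by rewrite [B' *m (B *m _)]mulmxA B'B mul1mx [rho mu s *m _]mulmxA fht -!mulmxA.
move=> e; have : C' *m (C *m f^T *m B') *m B = 0 by rewrite e mulmx0 mul0mx.
rewrite !mulmxA C'C mul1mx -mulmxA B'B mulmx1 => /(congr1 trmx).
by rewrite trmxK trmx0.
Qed.

Lemma rho_average_hom la mu (M : 'M[R]_(d la, d mu)) t :
  rho la t *m (\sum_(s : 'S_k) (rho la s)^T *m M *m rho mu s) =
  (\sum_(s : 'S_k) (rho la s)^T *m M *m rho mu s) *m rho mu t.
Proof.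
rewrite mulmx_sumr mulmx_suml (reindex_inj (mulIg t)) /=; apply: eq_bigr => s _.
rewrite !repr_mxM ?inE // trmx_mul !mulmxA rho_orth mul1mx.
by [].
Qed.

(** The sum is an entry of the average of a matrix unit, an intertwiner: zero, or a scalar found
    from its trace. Indices are compared as numbers because their types depend on [la] and [mu]. *)
Lemma schur_orth la mu i j i' j' :
  \sum_(s : 'S_k) rho la s i j * rho mu s i' j' =
  (k`!%:R / (d la)%:R) *
    [&& la == mu, (i : nat) == i' & (j : nat) == j']%:R.
Proof.
pose X := \sum_(s : 'S_k) (rho la s)^T *m delta_mx i i' *m rho mu s.
have XE a b : X a b = \sum_(s : 'S_k) rho la s i a * rho mu s i' b.
  rewrite summxE; apply: eq_bigr => s _; rewrite mxE (bigD1 i') //= big1 ?addr0.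
    rewrite mxE (bigD1 i) //= big1 ?addr0 => [|c ci].
      by rewrite !mxE !eqxx mulr1.
    by rewrite !mxE (negPf ci) mulr0.
  move=> c ci; rewrite mxE big1 ?mul0r // => c' _.
  by rewrite !mxE (negPf ci) andbF mulr0.
rewrite -XE; have Xh := rho_average_hom (delta_mx i i').
have [e|ne] := eqVneq la mu; last by rewrite [X](rho_hom_neq ne Xh) mxE mulr0.
subst mu; have [a aE] := rho_hom_scalar Xh.
have tX : \tr X = k`!%:R * (i == i')%:R.
  rewrite raddf_sum (eq_bigr (fun=> (i == i')%:R)) => [|s _].
    by rewrite sumr_const card_Sn mulr_natl.
  rewrite /= mxtrace_mulC mulmxA rho_orth mul1mx /mxtrace (bigD1 i) //= big1 ?addr0.
    by rewrite mxE eqxx.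
  by move=> c ci; rewrite mxE (negPf ci).
have d0 : (d la)%:R != 0 :> R by rewrite pnatr_eq0 -lt0n rho_dim_gt0.
have aV : a = k`!%:R / (d la)%:R * (i == i')%:R.
  apply: (mulIf d0); rewrite mulrAC divfK // -tX [X]aE mxtrace_scalar.
  by rewrite mulr_natr.
rewrite [X]aE mxE aV /= -!val_eqE /=.
by do 2 case: eqP => _; rewrite ?mulr1 ?mulr0 ?mulr1n ?mulr0n ?mul0rn.
Qed.

Lemma sum_enum_val (F : 'S_k -> R) : \sum_(a < nSym k) F (enum_val a) = \sum_s F s.
Proof.
rewrite [RHS](reindex (@enum_val _ [set: 'S_k])) /=; first by [].
exists (gring_index G) => [a _|s _]; [exact: gring_valK|exact: gring_indexK].
Qed.

Lemma matrix_element_dot la mu i j i' j' :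
  (matrix_element (rho la) i j *m (matrix_element (rho mu) i' j')^T) 0 0 =
  (k`!%:R / (d la)%:R) * [&& la == mu, (i : nat) == i' & (j : nat) == j']%:R.
Proof.
rewrite mxE; under eq_bigr do rewrite [in X in _ * X]mxE !matrix_elementE.
rewrite (sum_enum_val (fun s => rho la s j i * rho mu s j' i')) schur_orth.
by rewrite [((j : nat) == j') && _]andbC.
Qed.

(** Similar representations have matrix elements with the same span; this links [rho] to [Vsub],
    which is defined through [simple_repr]. *)
Lemma matrix_element_spec la i j : exists c : 'I_(d la) -> 'I_(d la) -> R,
  matrix_element (simple_repr R la) i j =
  \sum_a \sum_b c a b *: matrix_element (rho la) a b.
Proof.
have [B [B' [_ _ se _]]] := rho_conj la.
exists (fun a b => B j b * B' a i); apply/rowP => x; rewrite matrix_elementE se mxE summxE.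
apply: eq_bigr => a _; rewrite summxE mxE mulr_suml; apply: eq_bigr => b _.
by rewrite [RHS]mxE matrix_elementE mulrAC.
Qed.

Lemma matrix_element_rho la i j : exists c : 'I_(d la) -> 'I_(d la) -> R,
  matrix_element (rho la) i j =
  \sum_a \sum_b c a b *: matrix_element (simple_repr R la) a b.
Proof.
have [B [B' [_ _ _ re]]] := rho_conj la.
exists (fun a b => B' j b * B a i); apply/rowP => x; rewrite matrix_elementE re mxE summxE.
apply: eq_bigr => a _; rewrite summxE mxE mulr_suml; apply: eq_bigr => b _.
by rewrite [RHS]mxE matrix_elementE mulrAC.
Qed.

Lemma row_space_orth_disj (W : 'M[R]_(nSym k)) : (W :&: kermx W^T)%MS = 0.
Proof.
apply/eqP/rowV0P => v; rewrite sub_capmx => /andP[/submxP[u uE] /sub_kermxP vW].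
by apply/eqP; rewrite -row_dot_eq0 {2}uE trmx_mul mulmxA vW mul0mx mxE.
Qed.

Lemma proj_V_element r la i j :
  proj_V r (matrix_element (rho la) i j) =
  if head 0%N (parts la) == (k - r)%N then matrix_element (rho la) i j else 0.
Proof.
rewrite /proj_V; case: ifP => h.
  apply: proj_mx_id; first exact: row_space_orth_disj.
  have [c ->] := matrix_element_rho i j.
  apply: summx_sub => a _; apply: summx_sub => b _; apply: scalemx_sub.
  by apply: (sumsmx_sup la) => //; apply: (sumsmx_sup a) => //;
    apply: (sumsmx_sup b) => //; rewrite genmxE.
apply: proj_mx_0; first exact: row_space_orth_disj.
apply/sub_kermxP; rewrite -[X in X *m _]trmxK -trmx_mul.
suff -> : Vsub R k r *m (matrix_element (rho la) i j)^T = 0 by rewrite trmx0.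
apply/sub_kermxP/sumsmx_subP => mu hmu; apply/sumsmx_subP => a _; apply/sumsmx_subP => b _.
rewrite genmxE; apply/sub_kermxP; have [c ->] := matrix_element_spec a b.
rewrite mulmx_suml big1 // => x _; rewrite mulmx_suml big1 // => y _.
rewrite -scalemxAl; apply/matrixP => u v; rewrite !ord1 mxE matrix_element_dot.
have -> : (mu == la) = false by apply/eqP => e; rewrite e h in hmu.
by rewrite !mulr0 mxE.
Qed.

Definition melt := {la : intpart k & ('I_(d la) * 'I_(d la))%type}.

Lemma card_melt : #|{: melt}| = nSym k.
Proof.
rewrite cardsT card_Sn -(sum_dim_simple R k) card_tagged sumnE big_map big_enum /=.
by apply: eq_bigr => la _; rewrite card_prod !card_ord mulnn.
Qed.

Definition melt_idx (x : melt) : 'I_(nSym k) := cast_ord card_melt (enum_rank x).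
Definition melt_of (a : 'I_(nSym k)) : melt := enum_val (cast_ord (esym card_melt) a).

Lemma melt_idxK : cancel melt_idx melt_of.
Proof. by move=> x; rewrite /melt_of cast_ordK enum_rankK. Qed.

Lemma melt_ofK : cancel melt_of melt_idx.
Proof. by move=> a; rewrite /melt_idx enum_valK cast_ordKV. Qed.

Definition melt_row (x : melt) : 'rV[R]_(nSym k) :=
  Num.sqrt ((d (tag x))%:R / k`!%:R) *:
    matrix_element (rho (tag x)) (tagged x).1 (tagged x).2.

Definition melt_mx : 'M[R]_(nSym k) := \matrix_(a, b) melt_row (melt_of b) 0 a.

Lemma melt_row_dot x y : (melt_row x *m (melt_row y)^T) 0 0 = (x == y)%:R.
Proof.
case: x y => la [i j] [mu [i' j']].
rewrite /melt_row /= linearZ /= -scalemxAr -scalemxAl !mxE.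
have := matrix_element_dot i j i' j'; rewrite mxE => ->.
have [e|ne] := eqVneq la mu; last first.
  rewrite mulr0 !mulr0; case: eqP => // /(congr1 (@tag _ _)) /= e.
  by rewrite e eqxx in ne.
subst mu; rewrite eq_Tagged /= xpair_eqE /= mulrA -expr2 sqr_sqrtr; last first.
  by rewrite divr_ge0 ?ler0n.
have d0 : (d la)%:R != 0 :> R by rewrite pnatr_eq0 -lt0n rho_dim_gt0.
have k0 : k`!%:R != 0 :> R by rewrite pnatr_eq0 -lt0n fact_gt0.
by rewrite mulrA -invf_div mulVf ?mul1r // mulf_neq0 ?invr_eq0.
Qed.

Lemma melt_mx_orth : melt_mx^T *m melt_mx = 1%:M.
Proof.
apply/matrixP => a b; rewrite !mxE; transitivity ((melt_row (melt_of a) *m (melt_row (melt_of b))^T) 0 0).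
  by rewrite [RHS]mxE; apply: eq_bigr => x _; rewrite !mxE.
by rewrite melt_row_dot (inj_eq (can_inj melt_ofK)).
Qed.

End Family.

(** * Symmetrizers on private labels and Schur's lemma *)

Section Cross.
Import mathcomp.boot.fintype mathcomp.boot.finset.
Variables (R : realType) (k : nat).
Local Notation G := [set: 'S_k]%G.
Local Notation d la := (dim_simple R la).
Variable rho : forall la : intpart k, mx_representation R G (d la).
Implicit Types (la mu : intpart k) (A : {set 'I_k}).
Hypothesis rho_sim : forall la, mx_rsim (simple_repr R la) (rho la).
Hypothesis rho_orth : forall la s, rho la s *m (rho la s)^T = 1%:M.

Definition high r : {set 'I_k} := [set l : 'I_k | (r <= l)%N].

Lemma card_high r : (r <= k)%N -> #|high r| = (k - r)%N.
Proof.
move=> rk; have := cardsC [set l : 'I_k | (l < r)%N]; rewrite card_low // card_ord.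
have -> : ~: [set l : 'I_k | (l < r)%N] = high r.
  by apply/setP => l; rewrite !inE -leqNgt.
by move=> e; rewrite -[X in (X - _)%N]e addKn.
Qed.

Definition symsum la (A : {set 'I_k}) := \sum_(h : 'S_k | perm_on A h) rho la h.

Lemma symsum_conj la A : exists B B' : 'M[R]_(d la), B' *m B = 1%:M /\
  \sum_(h : 'S_k | perm_on A h) simple_repr R la h = B *m symsum la A *m B'.
Proof.
have [B [B' [_ B'B se _]]] := rho_conj rho_sim la; exists B, B'; split=> //.
by rewrite mulmx_sumr mulmx_suml; apply: eq_bigr => h _; rewrite se.
Qed.

Lemma symsum0 la A : (head 0%N (parts la) < #|A|)%N -> symsum la A = 0.
Proof.
move=> /(spec_sym_sum0 R) e; have [B [B' [B'B se]]] := symsum_conj la A.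
have : B' *m (B *m symsum la A *m B') *m B = 0 by rewrite -se e mulmx0 mul0mx.
by rewrite !mulmxA B'B mul1mx -mulmxA B'B mulmx1.
Qed.

Lemma symsum_neq0 la A : #|A| = head 0%N (parts la) -> symsum la A != 0.
Proof.
move=> /(spec_sym_sum_neq0 R) ne; have [B [B' [_ se]]] := symsum_conj la A.
by apply: contraNneq ne => e; rewrite se e mulmx0 mul0mx.
Qed.

Definition symcard (A : {set 'I_k}) : R := (#|[set h : 'S_k | perm_on A h]|)%:R.

Lemma symcard_neq0 A : symcard A != 0.
Proof.
rewrite pnatr_eq0 -lt0n; apply/card_gt0P; exists 1%g; rewrite inE; exact: perm_on1.
Qed.

(** The orthogonal projection onto the vectors fixed by all permutations of the private labels. *)
Definition inv_proj la r : 'M[R]_(d la) := (symcard (high r))^-1 *: symsum la (high r).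

Lemma perm_onV (A : {set 'I_k}) (h : 'S_k) : perm_on A h -> perm_on A (h^-1)%g.
Proof.
move=> hA; rewrite /perm_on; apply/subsetP => x; rewrite inE => ne.
have := subsetP hA x; rewrite !inE; apply; apply: contraNneq ne => e.
by rewrite -{1}e permK.
Qed.

Lemma rho_inv_proj la r h : perm_on (high r) h -> rho la h *m inv_proj la r = inv_proj la r.
Proof.
move=> hA; rewrite /inv_proj -scalemxAr; congr (_ *: _).
rewrite mulmx_sumr [RHS](reindex_inj (mulgI h)) /=; apply: eq_big => [p|p _].
  apply/idP/idP => pA; first exact: perm_onM.
  by rewrite -(mulKg h p); apply: perm_onM => //; exact: perm_onV.
by rewrite repr_mxM ?inE.
Qed.

Lemma inv_proj_tr la r : (inv_proj la r)^T = inv_proj la r.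
Proof.
rewrite /inv_proj linearZ /=; congr (_ *: _); rewrite linear_sum /=.
rewrite [RHS](reindex_inj invg_inj) /=; apply: eq_big => [p|p _].
  by apply/idP/idP => /perm_onV; rewrite ?invgK.
by rewrite rho_tr.
Qed.

Lemma inv_proj_rho la r h : perm_on (high r) h -> inv_proj la r *m rho la h = inv_proj la r.
Proof.
move=> hA; apply: trmx_inj; rewrite trmx_mul rho_tr // inv_proj_tr.
exact: rho_inv_proj (perm_onV hA).
Qed.

Lemma inv_proj_idem la r : inv_proj la r *m inv_proj la r = inv_proj la r.
Proof.
rewrite {1}/inv_proj -scalemxAl mulmx_suml (eq_bigr (fun=> inv_proj la r)); last first.
  by move=> h; exact: rho_inv_proj.
rewrite sumr_const -scaler_nat scalerA /symcard cardsE mulVf ?scale1r //.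
by have := symcard_neq0 (high r); rewrite /symcard cardsE.
Qed.

(** The trace of a symmetric idempotent is the sum of its squared entries, and there are exactly
    lambda_1 private labels, so the symmetrizer is nonzero. *)
Lemma inv_proj_trace la r : (r <= k)%N -> head 0%N (parts la) = (k - r)%N ->
  0 < \tr (inv_proj la r).
Proof.
move=> rk hl; have E0 : inv_proj la r != 0.
  by rewrite scaler_eq0 invr_eq0 (negPf (symcard_neq0 _)) symsum_neq0 ?card_high.
have E2 : \tr (inv_proj la r) = \sum_i \sum_j inv_proj la r i j ^+ 2.
  transitivity (\tr (inv_proj la r *m (inv_proj la r)^T)).
    by rewrite inv_proj_tr inv_proj_idem.
  apply: eq_bigr => i _; rewrite mxE.
  by apply: eq_bigr => j _; rewrite [X in _ * X]mxE expr2.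
have ge : 0 <= \tr (inv_proj la r).
  by rewrite E2; apply: sumr_ge0 => i _; apply: sumr_ge0 => j _; exact: sqr_ge0.
rewrite lt_def ge andbT; apply: contra E0; rewrite E2 psumr_eq0 => [/allP h|i _]; last first.
  by apply: sumr_ge0 => j _; exact: sqr_ge0.
apply/eqP/matrixP => i j; have := h i (mem_index_enum _) => /=.
rewrite psumr_eq0 => [/allP h'|? _]; last exact: sqr_ge0.
by have := h' j (mem_index_enum _); rewrite /= sqrf_eq0 => /eqP ->; rewrite mxE.
Qed.

(** Coset decomposition according to the image of j. *)
Lemma symsum_split la r (j : 'I_k) : (j < r)%N ->
  symsum la (j |: high r) =
  \sum_(i in j |: high r) symsum la (high r) *m rho la (tperm j i).
Proof.
move=> jr; have jh : j \notin high r by rewrite inE -ltnNge.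
rewrite {1}/symsum (partition_big (fun h : 'S_k => h j) (mem (j |: high r))) /=; last first.
  by move=> h hA; rewrite perm_closed // setU11.
apply: eq_bigr => i iA; rewrite mulmx_suml (reindex_inj (mulIg (tperm j i))) /=.
have sub (h : 'S_k) : perm_on (high r) h -> perm_on (j |: high r) h.
  by move=> hA; apply: subset_trans hA (subsetUr _ _).
have tA : perm_on (j |: high r) (tperm j i).
  rewrite /perm_on; apply/subsetP => x; rewrite inE.
  by case: tpermP => [->|->|]; rewrite ?setU11 ?eqxx.
apply: eq_big => [h|h _]; last by rewrite repr_mxM ?inE.
apply/andP/idP => [[hA /eqP]|hA]; last first.
  by split; [apply: perm_onM => //; exact: sub|rewrite permM (out_perm hA) // tpermL].
rewrite permM => e; have hj : h j = j by apply: (@perm_inj _ (tperm j i)); rewrite e tpermL.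
have hA' : perm_on (j |: high r) h.
  by rewrite -(mulgK (tperm j i) h) tpermV; exact: perm_onM.
rewrite /perm_on; apply/subsetP => x xh; have := subsetP hA' x xh; rewrite in_setU1.
by case/orP => // /eqP xj; move: xh; rewrite inE xj hj eqxx.
Qed.

Section Commute.
Variables (la mu : intpart k) (r : nat) (M : 'M[R]_(d la, d mu)).
Hypotheses (rk : (r <= k)%N) (hla : head 0%N (parts la) = (k - r)%N)
  (hmu : head 0%N (parts mu) = (k - r)%N).
Hypothesis Minv : forall p q : 'S_k,
  (forall i : 'I_k, (i < r)%N -> p i = q i /\ (p i < r)%N) -> rho la p *m M *m (rho mu q)^T = M.
Local Notation E := (inv_proj la r).
Local Notation E' := (inv_proj mu r).

Lemma high_fix (h : 'S_k) (i : 'I_k) : perm_on (high r) h -> (i < r)%N -> h i = i.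
Proof. by move=> hA ir; apply: out_perm hA _; rewrite inE -ltnNge. Qed.

Lemma inv_projM : E *m M = M.
Proof.
rewrite /inv_proj -scalemxAl mulmx_suml (eq_bigr (fun=> M)) => [|h hA].
  rewrite sumr_const -scaler_nat scalerA /symcard cardsE mulVf ?scale1r //.
  by have := symcard_neq0 (high r); rewrite /symcard cardsE.
have := @Minv h 1%g; rewrite repr_mx1 trmx1 mulmx1; apply => i ir.
by rewrite perm1 (high_fix hA).
Qed.

Lemma M_inv_proj : M *m E' = M.
Proof.
rewrite /inv_proj -scalemxAr mulmx_sumr (eq_bigr (fun=> M)) => [|h hA].
  rewrite sumr_const -scaler_nat scalerA /symcard cardsE mulVf ?scale1r //.
  by have := symcard_neq0 (high r); rewrite /symcard cardsE.
have := @Minv 1%g (h^-1)%g; rewrite repr_mx1 mul1mx rho_tr // invgK; apply => i ir.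
by rewrite perm1 (high_fix (perm_onV hA)).
Qed.

Definition outside (g : 'S_k) : nat := #|[set j : 'I_k | (j < r)%N && (r <= g j)%N]|.

(** The failure of [M] to intertwine the element E g E of the corner algebra. *)
Definition defect (g : 'S_k) : 'M[R]_(d la, d mu) :=
  E *m rho la g *m E *m M - M *m E' *m rho mu g *m E'.

(** Both halves acquire a symmetrizer on k - r + 1 points, one more than the first row, so both
    vanish. *)
Lemma sum_defect g (j : 'I_k) : (j < r)%N ->
  \sum_(i in j |: high r) defect (tperm j i * g)%g = 0.
Proof.
move=> jr; have cA : #|j |: high r| = (k - r).+1.
  by rewrite cardsU1 card_high // inE -ltnNge jr.
have z nu : head 0%N (parts nu) = (k - r)%N ->
    \sum_(i in j |: high r) inv_proj nu r *m rho nu (tperm j i) = 0.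
  move=> hn; transitivity ((symcard (high r))^-1 *: symsum nu (j |: high r)).
    rewrite (symsum_split nu jr) scaler_sumr; apply: eq_bigr => i _.
    by rewrite scalemxAl.
  by rewrite symsum0 ?scaler0 // cA hn.
rewrite sumrB.
have -> : \sum_(i in j |: high r) E *m rho la (tperm j i * g)%g *m E *m M =
    (\sum_(i in j |: high r) E *m rho la (tperm j i)) *m (rho la g *m E *m M).
  by rewrite mulmx_suml; apply: eq_bigr => i _; rewrite repr_mxM ?inE // !mulmxA.
have -> : \sum_(i in j |: high r) M *m E' *m rho mu (tperm j i * g)%g *m E' =
    M *m (\sum_(i in j |: high r) E' *m rho mu (tperm j i)) *m (rho mu g *m E').
  rewrite mulmx_sumr mulmx_suml; apply: eq_bigr => i _.
  by rewrite repr_mxM ?inE // !mulmxA.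
by rewrite !z // mul0mx mulmx0 mul0mx subrr.
Qed.

(* Double cosets of the stabilizer of the low labels: multiplying by a transposition
   that brings an escaped label back lowers [outside]. *)
Lemma defect0 g : defect g = 0.
Proof.
have [n] := ubnP (outside g); elim: n => // n IH in g *; rewrite ltnS => le.
have [/eqP o0|] := eqVneq (outside g) 0%N.
  have lo (i : 'I_k) : (i < r)%N -> g i = g i /\ (g i < r)%N.
    move=> ir; split=> //; rewrite ltnNge; apply/negP => ge.
    by move: o0; rewrite /outside cards_eq0 => /eqP/setP/(_ i); rewrite !inE ir ge.
  have e : rho la g *m M = M *m rho mu g.
    have := Minv lo; move=> /(congr1 (mulmx^~ (rho mu g))).
    have o : (rho mu g)^T *m rho mu g = 1%:M by apply: mulmx1C; exact: rho_orth.
    by rewrite -mulmxA o mulmx1 => ->.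
  rewrite /defect -(mulmxA _ E M) inv_projM -(mulmxA E) e mulmxA inv_projM M_inv_proj.
  by rewrite -e -(mulmxA _ M E') M_inv_proj subrr.
rewrite -lt0n => /card_gt0P[j]; rewrite inE => /andP[jr gj].
have := sum_defect g jr.
rewrite (bigID (fun i => (r <= g i)%N)) /= [X in _ + X]big1 ?addr0; last first.
  move=> i /andP[iA gi]; apply: IH; apply: leq_trans le.
  have ij : i != j by apply: contraNneq gi => ->.
  have ih : (r <= i)%N by move: iA; rewrite in_setU1 (negPf ij) inE.
  apply: proper_card; apply/properP; split; last first.
    exists j; rewrite !inE ?jr ?gj //= permM tpermL -ltnNge ltnNge; first by [].
  apply/subsetP => x; rewrite !inE permM => /andP[xr]; rewrite xr /=.
  case: tpermP => [->|xi|//]; first by rewrite (negPf gi).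
  by move: xr; rewrite xi ltnNge ih.
rewrite (eq_bigr (fun=> defect g)) => [|i /andP[iA gi]].
  rewrite sumr_const -scaler_nat => /eqP; rewrite scaler_eq0 pnatr_eq0 => /orP[|/eqP //].
  rewrite -leqn0 leqNgt => /negP[]; apply/card_gt0P; exists j.
  by apply/andP; split; [exact: setU11|exact: gj].
have tP : perm_on (high r) (tperm (g j) (g i)).
  rewrite /perm_on; apply/subsetP => x; rewrite inE.
  by case: tpermP => [->|->|]; rewrite ?inE ?eqxx.
have -> : (tperm j i * g = g * tperm (g j) (g i))%g by rewrite -tpermJ conjgE !mulgA mulgV mul1g.
rewrite /defect !repr_mxM ?inE // -!mulmxA.
rewrite [rho la (tperm _ _) *m (E *m M)]mulmxA (rho_inv_proj _ tP).
by rewrite (rho_inv_proj _ tP).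
Qed.

Lemma inv_proj_average : exists2 c : R, 0 < c &
  \sum_(s : 'S_k) (rho mu s)^T *m E' *m rho mu s = c%:M.
Proof.
have [c cE] := rho_hom_scalar rho_sim (rho_average_hom rho_orth E').
exists c => //; have t : \tr (c%:M : 'M[R]_(d mu)) = k`!%:R * \tr E'.
  rewrite -cE raddf_sum (eq_bigr (fun=> \tr E')) => [|s _].
    by rewrite sumr_const card_Sn mulr_natl.
  by rewrite /= mxtrace_mulC mulmxA rho_orth mul1mx.
have d0 : 0 < (d mu)%:R :> R by rewrite ltr0n (rho_dim_gt0 rho_sim).
rewrite -(pmulr_lgt0 _ d0) mulr_natr -mxtrace_scalar t mulr_gt0 ?inv_proj_trace //.
by rewrite ltr0n fact_gt0.
Qed.

(** With zero defect at s^-1, [M] moves to the left of every summand and leaves an average of [E'],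
    a positive scalar. So [M] is recovered from an intertwiner of the full representations. *)
Lemma cross_average : exists c : R, c != 0 /\
  E *m (\sum_(s : 'S_k) (rho la s)^T *m M *m rho mu s) *m E' = c *: M.
Proof.
have [c c0 cE] := inv_proj_average; exists c; split; first exact: lt0r_neq0.
rewrite mulmx_sumr mulmx_suml.
transitivity (\sum_(s : 'S_k) M *m E' *m ((rho mu s)^T *m E' *m rho mu s) *m E').
  apply: eq_bigr => s _; have /eqP := defect0 (s^-1)%g; rewrite subr_eq0 => /eqP e.
  by rewrite !mulmxA !rho_tr // -e -(mulmxA _ E M) inv_projM.
rewrite -mulmx_suml -mulmx_sumr cE mul_mx_scalar M_inv_proj -scalemxAl.
by rewrite M_inv_proj.
Qed.

Lemma cross_neq : la != mu -> M = 0.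
Proof.
move=> ne; have [c [c0]] := cross_average.
rewrite (rho_hom_neq rho_sim rho_orth ne (rho_average_hom rho_orth M)) mulmx0 mul0mx.
by move/esym/eqP; rewrite scaler_eq0 (negPf c0) => /eqP.
Qed.

End Commute.

Lemma cross_eq la r (M : 'M[R]_(d la)) : (r <= k)%N -> head 0%N (parts la) = (k - r)%N ->
  (forall p q : 'S_k, (forall i : 'I_k, (i < r)%N -> p i = q i /\ (p i < r)%N) ->
     rho la p *m M *m (rho la q)^T = M) ->
  M = (\tr M / \tr (inv_proj la r)) *: inv_proj la r.
Proof.
move=> rk hl Minv; have [c [c0]] := cross_average rk hl hl Minv.
have [a ->] := rho_hom_scalar rho_sim (rho_average_hom rho_orth M).
rewrite mul_mx_scalar -scalemxAl inv_proj_idem => e.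
have M_E : M = (c^-1 * a) *: inv_proj la r.
  by rewrite -scalerA e scalerA mulVf // scale1r.
have t0 := lt0r_neq0 (inv_proj_trace rk hl).
by rewrite [in RHS]M_E mxtraceZ mulfK // -M_E.
Qed.

End Cross.

Lemma swap_ext k m : (m <= k)%N ->
  exists s : 'S_(k + (k - m)), forall i, s (labA m i) = labB m i /\ s (labB m i) = labA m i.
Proof.
move=> mk.
have lt (l : 'I_(k + (k - m))) : ((if (l < m)%N then l : nat else
    if (l < k)%N then l + (k - m) else l - (k - m)) < k + (k - m))%N.
  by have := ltn_ord l; case: (ltnP l m); case: (ltnP l k); lia.
pose f (l : 'I_(k + (k - m))) := Ordinal (lt l).
have fi : injective f.
  apply: (can_inj (g := f)) => l; apply: val_inj => /=.
  have := ltn_ord l; case: (ltnP l m) => lm; first by rewrite lm.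
  case: (ltnP l k) => lk ln.
    have -> : (l + (k - m) < m)%N = false by lia.
    by have -> : (l + (k - m) < k)%N = false; lia.
  have -> : (l - (k - m) < m)%N = false by lia.
  by have -> : (l - (k - m) < k)%N; lia.
exists (perm fi) => i; split; apply: val_inj; rewrite permE /=.
  by case: (ltnP i m) => // im; rewrite ltn_ord.
have := ltn_ord i; case: (ltnP i m) => im ik; first by rewrite im.
have -> : (i + (k - m) < m)%N = false by lia.
by have -> : (i + (k - m) < k)%N = false; lia.
Qed.

(** * Cross averages over relative orders *)

Section CrossMoments.
Import mathcomp.boot.fintype mathcomp.boot.finset.
Variables (R : realType) (k : nat).
Local Notation G := [set: 'S_k]%G.
Local Notation d la := (dim_simple R la).
Variable rho : forall la : intpart k, mx_representation R G (d la).
Implicit Types (la mu : intpart k) (A B : {set 'I_k}).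

Definition stdA m (eta : 'S_(k + (k - m))) : 'S_k := std (fun x => eta (labA m x) : nat).
Definition stdB m (eta : 'S_(k + (k - m))) : 'S_k := std (fun x => eta (labB m x) : nat).

(** Entry (a, b) is the mean of rho(std A)_(a i) rho'(std B)_(b i') over the relative orders of the
    union. *)
Definition cross m la mu (i : 'I_(d la)) (i' : 'I_(d mu)) : 'M[R]_(d la, d mu) :=
  (k + (k - m))`!%:R^-1 *: \sum_(eta : 'S_(k + (k - m)))
    col i (rho la (stdA eta)) *m (col i' (rho mu (stdB eta)))^T.

Arguments cross : clear implicits.

Definition level la := (k - head 0 (parts la))%N.

(** This is nu of the overview; its entries are the traces of the cross averages at the critical
    level. *)
Definition ntr la : 'M[R]_(d la) :=
  (k + (k - level la))`!%:R^-1 *: \sum_(eta : 'S_(k + (k - level la)))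
    (rho la (stdA eta))^T *m rho la (stdB eta).

Lemma eta_labA_inj m (eta : 'S_(k + (k - m))) : injective (fun x => eta (labA m x) : nat).
Proof. by move=> x y /val_inj/perm_inj; exact: labA_inj. Qed.

Lemma eta_labB_inj m (eta : 'S_(k + (k - m))) : injective (fun x => eta (labB m x) : nat).
Proof. by move=> x y /val_inj/perm_inj; exact: labB_inj. Qed.

Lemma col_mulmx n (M1 M2 : 'M[R]_n) i : col i (M1 *m M2) = M1 *m col i M2.
Proof. by rewrite !colE mulmxA. Qed.

(** A relabelling of the union that acts as [p] on A and as [q] on B only permutes the summands. *)
Lemma cross_inv m la mu i i' (p q : 'S_k) :
  (forall x : 'I_k, (x < m)%N -> p x = q x /\ (p x < m)%N) ->
  rho la p *m cross m la mu i i' *m (rho mu q)^T = cross m la mu i i'.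
Proof.
move=> /relabel_ext[s sE]; rewrite /cross -scalemxAr -scalemxAl; congr (_ *: _).
rewrite mulmx_sumr mulmx_suml [RHS](reindex_inj (mulgI s)) /=; apply: eq_bigr => eta _.
have -> : stdA (s * eta)%g = (p * stdA eta)%g.
  rewrite -std_perm; last exact: eta_labA_inj.
  by apply: eq_std => x /=; rewrite permM (sE x).1.
have -> : stdB (s * eta)%g = (q * stdB eta)%g.
  rewrite -std_perm; last exact: eta_labB_inj.
  by apply: eq_std => x /=; rewrite permM (sE x).2.
by rewrite !repr_mxM ?inE // !col_mulmx trmx_mul !mulmxA.
Qed.

Lemma ntrE la i i' : ntr la i i' = \tr (cross (level la) la la i i').
Proof.
rewrite /ntr /cross mxtraceZ mxE; congr (_ * _); rewrite raddf_sum summxE.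
apply: eq_bigr => eta _; rewrite /= mxtrace_mulC mxE.
by rewrite /mxtrace big_ord1 mxE; apply: eq_bigr => a _; rewrite !mxE mulrC.
Qed.

(** Swapping the two label sets exchanges the two standardizations. *)
Lemma ntr_sym la : (ntr la)^T = ntr la.
Proof.
have [s sE] := swap_ext (leq_subr (head 0%N (parts la)) k).
rewrite /ntr linearZ /=; congr (_ *: _); rewrite linear_sum /=.
rewrite [RHS](reindex_inj (mulgI s)) /=; apply: eq_bigr => eta _.
have -> : stdA (s * eta)%g = stdB eta.
  by apply: eq_std => x /=; rewrite permM (sE x).1.
have -> : stdB (s * eta)%g = stdA eta.
  by apply: eq_std => x /=; rewrite permM (sE x).2.
by rewrite trmx_mul trmxK.
Qed.

Hypothesis rho_sim : forall la, mx_rsim (simple_repr R la) (rho la).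
Hypothesis rho_orth : forall la s, rho la s *m (rho la s)^T = 1%:M.

Lemma head_parts_le la : (head 0%N (parts la) <= k)%N.
Proof.
rewrite -[X in (_ <= X)%N](sumn_parts la).
by case: (parts la) => //= x s; exact: leq_addr.
Qed.

Lemma head_level la : head 0%N (parts la) = (k - level la)%N.
Proof. by rewrite /level subKn ?head_parts_le. Qed.

Lemma level_le la : (level la <= k)%N. Proof. exact: leq_subr. Qed.

(** With so few shared labels more than lambda_1 are private; their symmetrizer is zero, yet it
    multiplies the average by a nonzero number. *)
Lemma cross0_l m la mu i i' : (m < level la)%N -> cross m la mu i i' = 0.
Proof.
move=> ml; have mk : (m <= k)%N by exact: leq_trans (ltnW ml) (level_le la).
have : symsum rho la (high k m) *m cross m la mu i i' = symcard R (high k m) *: cross m la mu i i'.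
  rewrite mulmx_suml (eq_bigr (fun=> cross m la mu i i')) => [|h hA].
    by rewrite sumr_const -scaler_nat /symcard cardsE.
  have := @cross_inv m la mu i i' h 1%g; rewrite repr_mx1 trmx1 mulmx1; apply => x xm.
  by rewrite perm1 (high_fix hA).
rewrite symsum0 // => [|]; last first.
  by rewrite card_high // head_level; move: ml (level_le la); lia.
rewrite mul0mx => /esym/eqP; rewrite scaler_eq0 (negPf (symcard_neq0 _ _)) /=.
by move/eqP.
Qed.

Lemma cross0_r m la mu i i' : (m < level mu)%N -> cross m la mu i i' = 0.
Proof.
move=> ml; have mk : (m <= k)%N by exact: leq_trans (ltnW ml) (level_le mu).
have : cross m la mu i i' *m symsum rho mu (high k m) = symcard R (high k m) *: cross m la mu i i'.
  rewrite mulmx_sumr (eq_bigr (fun=> cross m la mu i i')) => [|h hA].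
    by rewrite sumr_const -scaler_nat /symcard cardsE.
  have := @cross_inv m la mu i i' 1%g (h^-1)%g.
  rewrite repr_mx1 mul1mx rho_tr // invgK; apply => x xm.
  by rewrite perm1 (high_fix (perm_onV hA)).
rewrite symsum0 // => [|]; last first.
  by rewrite card_high // head_level; move: ml (level_le mu); lia.
rewrite mulmx0 => /esym/eqP; rewrite scaler_eq0 (negPf (symcard_neq0 _ _)) /=.
by move/eqP.
Qed.

Lemma cross_level_neq m la mu i i' : level la = m -> level mu = m -> la != mu ->
  cross m la mu i i' = 0.
Proof.
move=> hl hm; apply: (cross_neq rho_sim rho_orth (r := m)).
- by rewrite -hl level_le.
- by rewrite -hl -head_level.
- by rewrite -hm -head_level.
- by move=> p q; exact: cross_inv.
Qed.

Local Notation E la := (inv_proj rho la (level la)).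

Lemma cross_level_eq la i i' :
  cross (level la) la la i i' = (ntr la i i' / \tr (E la)) *: E la.
Proof.
rewrite ntrE; apply: (cross_eq rho_sim rho_orth).
- exact: level_le.
- by rewrite -head_level.
- by move=> p q; exact: cross_inv.
Qed.

Lemma E_trace_gt0 la : 0 < \tr (E la).
Proof. by apply: inv_proj_trace => //; rewrite ?level_le -?head_level. Qed.

Lemma ntr_gt0 la (u : 'cV[R]_(d la)) : u != 0 -> 0 < (u^T *m ntr la *m u) 0 0.
Proof.
move=> u0; set r := level la; set val := (_ 0 0).
pose h a (b : 'S_k) : R := (E la *m rho la b *m u) a 0.
(* Otherwise E would kill rho(s) u for every s, and the conjugation average of E, a nonzero scalar,
   would kill u. *)
have [a [b hb]] : exists a b, h a b != 0.
  apply: contrapT => no; case/eqP: u0.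
  have [c c0 cE] := inv_proj_average rho_sim rho_orth (level_le la) (head_level la).
  have : (\sum_(s : 'S_k) (rho la s)^T *m E la *m rho la s) *m u = 0.
    rewrite mulmx_suml big1 // => s _; rewrite -!mulmxA.
    have -> : E la *m (rho la s *m u) = 0; last by rewrite mulmx0.
    apply/matrixP => a j; rewrite ord1 [RHS]mxE mulmxA.
    by apply/eqP; apply: contraT => ne; case: no; exists a, s.
  rewrite cE mul_scalar_mx => /eqP; rewrite scaler_eq0 => /orP[|/eqP //].
  by rewrite (gt_eqF c0).
have pos := @interleave_gt0 R k r (level_le la) (h a).
have {}pos : 0 < \sum_(eta : 'S_(k + (k - r))) h a (stdA eta) * h a (stdB eta).
  apply: pos; last by exists b.
  move=> p q pf; rewrite /h repr_mxM ?inE // mulmxA inv_proj_rho //.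
  rewrite /perm_on; apply/subsetP => x; rewrite !inE leqNgt; apply: contra => xr.
  by rewrite pf.
have f0 : 0 < (k + (k - r))`!%:R^-1 :> R by rewrite invr_gt0 ltr0n fact_gt0.
(* The average [Y] expands into cross averages, all multiples of E, so the quadratic form can be
   read off a diagonal entry of E Y E, which is an interleaving sum. *)
pose Y := (k + (k - r))`!%:R^-1 *: \sum_(eta : 'S_(k + (k - r)))
  (rho la (stdA eta) *m u) *m (rho la (stdB eta) *m u)^T.
have YE : Y = (val / \tr (E la)) *: E la.
  have -> : val = \sum_i \sum_i' u i 0 * u i' 0 * ntr la i i'.
    rewrite /val mxE exchange_big /=; apply: eq_bigr => i _.
    rewrite mxE mulr_suml; apply: eq_bigr => j _; rewrite [u^T _ _]mxE; ring.
  transitivity (\sum_i \sum_i' (u i 0 * u i' 0) *: cross r la la i i'); last first.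
    rewrite mulr_suml scaler_suml; apply: eq_bigr => i _.
    rewrite mulr_suml scaler_suml; apply: eq_bigr => j _.
    by rewrite cross_level_eq scalerA mulrA.
  rewrite /Y /cross; under [RHS]eq_bigr => i _.
    under eq_bigr => j _ do rewrite scalerA mulrC -scalerA.
    rewrite -scaler_sumr; over.
  rewrite -scaler_sumr; congr (_ *: _); apply/matrixP => x y.
  rewrite summxE [RHS]summxE; under [RHS]eq_bigr => i _.
    rewrite summxE; under eq_bigr => j _ do rewrite mxE summxE mulr_sumr.
    rewrite exchange_big /=; over.
  rewrite [RHS]exchange_big /=; apply: eq_bigr => eta _.
  rewrite mxE big_ord1 [X in _ * X]mxE ![(_ *m u) _ _]mxE big_distrlr /=.
  apply: eq_bigr => i _; apply: eq_bigr => j _.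
  by rewrite [X in _ = _ * X]mxE big_ord1 !mxE; ring.
have key : val / \tr (E la) * E la a a =
    (k + (k - r))`!%:R^-1 * \sum_(eta : 'S_(k + (k - r))) h a (stdA eta) * h a (stdB eta).
  transitivity ((E la *m Y *m E la) a a).
    by rewrite YE -(scalemxAr (val / _)) -(scalemxAl (val / _)) !inv_proj_idem // [RHS]mxE.
  set c := _^-1; rewrite /Y -/c -(scalemxAr c) -(scalemxAl c) [LHS]mxE; congr (_ * _).
  rewrite mulmx_sumr mulmx_suml summxE; apply: eq_bigr => eta _.
  transitivity (((E la *m rho la (stdA eta) *m u) *m (E la *m rho la (stdB eta) *m u)^T) a a).
    by rewrite !trmx_mul (inv_proj_tr rho_orth) !mulmxA.
  by rewrite mxE big_ord1 [X in _ * X]mxE.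
have : 0 < val / \tr (E la) * E la a a by rewrite key mulr_gt0.
have Ea : 0 <= E la a a.
  rewrite -(inv_proj_idem rho la) -{2}(inv_proj_tr rho_orth) [X in _ <= X]mxE.
  by apply: sumr_ge0 => x _; rewrite [X in _ * X]mxE -expr2 sqr_ge0.
have t0 := E_trace_gt0 la; move=> p0.
have : 0 < val / \tr (E la).
  rewrite ltNge; apply: contraTN p0 => le; rewrite -leNgt.
  by apply: mulr_le0_ge0.
by rewrite pmulr_lgt0 ?invr_gt0.
Qed.

End CrossMoments.

Arguments cross {R k} rho m la mu i i'.

(** * Second moments of pattern sums *)

Section PatternSums.
Import mathcomp.boot.fintype mathcomp.boot.finset.
Variables (R : realType) (k n : nat).
Implicit Types (F : 'S_k -> R) (pi xi eta : 'S_n) (A B : {set 'I_n}).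

Definition patsum F pi : R := \sum_(s : 'S_k) F s * (occurrences s pi)%:R.

Definition pattern_value F pi A : R := \sum_(s : 'S_k | induces pi A s) F s.

Lemma patsumE F pi : patsum F pi = \sum_(A : {set 'I_n} | #|A| == k) pattern_value F pi A.
Proof.
rewrite /patsum /pattern_value.
rewrite [RHS](exchange_big_dep predT) //=; apply: eq_bigr => s _.
rewrite mulr_natr /occurrences -sumr_const; apply: eq_bigl => A.
by rewrite inE.
Qed.

Lemma pattern_value_lab F pi xi (lab : 'I_k -> 'I_n) : injective lab ->
  pattern_value F pi [set xi (lab i) | i : 'I_k] =
  F ((std (fun i => xi (lab i) : nat))^-1 * std (fun i => (xi * pi)%g (lab i) : nat))%g.
Proof.
move=> li; have xli : injective (fun i => xi (lab i)) by move=> i j /perm_inj/li.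
rewrite /pattern_value (eq_bigl _ _ (fun s => inducesE pi s xli)) big_pred1_eq.
by congr (F (_ * _)%g); apply: eq_std => i; rewrite permM.
Qed.

Hypothesis kn : (k + k <= n)%N.

Lemma label_bound m : (k + (k - m) <= n)%N.
Proof. by apply: leq_trans kn; rewrite leq_add2l leq_subr. Qed.

Definition wstdA m eta : 'S_k := std (fun i => eta (widen_ord (label_bound m) (labA m i)) : nat).
Definition wstdB m eta : 'S_k := std (fun i => eta (widen_ord (label_bound m) (labB m i)) : nat).

(** Pairs of k-sets become labellings [xi], and pi becomes eta = xi * pi, the ordinates of the
    labelled points; then [xi] and [eta] range independently over ['S_n]. *)
Lemma second_pattern_moment F F' :
  \sum_(pi : 'S_n) patsum F pi * patsum F' pi =
  \sum_(m < k.+1) (fiber_size k m n)%:R^-1 * \sum_(xi : 'S_n) \sum_(eta : 'S_n)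
    F ((wstdA m xi)^-1 * wstdA m eta)%g * F' ((wstdB m xi)^-1 * wstdB m eta)%g.
Proof.
have wi m : injective (widen_ord (label_bound m)) by move=> i j /(congr1 val) /= /val_inj.
have one pi : patsum F pi * patsum F' pi = \sum_(m < k.+1) (fiber_size k m n)%:R^-1 *
    \sum_(xi : 'S_n) pattern_value F pi (posA (label_bound m) xi) *
                     pattern_value F' pi (posB (label_bound m) xi).
  rewrite !patsumE big_distrlr /= pair_big /=.
  rewrite (partition_big (fun AB : {set 'I_n} * {set 'I_n} =>
    inord #|AB.1 :&: AB.2| : 'I_k.+1) predT) //=; apply: eq_bigr => m _.
  have mk : (m <= k)%N by rewrite -ltnS.
  rewrite (sum_pairs mk (label_bound m)
    (fun A B => pattern_value F pi A * pattern_value F' pi B)).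
  rewrite -[X in _ * X]mulr_natl mulKf; last first.
    by rewrite pnatr_eq0 -lt0n !muln_gt0 !fact_gt0.
  apply: eq_bigl => -[A B] /=; rewrite -andbA; case: eqP => //= cA; case: eqP => //= cB.
  rewrite -val_eqE /= inordK // ltnS -cA; exact: subset_leq_card (subsetIl _ _).
under eq_bigr do rewrite one.
rewrite exchange_big /=; apply: eq_bigr => m _; rewrite -mulr_sumr; congr (_ * _).
rewrite exchange_big /=; apply: eq_bigr => xi _; rewrite [RHS](reindex_inj (mulgI xi)) /=.
apply: eq_bigr => pi _; rewrite /posA /posB.
rewrite (@pattern_value_lab F pi xi (widen_ord (label_bound m) \o labA m)); last first.
  by apply: inj_comp; [exact: wi|exact: labA_inj].
rewrite (@pattern_value_lab F' pi xi (widen_ord (label_bound m) \o labB m)) //.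
by apply: inj_comp; [exact: wi|exact: labB_inj].
Qed.

Local Notation G := [set: 'S_k]%G.
Local Notation d la := (dim_simple R la).
Variable rho : forall la : intpart k, mx_representation R G (d la).
Implicit Types la mu : intpart k.
Hypothesis rho_orth : forall la s, rho la s *m (rho la s)^T = 1%:M.

(** Only the relative order of the labelled points enters, and it is uniform. *)
Lemma sum_wstd_cross m la mu i i' a b :
  \sum_(eta : 'S_n) rho la (wstdA m eta) a i * rho mu (wstdB m eta) b i' =
  n`!%:R * cross rho m la mu i i' a b.
Proof.
have n0 : n`!%:R != 0 :> R by rewrite pnatr_eq0 -lt0n fact_gt0.
apply: (mulIf (invr_neq0 n0)); rewrite [RHS]mulrAC mulfV // mul1r.
have := @sum_std_restrict R _ _ (label_bound m) (fun tau =>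
  rho la (std (fun x => tau (labA m x) : nat)) a i *
  rho mu (std (fun x => tau (labB m x) : nat)) b i').
have ei (eta : 'S_n) : injective (fun x => eta (widen_ord (label_bound m) x) : nat).
  by move=> x y /val_inj/perm_inj/(congr1 val) /= /val_inj.
under [in LHS]eq_bigr => eta _ do
  rewrite (std_comp (ei eta) (@labA_inj k m)) (std_comp (ei eta) (@labB_inj k m)).
move=> ->; rewrite /cross [RHS]mxE mulrC summxE; congr (_ * _); apply: eq_bigr => eta _.
by rewrite [RHS]mxE big_ord1 !mxE.
Qed.

(** By orthogonality a matrix element at std(xi)^-1 std(eta) is a sum of products of an [xi] part
    and an [eta] part, giving one cross average for each of the two matrix indices. *)
Lemma second_moment_rho la mu i j i' j' :
  \sum_(pi : 'S_n) patsum (fun s => rho la s j i) pi * patsum (fun s => rho mu s j' i') pi =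
  \sum_(m < k.+1) (fiber_size k m n)%:R^-1 * (n`!%:R ^+ 2 *
    \sum_a \sum_b cross rho m la mu i i' a b * cross rho m la mu j j' a b).
Proof.
rewrite second_pattern_moment; apply: eq_bigr => m _; congr (_ * _).
transitivity (\sum_(xi : 'S_n) \sum_(eta : 'S_n) \sum_a \sum_b
    (rho la (wstdA m eta) a i * rho mu (wstdB m eta) b i') *
    (rho la (wstdA m xi) a j * rho mu (wstdB m xi) b j')).
  have trx p (M : 'M[R]_p) x y : M^T x y = M y x by rewrite mxE.
  apply: eq_bigr => xi _; apply: eq_bigr => eta _.
  rewrite !repr_mxM ?inE // -!rho_tr // mxE [X in _ * X]mxE big_distrlr /=.
  apply: eq_bigr => a _; apply: eq_bigr => b _; rewrite !trx.
  by ring.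
rewrite exchange_big /= mulr_sumr.
under eq_bigr => eta _ do rewrite exchange_big /=.
rewrite exchange_big /=; apply: eq_bigr => a _; rewrite mulr_sumr.
under eq_bigr => eta _ do rewrite exchange_big /=.
rewrite exchange_big /=; apply: eq_bigr => b _.
under eq_bigr => eta _ do rewrite -mulr_sumr sum_wstd_cross.
by rewrite -mulr_suml sum_wstd_cross; ring.
Qed.

End PatternSums.

(** * Choosing realizations that diagonalize nu *)

Section Rotation.
Variables (R : realType) (k : nat).
Local Notation G := [set: 'S_k]%G.
Local Notation d la := (dim_simple R la).
Implicit Types la : intpart k.

Lemma ntr_conj (rho rho' : forall la : intpart k, mx_representation R G (d la)) la
    (O : 'M[R]_(d la)) : O^T *m O = 1%:M ->
  (forall s, rho' la s = O *m rho la s *m O^T) -> ntr rho' la = O *m ntr rho la *m O^T.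
Proof.
move=> OO e; set c := (k + (k - level la))`!%:R^-1 : R.
rewrite /ntr -/c -(scalemxAr c) -(scalemxAl c); congr (_ *: _).
rewrite mulmx_sumr mulmx_suml; apply: eq_bigr => eta _.
rewrite !e !trmx_mul trmxK !mulmxA; congr (_ *m _ *m _).
by rewrite -[LHS]mulmxA OO mulmx1.
Qed.

(** Orthogonal conjugation of a representation conjugates [ntr] in the same way, so the spectral
    theorem selects the realization. *)
Lemma diagonal_realization :
  exists rho : forall la : intpart k, mx_representation R G (d la),
    [/\ forall la, mx_rsim (simple_repr R la) (rho la),
        forall la s, rho la s *m (rho la s)^T = 1%:M &
        forall la, is_diag_mx (ntr rho la)].
Proof.
have [rho [sim orth]] := orthogonal_realization R k.
have ex la : exists O : 'M[R]_(d la),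
    O *m O^T = 1%:M /\ is_diag_mx (O *m ntr rho la *m O^T).
  have [O [dl [OO e]]] := real_spectral (ntr_sym rho la).
  by exists O; rewrite e diag_mx_is_diag.
pose O la := projT1 (cid (ex la)).
have OO la : O la *m (O la)^T = 1%:M by have [] := projT2 (cid (ex la)).
have OO' la : (O la)^T *m O la = 1%:M by apply: mulmx1C.
have uO la : O la \in unitmx by have [] := mulmx1_unit (OO la).
have iO la : invmx (O la) = (O la)^T.
  by rewrite -[RHS]mulmx1 -(mulmxV (uO la)) mulmxA OO' mul1mx.
have e la s : rconj_repr (rho la) (uO la) s = O la *m rho la s *m (O la)^T.
  by rewrite rconj_mxE iO.
exists (fun la => rconj_repr (rho la) (uO la)); split.
- move=> la; apply: mx_rsim_trans (sim la) _.
  apply: (@MxReprSim _ _ _ _ _ _ _ (invmx (O la))) => // [|s _].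
    by rewrite row_free_unit unitmx_inv.
  by rewrite rconj_mxE !mulmxA mulVmx // mul1mx.
- move=> la s; rewrite e !trmx_mul trmxK -!mulmxA [(O la)^T *m (O la *m _)]mulmxA OO' mul1mx.
  by rewrite [rho la s *m (_ *m _)]mulmxA orth mul1mx.
- move=> la; rewrite (@ntr_conj rho (fun la => rconj_repr (rho la) (uO la)) la (O la)) //.
    by have [] := projT2 (cid (ex la)).
  exact: e.
Qed.

End Rotation.

(** * Asymptotics of the weights *)

Section Limits.
Local Open Scope classical_set_scope.
Variable R : realType.

Lemma cvgn_sum (V : normedModType R) (I : Type) (s : seq I) (P : pred I)
    (f : I -> nat -> V) (l : I -> V) :
  (forall i, f i n @[n --> \oo] --> l i) ->
  (\sum_(i <- s | P i) f i n) @[n --> \oo] --> \sum_(i <- s | P i) l i.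
Proof.
move=> fl; elim: s => [|i s IH].
  rewrite big_nil; under eq_fun do rewrite big_nil; exact: cvg_cst.
rewrite big_cons; under eq_fun do rewrite big_cons.
by case: ifP => _; [exact: cvgD|exact: IH].
Qed.

Lemma cvgn_inv : (n%:R^-1 : R) @[n --> \oo] --> (0 : R).
Proof. by rewrite -(cvg_shiftS (fun n => n%:R^-1 : R)); exact: cvg_harmonic. Qed.

Lemma cvgn_inv_sqrt : ((Num.sqrt (n%:R : R))^-1) @[n --> \oo] --> (0 : R).
Proof.
under eq_fun do rewrite -sqrtrV ?ler0n //.
have : Num.sqrt (n%:R^-1 : R) @[n --> \oo] --> Num.sqrt (0 : R).
  by apply: continuous_cvg cvgn_inv; exact: realfun.sqrt_continuous.
by rewrite sqrtr0.
Qed.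

Lemma cvgn_ffact j : ((n ^_ j)%:R / n%:R ^+ j : R) @[n --> \oo] --> (1 : R).
Proof.
elim: j => [|j IH].
  under eq_fun do rewrite ffactn0 expr0 divr1; exact: cvg_cst.
have h : ((n - j)%:R / n%:R : R) @[n --> \oo] --> (1 : R).
  apply: (@cvg_trans _ ((fun n => 1 - j%:R * n%:R^-1 : R) @ \oo)).
    apply: near_eq_cvg; near=> n.
    have nj : (j < n)%N by near: n; exact: nbhs_infty_gt.
    have n0 : n%:R != 0 :> R by rewrite pnatr_eq0; case: (n) nj.
    by rewrite natrB ?(ltnW nj) // mulrBl mulfV.
  have : (1 - j%:R * n%:R^-1 : R) @[n --> \oo] --> (1 - j%:R * 0 : R).
    apply: cvgB; first exact: cvg_cst.
    by apply: cvgM; [exact: cvg_cst|exact: cvgn_inv].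
  by rewrite mulr0 subr0.
rewrite -[X in _ --> X]mulr1.
apply: cvg_trans (cvgM IH h); apply: near_eq_cvg; near=> n => /=.
by rewrite ffactnSr natrM exprSr invfM mulrACA.
Unshelve. all: by end_near. Qed.

(** For m <= k and large n, the probability that two independent uniform k-subsets share exactly m
    elements. *)
Definition pair_weight k m n : R :=
  n`!%:R / (fiber_size k m n)%:R / 'C(n, k)%:R ^+ 2.

Definition pair_const k m : R := k`!%:R ^+ 2 / (m`! * (k - m)`! * (k - m)`!)%:R.

Lemma pair_weight_cvg k m : (m <= k)%N ->
  (n%:R ^+ m * pair_weight k m n) @[n --> \oo] --> pair_const k m.
Proof.
move=> mk; have f0 q : q`!%:R != 0 :> R by rewrite pnatr_eq0 -lt0n fact_gt0.
have lim : (pair_const k m * (((n ^_ (k + (k - m)))%:R / n%:R ^+ (k + (k - m))) *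
    ((n ^_ k)%:R / n%:R ^+ k)^-1 ^+ 2)) @[n --> \oo] --> (pair_const k m * (1 * 1^-1 ^+ 2) : R).
  apply: cvgM; first exact: cvg_cst.
  apply: cvgM; first exact: cvgn_ffact.
  rewrite expr2; under eq_fun do rewrite expr2.
  by apply: cvgM; apply: cvgV; rewrite ?oner_eq0 //; exact: cvgn_ffact.
rewrite invr1 expr1n !mulr1 in lim; apply: cvg_trans lim.
apply: near_eq_cvg; near=> n.
have n2 : (k + k < n)%N by near: n; exact: nbhs_infty_gt.
have Nn : (k + (k - m) <= n)%N by lia.
have n0 : n%:R != 0 :> R by rewrite pnatr_eq0; lia.
have kn : (k <= n)%N by lia.
have e1 : n`!%:R = (n ^_ (k + (k - m)))%:R * (n - (k + (k - m)))`!%:R :> R.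
  by rewrite -natrM ffact_fact.
have e2 : 'C(n, k)%:R = (n ^_ k)%:R / k`!%:R :> R.
  by rewrite -bin_ffact natrM mulfK.
have k0 : (n ^_ k)%:R != 0 :> R by rewrite pnatr_eq0 -lt0n ffact_gt0.
have e3 : n%:R ^+ k * n%:R ^+ k = n%:R ^+ m * n%:R ^+ (k + (k - m)) :> R.
  by rewrite -!exprD; congr (_ ^+ _); lia.
have p0 j : n%:R ^+ j != 0 :> R by rewrite expf_neq0.
rewrite /pair_weight /pair_const /fiber_size e1 e2 !natrM.
have e4 : n%:R ^+ m = n%:R ^+ k * n%:R ^+ k / n%:R ^+ (k + (k - m)) :> R by rewrite e3 mulfK.
rewrite e4; field.
by rewrite !f0 !p0 k0.
Unshelve. all: by end_near. Qed.

Lemma powR_half n r : (n%:R : R) `^ (r%:R / 2) = Num.sqrt n%:R ^+ r.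
Proof.
rewrite mulrC powRrM powR12_sqrt ?ler0n // powR_mulrn //; exact: sqrtr_ge0.
Qed.

(* [0 ^+ j] is 1 for [j = 0] and 0 otherwise: only the matching levels survive. *)
Lemma scaled_weight_cvg k m r r' : (r <= m)%N -> (r' <= m)%N -> (m <= k)%N ->
  ((n%:R : R) `^ (r%:R / 2) * (n%:R : R) `^ (r'%:R / 2) * pair_weight k m n)
    @[n --> \oo] --> (0 ^+ (m - r) * 0 ^+ (m - r') * pair_const k m : R).
Proof.
move=> rm rm' mk.
have pw j : ((Num.sqrt (n%:R : R))^-1 ^+ j) @[n --> \oo] --> (0 ^+ j : R).
  elim: j => [|j IH]; first by under eq_fun do rewrite expr0; exact: cvg_cst.
  rewrite exprS; under eq_fun do rewrite exprS.
  by apply: cvgM; [exact: cvgn_inv_sqrt|exact: IH].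
apply: cvg_trans (cvgM (cvgM (pw (m - r)%N) (pw (m - r')%N)) (pair_weight_cvg mk)).
apply: near_eq_cvg; near=> n => /=.
have n0 : (0 < n)%N by near: n; exact: nbhs_infty_gt.
have s0 : Num.sqrt (n%:R : R) != 0 by rewrite sqrtr_eq0 -ltNge ltr0n.
rewrite !powR_half mulrA; congr (_ * _).
have e : n%:R ^+ m = Num.sqrt (n%:R : R) ^+ m * Num.sqrt (n%:R : R) ^+ m.
  by rewrite -exprMn -expr2 sqr_sqrtr ?ler0n.
rewrite e; have aux a : (a <= m)%N ->
    (Num.sqrt (n%:R : R))^-1 ^+ (m - a) * Num.sqrt (n%:R : R) ^+ m = Num.sqrt (n%:R : R) ^+ a.
  move=> am; rewrite -{2}(subnK am) exprD mulrA -exprMn mulVf // expr1n mul1r //.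
by rewrite mulrACA !aux.
Unshelve. all: by end_near. Qed.

Lemma pair_const_gt0 k m : 0 < pair_const k m.
Proof.
by rewrite divr_gt0 ?exprn_gt0 // ltr0n ?muln_gt0 ?fact_gt0.
Qed.

End Limits.

(** * The limit in the basis of matrix elements *)

Section Limit.
Variables (R : realType) (k : nat).
Local Notation G := [set: 'S_k]%G.
Local Notation d la := (dim_simple R la).
Implicit Types la mu : intpart k.
Variable rho : forall la, mx_representation R G (d la).
Hypothesis k_gt0 : (0 < k)%N.
Hypothesis rho_sim : forall la, mx_rsim (simple_repr R la) (rho la).
Hypothesis rho_orth : forall la s, rho la s *m (rho la s)^T = 1%:M.
Hypothesis rho_diag : forall la, is_diag_mx (ntr rho la).
Local Notation melt := (melt R k).
Local Notation U := (melt_mx rho).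
Local Notation scale la := (Num.sqrt ((d la)%:R / k`!%:R) : R).

Lemma level_lt la : (level la < k)%N.
Proof.
rewrite /level ltn_subrL k_gt0 andbT.
have := sumn_parts la; have := parts_neq0 la; case: (parts la) => [|x s] /=.
  by move=> _ e; move: k_gt0; rewrite -e.
by rewrite inE negb_or eq_sym lt0n => /andP[].
Qed.

Definition coef n (pi : 'S_n) (x : melt) : R :=
  (profile R k pi *m (melt_row rho x)^T) 0 0.

Lemma coefE n (pi : 'S_n) (x : melt) :
  coef pi x = scale (tag x) *
    patsum (fun s => rho (tag x) s (tagged x).2 (tagged x).1) pi / 'C(n, k)%:R.
Proof.
rewrite /coef mxE /patsum -(sum_enum_val (fun s => _ * _)) mulr_sumr mulr_suml.
apply: eq_bigr => a _; rewrite [X in _ * X]mxE [X in _ * X]mxE matrix_elementE.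
by rewrite mxE /density; ring.
Qed.

Lemma profile_expand n (pi : 'S_n) :
  profile R k pi = \sum_a coef pi (melt_of R a) *: melt_row rho (melt_of R a).
Proof.
have UU : U *m U^T = 1%:M by apply: mulmx1C; exact: melt_mx_orth.
rewrite -[LHS]mulmx1 -UU mulmxA; apply/rowP => b; rewrite mxE summxE.
apply: eq_bigr => a _; rewrite [RHS]mxE; congr (_ * _); last by rewrite !mxE.
rewrite [LHS]mxE /coef [RHS]mxE; apply: eq_bigr => c _; congr (_ * _).
by rewrite mxE [RHS]mxE.
Qed.

Lemma proj_V_melt r (x : melt) :
  proj_V r (melt_row rho x) =
  if head 0%N (parts (tag x)) == (k - r)%N then melt_row rho x else 0.
Proof.
have := proj_V_element rho_sim rho_orth r (tagged x).1 (tagged x).2.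
rewrite /proj_V /melt_row -scalemxAl => ->.
by case: ifP; rewrite ?scaler0.
Qed.

Definition zrow n (pi : 'S_n) : 'rV[R]_(nSym k) :=
  \row_a ((n%:R : R) `^ ((level (tag (melt_of R a)))%:R / 2) * coef pi (melt_of R a)).

(** Each basis vector lies in the single subspace V_r with r its level, so exactly one scaling
    reaches it. *)
Lemma normalized_profileE n (pi : 'S_n) : normalized_profile R k pi = zrow pi *m U^T.
Proof.
transitivity (\sum_a (zrow pi) 0 a *: melt_row rho (melt_of R a)); last first.
  apply/rowP => b; rewrite mxE summxE; apply: eq_bigr => a _.
  by rewrite [LHS]mxE; congr (_ * _); rewrite !mxE.
rewrite /normalized_profile.
transitivity (\sum_(r < k) \sum_a ((n%:R : R) `^ (r%:R / 2) * coef pi (melt_of R a)) *: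
    proj_V r (melt_row rho (melt_of R a))).
  apply: eq_bigr => r _; rewrite {1}profile_expand /proj_V mulmx_suml scaler_sumr.
  by apply: eq_bigr => a _; rewrite -scalemxAl scalerA.
rewrite exchange_big /=; apply: eq_bigr => a _.
set x := melt_of R a; have lx := level_lt (tag x).
rewrite (bigD1 (Ordinal lx)) //= big1 ?addr0 => [|r ne].
  by rewrite proj_V_melt -head_level eqxx mxE.
rewrite proj_V_melt; case: eqP => [e|]; last by rewrite scaler0.
case/eqP: ne; apply: val_inj => /=; rewrite /level e subKn //; exact: ltnW.
Qed.

Definition moment_mx n : 'M[R]_(nSym k) :=
  \matrix_(a, b) (n`!%:R^-1 * \sum_(pi : 'S_n) zrow pi 0 a * zrow pi 0 b).

Lemma second_momentE n : second_moment R k n = U *m moment_mx n *m U^T.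
Proof.
have -> : moment_mx n = n`!%:R^-1 *: \sum_(pi : 'S_n) (zrow pi)^T *m zrow pi.
  apply/matrixP => a b; rewrite !mxE; congr (_ * _); rewrite summxE.
  by apply: eq_bigr => pi _; rewrite [RHS]mxE big_ord1; congr (_ * _); rewrite [RHS]mxE.
rewrite /second_moment -scalemxAr -scalemxAl; congr (_ *: _).
rewrite mulmx_sumr mulmx_suml; apply: eq_bigr => pi _.
by rewrite normalized_profileE trmx_mul trmxK !mulmxA.
Qed.

Definition cross_dot m (x y : melt) : R :=
  \sum_a \sum_b
    cross rho m (tag x) (tag y) (tagged x).1 (tagged y).1 a b *
    cross rho m (tag x) (tag y) (tagged x).2 (tagged y).2 a b.

Lemma moment_mxE n a b : (k + k <= n)%N ->
  moment_mx n a b = \sum_(m < k.+1)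
    ((n%:R : R) `^ ((level (tag (melt_of R a)))%:R / 2) *
     (n%:R : R) `^ ((level (tag (melt_of R b)))%:R / 2) * pair_weight R k m n) *
    (scale (tag (melt_of R a)) * scale (tag (melt_of R b)) * cross_dot m (melt_of R a) (melt_of R b)).
Proof.
move=> kn; rewrite mxE; set x := melt_of R a; set y := melt_of R b.
set p := (n%:R : R) `^ _; set q := (n%:R : R) `^ _.
have n0 : n`!%:R != 0 :> R by rewrite pnatr_eq0 -lt0n fact_gt0.
transitivity (p * q * scale (tag x) * scale (tag y) / n`!%:R / 'C(n, k)%:R ^+ 2 *
    \sum_(pi : 'S_n) patsum (fun s => rho (tag x) s (tagged x).2 (tagged x).1) pi *
      patsum (fun s => rho (tag y) s (tagged y).2 (tagged y).1) pi).
  rewrite mulr_sumr mulr_sumr; apply: eq_bigr => pi _; rewrite !mxE -/x -/y -/p -/q.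
  by rewrite !coefE -exprVn; ring.
rewrite (second_moment_rho kn rho_orth) mulr_sumr; apply: eq_bigr => m _.
rewrite /cross_dot /pair_weight; set S := \sum_(_ < _) _.
rewrite (_ : n`!%:R ^+ 2 * S = n`!%:R * (n`!%:R * S)); last by ring.
have c0 : 'C(n, k)%:R ^+ 2 != 0 :> R by rewrite expf_neq0 // pnatr_eq0 -lt0n bin_gt0; lia.
set f := (fiber_size _ _ _)%:R^-1; move: c0; set c := 'C(n, k)%:R ^+ 2 => c0.
by field; rewrite ?n0 ?c0.
Qed.

(** For [m] below one of the levels the scaled weight need not converge; the value 0 is right for
    the product because [cross_dot] vanishes there. *)
Definition level_limit m r r' : R :=
  if (r <= m)%N && (r' <= m)%N then 0 ^+ (m - r) * 0 ^+ (m - r') * pair_const R k m else 0.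

Definition limit_mx : 'M[R]_(nSym k) := \matrix_(a, b) \sum_(m < k.+1)
  level_limit m (level (tag (melt_of R a : melt))) (level (tag (melt_of R b : melt))) *
  (scale (tag (melt_of R a : melt)) * scale (tag (melt_of R b : melt)) *
   cross_dot m (melt_of R a) (melt_of R b)).

Local Open Scope classical_set_scope.

Lemma moment_mx_cvg a b : moment_mx n a b @[n --> \oo] --> limit_mx a b.
Proof.
rewrite mxE; apply: cvg_trans; last first.
  apply: cvgn_sum => m; instantiate (1 := fun m n =>
    ((n%:R : R) `^ ((level (tag (melt_of R a : melt)))%:R / 2) *
     (n%:R : R) `^ ((level (tag (melt_of R b : melt)))%:R / 2) * pair_weight R k m n) *
    (scale (tag (melt_of R a : melt)) * scale (tag (melt_of R b : melt)) *
     cross_dot m (melt_of R a) (melt_of R b))).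
  rewrite /level_limit; case: ifP => [/andP[h1 h2]|h].
    apply: cvgM; last exact: cvg_cst.
    by apply: scaled_weight_cvg => //; rewrite -ltnS.
  have -> : cross_dot m (melt_of R a) (melt_of R b) = 0.
    rewrite /cross_dot big1 // => i _; rewrite big1 // => j _.
    move: h => /negbT; rewrite negb_and -!ltnNge => /orP[] lt.
      by rewrite (cross0_l rho_sim) // mxE mul0r.
    by rewrite (cross0_r rho_sim rho_orth) // mxE mul0r.
  under eq_fun do rewrite !mulr0; rewrite !mulr0; exact: cvg_cst.
apply: near_eq_cvg; near=> n; rewrite moment_mxE //.
near: n; exact: nbhs_infty_ge.
Unshelve. all: by end_near. Qed.

(** The matrix is a combination of fixed rank-one matrices with entries of [moment_mx] as
    coefficients, so scalar limits suffice. *)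
Lemma second_moment_cvg : second_moment R k n @[n --> \oo] --> U *m limit_mx *m U^T.
Proof.
have expand (M : 'M[R]_(nSym k)) :
    U *m M *m U^T = \sum_a \sum_b M a b *: (col a U *m row b U^T).
  apply/matrixP => i j; rewrite mxE summxE.
  under eq_bigr => b _ do rewrite [X in X * _]mxE mulr_suml.
  rewrite exchange_big /=; apply: eq_bigr => a _; rewrite summxE; apply: eq_bigr => b _.
  have e : (col a U *m row b U^T) i j = U i a * U^T b j.
    by rewrite mxE big_ord1 [col a U _ _]mxE [row b _ _ _]mxE.
  by rewrite [RHS]mxE e; ring.
rewrite expand; under eq_fun do rewrite second_momentE expand.
apply: cvgn_sum => a; apply: cvgn_sum => b.
by apply: cvgZr_tmp; exact: moment_mx_cvg.
Qed.

(** Only m equal to both levels survives. There distinct representations have zero cross average,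
    and within one representation an off-diagonal entry of the diagonal [ntr] appears as a
    factor. *)
Lemma limit_mx_diag : is_diag_mx limit_mx.
Proof.
apply/is_diag_mxP => a b ab; rewrite mxE big1 // => m _.
rewrite /level_limit; case: ifP => [/andP[h1 h2]|_]; last by rewrite mul0r.
have [e1|ne] := eqVneq (m - level (tag (melt_of R a : melt)))%N 0%N; last first.
  by rewrite (expr0n _ (m - _)) (negPf ne) !mul0r.
have [e2|ne] := eqVneq (m - level (tag (melt_of R b : melt)))%N 0%N; last first.
  by rewrite [X in _ * X * _ * _]expr0n (negPf ne) mulr0 !mul0r.
have l1 : level (tag (melt_of R a : melt)) = m by apply/eqP; rewrite eqn_leq h1 -subn_eq0 e1.
have l2 : level (tag (melt_of R b : melt)) = m by apply/eqP; rewrite eqn_leq h2 -subn_eq0 e2.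
suff -> : cross_dot m (melt_of R a) (melt_of R b) = 0 by rewrite !mulr0.
have : melt_of R a != melt_of R b :> melt.
  by apply: contra ab => /eqP/(can_inj (@melt_ofK R k)) ->.
move: (melt_of R a : melt) (melt_of R b : melt) l1 l2 => [la [i j]] [mu [i' j']] /= l1 l2 ne.
rewrite /cross_dot /= big1 // => x _; rewrite big1 // => y _.
have [e|neq] := eqVneq la mu; last first.
  by rewrite (cross_level_neq rho_sim rho_orth) // mxE mul0r.
subst mu; rewrite -l1 !(cross_level_eq rho_sim rho_orth).
have diag0 u v : u != v -> ntr rho la u v = 0.
  by move=> uv; have /is_diag_mxP := rho_diag la; apply.
move: ne; rewrite eq_Tagged /= xpair_eqE negb_and => /orP[] /diag0 ->.
  by rewrite mul0r scale0r mxE mul0r.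
by rewrite mul0r scale0r [X in _ * X]mxE mulr0.
Qed.

(** The one surviving term is a positive constant times two diagonal entries of the positive
    definite [ntr]. *)
Lemma limit_mx_gt0 a : 0 < limit_mx a a.
Proof.
rewrite mxE; set x := melt_of R a : melt; set m0 := level (tag x).
have mk : (m0 < k.+1)%N by rewrite ltnS level_le.
rewrite (bigD1 (Ordinal mk)) //= big1 ?addr0 => [|m ne]; last first.
  rewrite /level_limit; case: ifP => [/andP[h1 _]|_]; last by rewrite mul0r.
  rewrite (expr0n _ (m - _)) subn_eq0 leqNgt ltn_neqAle h1 andbT.
  have -> : (m0 != m)%N by apply: contraNneq ne => e; apply/eqP/val_inj.
  by rewrite !mul0r.
rewrite /level_limit leqnn /= subnn expr0 !mul1r.
have sc : 0 < scale (tag x).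
  by rewrite sqrtr_gt0 divr_gt0 ?ltr0n ?fact_gt0 // (rho_dim_gt0 rho_sim).
rewrite mulr_gt0 ?pair_const_gt0 // mulr_gt0 ?mulr_gt0 //.
have t0 := E_trace_gt0 rho_sim rho_orth (tag x).
have nt i : 0 < ntr rho (tag x) i i.
  have := @ntr_gt0 _ _ _ rho_sim rho_orth (tag x) (delta_mx i 0).
  rewrite trmx_delta -rowE -colE 2!mxE; apply.
  by apply/eqP => /matrixP/(_ i 0)/eqP; rewrite !mxE !eqxx oner_eq0.
rewrite /cross_dot /m0 !(cross_level_eq rho_sim rho_orth).
set E := inv_proj _ _ _; set c1 := _ / _; set c2 := _ / _.
have c1p : 0 < c1 by rewrite divr_gt0.
have c2p : 0 < c2 by rewrite divr_gt0.
(* For a symmetric idempotent E the sum of squared entries is its trace. *)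
have -> : \sum_i \sum_j (c1 *: E) i j * (c2 *: E) i j = c1 * c2 * \tr E.
  have -> : \tr E = \tr (E *m E^T) by rewrite inv_proj_tr // inv_proj_idem.
  rewrite /mxtrace mulr_sumr; apply: eq_bigr => i _; rewrite [X in _ * X]mxE mulr_sumr.
  by apply: eq_bigr => j _; rewrite [X in X * _]mxE [X in _ * X = _]mxE [E^T _ _]mxE; ring.
by rewrite mulr_gt0 // mulr_gt0.
Qed.

End Limit.

Theorem proposition5 (R : realType) (k : nat) (k_gt0 : (0 < k)%N)
    (k_le6 : (k <= 6)%N) :
  cvgn (@second_moment R k) /\
  exists (U D : 'M[R]_(nSym k)),
    [/\ U^T *m U = 1%:M,
        is_diag_mx D /\ (forall a, 0 < D a a),
        U^T *m limit_second_moment R k *m U = D &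
        exists rho : forall la : intpart k,
            mx_representation R [set: 'S_k] (dim_simple R la),
          [/\ forall la, mx_rsim (simple_repr R la) (rho la),
              forall la s, rho la s *m (rho la s)^T = 1%:M &
              exists c : {la : intpart k &
                          ('I_(dim_simple R la) * 'I_(dim_simple R la))%type} ->
                         'I_(nSym k),
                bijective c /\
                forall la i j,
                  col (c (existT _ la (i, j))) U =
                  Num.sqrt ((dim_simple R la)%:R / (k`!)%:R) *:
                    (matrix_element (rho la) i j)^T]].
Proof.
have [rho [sim orth diag]] := diagonal_realization R k.
have cvg := second_moment_cvg k_gt0 sim orth.
split; first by apply/cvg_ex; exists (melt_mx rho *m limit_mx rho *m (melt_mx rho)^T).
have UU := melt_mx_orth sim orth.
exists (melt_mx rho), (limit_mx rho); split=> //.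
- split; first exact: limit_mx_diag sim orth diag.
  exact: limit_mx_gt0 sim orth.
- have -> : limit_second_moment R k = melt_mx rho *m limit_mx rho *m (melt_mx rho)^T.
    exact: (cvg_lim (@norm_hausdorff _ _) cvg).
  by rewrite !mulmxA UU mul1mx -mulmxA UU mulmx1.
exists rho; split=> //; exists (@melt_idx R k); split.
  by exists (@melt_of R k); [exact: melt_idxK|exact: melt_ofK].
move=> la i j; apply/matrixP => a b; rewrite ord1 mxE mxE melt_idxK.
by rewrite /melt_row mxE [RHS]mxE [in RHS]mxE.
Qed.
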